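(* There exists an absolute constant $C$ such that the following holds. Let $N_1,N_2,L_1,L_2>0$, let $\pm_1,\pm_2\in\{+,-\}$ be arbitrary signs, let $r>0$ and $\omega\in\mathbb S^2$, and let $T_r(\omega)\subset\mathbb R^3$ be the tube of radius $r$ around the axis $\mathbb R\omega$. Let $u_1,u_2\in L^2(\mathbb R^{1+3})$ satisfy $\operatorname{supp}\widehat{u_j}\subset K^{\pm_j}_{N_j,L_j}$ for $j=1,2$. Then $$\bigl\|\mathfrak B_{\theta_{12}}(\mathbf P_{\mathbb R\times T_r(\omega)}u_1,u_2)\bigr\|\le C\,(r^2L_1L_2)^{1/2}\,\|u_1\|\,\|u_2\|.$$
   Context: Points of $\mathbb R^{1+3}$ are written $X=(\tau,\xi)$ with $\tau\in\mathbb R$, $\xi\in\mathbb R^3$ (Fourier variables of $(t,x)$); $\|\cdot\|$ is the norm of $L^2(\mathbb R^{1+3})$; $\widehat u=\mathcal Fu$ is the space-time Fourier transform. For $N,L>0$ and a sign $\pm$, $$K^{\pm}_{N,L}=\Bigl\{(\tau,\xi)\in\mathbb R^{1+3}:\ \tfrac N2<|\xi|\le N,\ \bigl|-\tau\pm|\xi|\bigr|\le L\Bigr\}.$$ The statement $\operatorname{supp}\widehat u\subset A$ means that $\widehat u$ vanishes almost everywhere outside $A$. For measurable $A\subset\mathbb R^{1+3}$, $\mathbf P_A$ is the Fourier multiplier with symbol $\chi_A$. The tube is $T_r(\omega)=\{\xi\in\mathbb R^3:\operatorname{dist}(\xi,\mathbb R\omega)\le r\}$. For nonzero $a,b\in\mathbb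 R^3$, $\theta(a,b)\in[0,\pi]$ is the angle between $a$ and $b$. With $X_j=(\tau_j,\xi_j)$ and $\theta_{12}=\theta(\pm_1\xi_1,\pm_2\xi_2)$, the bilinear operator $\mathfrak B_{\theta_{12}}$ is defined by $$\mathcal F\bigl(\mathfrak B_{\theta_{12}}(u_1,u_2)\bigr)(X_0)=\iint\theta_{12}\,\widehat{u_1}(X_1)\widehat{u_2}(X_2)\,\delta(X_0-X_1-X_2)\,dX_1\,dX_2,$$ i.e. the integral over $X_1\in\mathbb R^{1+3}$ with $X_2=X_0-X_1$. *)

(* Defs.v *)
From HB Require Import structures.
From mathcomp Require Import all_boot all_order all_algebra.
From mathcomp Require Import complex.
From mathcomp Require Import all_classical all_reals all_analysis.
Set Implicit Arguments.
Unset Strict Implicit.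
Unset Printing Implicit Defensive.
Import Order.TTheory GRing.Theory Num.Theory.
Import numFieldNormedType.Exports.
Local Open Scope classical_set_scope.
Local Open Scope ring_scope.
Local Open Scope complex_scope.

Notation R3 R := (measurableTypeR R * measurableTypeR R * measurableTypeR R)%type.
Notation R13 R := (measurableTypeR R * R3 R)%type.

Section Euclidean.
Variable R : realType.
Implicit Types (a b w : R3 R) (r s : R).

Definition dot3 a b : R := a.1.1 * b.1.1 + a.1.2 * b.1.2 + a.2 * b.2.

Definition norm3 a : R := Num.sqrt (dot3 a a).

Definition scale3 s a : R3 R := (s * a.1.1, s * a.1.2, s * a.2).

Definition sphere2 : set (R3 R) := [set w | norm3 w = 1].

Definition dist3 a (A : set (R3 R)) : R := inf [set norm3 (a - b) | b in A].

Definition axis w : set (R3 R) := [set scale3 s w | s in [set: R]].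

Definition tube r w : set (R3 R) := [set a | dist3 a (axis w) <= r].

(* For nonzero [a] and [b] this is the angle in [0, pi]; the value [acos 0]
   obtained when one of them vanishes plays no role. *)
Definition angle a b : R := acos (dot3 a b / (norm3 a * norm3 b)).

End Euclidean.

Section ProductLebesgue.
Local Open Scope ereal_scope.

(* In mathcomp-analysis 1.16 the canonical sigma-finite structure of [m1 \x m2]
   is only found for subprobabilities, hence this lemma and the named product
   measures below. *)
Lemma product_sigma_finite (d1 d2 : measure_display) (T1 : measurableType d1)
    (T2 : measurableType d2) (R : realType)
    (m1 : {sigma_finite_measure set T1 -> \bar R})
    (m2 : {sigma_finite_measure set T2 -> \bar R}) :
  sigma_finite [set: T1 * T2] (m1 \x m2).
Proof.
have /sigma_finiteP[F [TF ndF Foo]] := sigma_finiteT m1.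
have /sigma_finiteP[G [TG ndG Goo]] := sigma_finiteT m2.
exists (fun n => F n `*` G n).
  rewrite -setXTT TF TG predeqE => -[x y]; split.
    move=> [/= [n _ Fnx] [k _ Gky]]; exists (maxn n k) => //; split.
    - by move: x Fnx; exact/subsetPset/ndF/leq_maxl.
    - by move: y Gky; exact/subsetPset/ndG/leq_maxr.
  by move=> [n _ []/= ? ?]; split; exists n.
move=> k; have [? ?] := Foo k; have [? ?] := Goo k.
split; first exact: measurableX.
by rewrite product_measure1E// lte_mul_pinfty// ge0_fin_numE.
Qed.

Variable R : realType.

Definition lebesgue2 : set (measurableTypeR R * measurableTypeR R) -> \bar R :=
  @lebesgue_measure R \x @lebesgue_measure R.
HB.instance Definition _ := Measure.on lebesgue2.
HB.instance Definition _ := Measure_isSigmaFinite.Build _ _ _ lebesgue2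
  (product_sigma_finite (@lebesgue_measure R) (@lebesgue_measure R)).

Definition lebesgue3 : set (R3 R) -> \bar R := lebesgue2 \x @lebesgue_measure R.
HB.instance Definition _ := Measure.on lebesgue3.
HB.instance Definition _ := Measure_isSigmaFinite.Build _ _ _ lebesgue3
  (product_sigma_finite lebesgue2 (@lebesgue_measure R)).

Definition lebesgue13 : set (R13 R) -> \bar R := @lebesgue_measure R \x lebesgue3.
HB.instance Definition _ := Measure.on lebesgue13.
HB.instance Definition _ := Measure_isSigmaFinite.Build _ _ _ lebesgue13
  (product_sigma_finite (@lebesgue_measure R) lebesgue3).

End ProductLebesgue.

Section ComplexFunctions.
Variable R : realType.
Implicit Types (f g u v : R13 R -> R[i]) (p : R).

Definition cmeasurable f : Prop :=
  measurable_fun [set: R13 R] (fun x => complex.Re (f x)) /\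
  measurable_fun [set: R13 R] (fun x => complex.Im (f x)).

Definition cintegral f : R[i] :=
  (\int[@lebesgue13 R]_x complex.Re (f x)) +i* (\int[@lebesgue13 R]_x complex.Im (f x)).

Definition Lpnorm p f : \bar R :=
  Lnorm (@lebesgue13 R) p%:E (fun x => (Normc.normc (f x))%:E).

Definition in_Lp p f : Prop := cmeasurable f /\ (Lpnorm p f < +oo)%E.

Definition dot13 (x X : R13 R) : R := x.1 * X.1 + dot3 x.2 X.2.

(* The integral of e^{-i x.X} f(x) over x, meaningful for integrable [f]. *)
Definition fourier_integral f (X : R13 R) : R[i] :=
  cintegral (fun x => (cos (dot13 x X) -i* sin (dot13 x X)) * f x).

(* [v] is the Fourier transform of [u] on L^2: the graph of the L^2 transform
   is the closure in L^2 x L^2 of the graph of [fourier_integral] on the dense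
   subspace L^1 & L^2. *)
Definition is_fourier u v : Prop :=
  [/\ in_Lp 2 u, in_Lp 2 v &
    exists f : nat -> R13 R -> R[i],
      [/\ forall n, in_Lp 1 (f n) /\ in_Lp 2 (f n),
          (fun n => Lpnorm 2 (f n \- u)) @ \oo --> 0%E &
          (fun n => Lpnorm 2 (fourier_integral (f n) \- v)) @ \oo --> 0%E]].

(* By the Plancherel theorem the L^2 Fourier transform is a bijection of L^2 up
   to almost everywhere equality, so on L^2 both functions below return a
   representative of the intended class; the default value 0 is only for
   arguments outside L^2. *)
Definition fourier u : R13 R -> R[i] := xget (cst 0) [set v | is_fourier u v].

Definition inv_fourier v : R13 R -> R[i] := xget (cst 0) [set u | is_fourier u v].

Definition supp_fourier_sub u (A : set (R13 R)) : Prop :=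
  {ae @lebesgue13 R, forall X, ~ A X -> fourier u X = 0}.

Definition multiplier (A : set (R13 R)) u : R13 R -> R[i] :=
  inv_fourier (fun X => (\1_A X)%:C * fourier u X).

End ComplexFunctions.

Section Bilinear.
Variable R : realType.

(* A sign is a boolean, [true] standing for +. *)
Definition sgn (s : bool) : R := if s then 1 else -1.

Definition cone_region (s : bool) (N L : R) : set (R13 R) :=
  [set X | N / 2 < norm3 X.2 <= N /\ `| - X.1 + sgn s * norm3 X.2 | <= L].

Definition theta12 (s1 s2 : bool) (X1 X2 : R13 R) : R :=
  angle (scale3 (sgn s1) X1.2) (scale3 (sgn s2) X2.2).

(* The Fourier transform of the bilinear expression. The latter is defined as an
   element of L^2 exactly when this function is in L^2. *)
Definition angle_bilinear_hat (s1 s2 : bool) (u1 u2 : R13 R -> R[i]) (X0 : R13 R) :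
    R[i] :=
  cintegral (fun X1 =>
    (theta12 s1 s2 X1 (X0 - X1))%:C * fourier u1 X1 * fourier u2 (X0 - X1)).

Definition angle_bilinear (s1 s2 : bool) (u1 u2 : R13 R -> R[i]) : R13 R -> R[i] :=
  inv_fourier (angle_bilinear_hat s1 s2 u1 u2).

End Bilinear.

(* Main.v *)
(* Write F1 for the transform of P u1, which lives on the cone region
   intersected with the tube, and F2 for that of u2.  Cauchy-Schwarz in X1 gives
     |B(X0)|^2 <= k(X0) . int |F1(X1)|^2 |F2(X0 - X1)|^2 dX1,
   where k(X0) is the integral of theta12^2 over the X1 allowed by the supports;
   integrating in X0, it suffices to show that k(X0) = O(r^2 L1 L2).
   Integrating in tau1 leaves the factor min(L1, L2) and the condition that
   +-|xi| +- |xi0 - xi| lies in an interval of length O(max(L1, L2)).  Along a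
   ray xi = z w, |w| = 1, the derivative in z of this quantity is
   +-(1 - cos theta12), and theta^2 <= 8 (1 - cos theta), so the integral of
   theta12^2 over z is O(max(L1, L2)) without any loss at small angles.  The
   remaining factor z^2 dw is at most N1^2 times the measure of the directions
   meeting the tube at distance comparable to N1, which is O((r / N1)^2).  The
   directions are parametrised by the faces of a cube rather than by the sphere.

   Only two-sided L^2 bounds of the Fourier transform with some constant are
   needed.  Plancherel for integrable functions is proved on the line by Poisson
   summability and transferred to products by Fubini. *)

Require Import Defs.
From mathcomp Require Import all_boot all_order all_algebra.
From mathcomp Require Import complex.
From mathcomp Require Import all_classical all_reals all_analysis.
From mathcomp Require Import measurable_realfun ring lra.
Set Implicit Arguments.
Unset Strict Implicit.
Unset Printing Implicit Defensive.
Import Order.TTheory GRing.Theory Num.Theory.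
Import numFieldNormedType.Exports.
Local Open Scope classical_set_scope.
Local Open Scope ring_scope.

(** The phase is monotone along a ray, but its speed degenerates where the angle is small, so no
    change of variables is made. Instead the indicator of the interval is dominated by a rational
    bump whose primitive is an arctangent: bump times (1 - cos theta12) is then, up to sign, an
    exact derivative, and the ray integral is a difference of two arctangents. If the ray runs into
    xi0, the phase has a corner there; the square root in it is therefore smoothed, and the uniform
    bound passes to the limit by dominated convergence. On a cube face the substitution (z, q) ->
    (z, zq) has the plain Jacobian z^2, and the direction vectors have length between 1 and 2, which
    costs only constants. On the Fourier side, Poisson summability turns Plancherel into an exact
    identity at each scale: the weighted spectrum plus a nonnegative defect is constant. Since the
    transforms are picked by [xget], each is a genuine transform or the zero function, and the norm
    bounds are checked on both alternatives. *)

Lemma measurable_sqrt (R : realType) : measurable_fun setT (@Num.sqrt R).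
Proof. by apply: continuous_measurable_fun; exact: sqrt_continuous. Qed.

(** * Affine changes of variable on the line *)

Section change_of_variables.
Variable R : realType.
Local Notation mu := (@lebesgue_measure R).
Local Notation TR := (measurableTypeR R).
Local Open Scope ereal_scope.

Definition affine (a b : R) : TR -> TR := fun x => (a * x + b)%R.

Lemma measurable_affine (a b : R) : measurable_fun [set: TR] (affine a b).
Proof. by apply: measurable_funD => //; exact: measurable_funM. Qed.

Definition affine_image (a b : R) : {measure set TR -> \bar R} :=
  measure_function_pushforward__canonical__measure_function_Measure mu
    (measurable_affine a b).

(** Uniqueness of Lebesgue measure reduces the claim to half-open intervals. For negative [a] the
    preimage is open on the other side, which leaves its length unchanged. *)
Lemma lebesgue_measure_affine (a b : R) (na : {nonneg R}) : a != 0%R ->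
  na%:num = `|a|%R -> forall A, measurable A ->
  mscale na (affine_image a b) A = mu A.
Proof.
move=> a0 naE A mA; apply/esym; apply: lebesgue_measure_unique => //= _ [[p q]] _ <-.
rewrite /= /mscale /= naE /pushforward /= /affine.
have [pq|qp] := ltP p q; last first.
  rewrite lebesgue_measure_itv /= lte_fin ltNge qp /=.
  rewrite (_ : _ @^-1` _ = set0) ?measure0 ?mule0// -subset0 => x /=.
  by rewrite in_itv/= => /andP[px /(lt_le_trans px)]; rewrite ltNge qp.
rewrite lebesgue_measure_itv /= lte_fin pq.
have [agt0|] := ltP 0%R a.
- rewrite (_ : _ @^-1` _ = `]((p - b) / a)%R, ((q - b) / a)%R]%classic).
    rewrite lebesgue_measure_itv /= lte_fin ltr_pM2r ?invr_gt0// ltrD2r pq.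
    by rewrite gtr0_norm// -EFinB -EFinM; congr EFin; field.
  apply/seteqP; split => x /=; rewrite !in_itv/= ltr_pdivrMr// ler_pdivlMr//;
    by rewrite ltrBlDr lerBrDr mulrC.
- rewrite le_eqVlt (negbTE a0) /= => alt0.
  rewrite (_ : _ @^-1` _ = `[((q - b) / a)%R, ((p - b) / a)%R[%classic).
    rewrite lebesgue_measure_itv /= lte_fin ltr_nM2r ?invr_lt0// ltrD2r pq.
    by rewrite ltr0_norm// -EFinB -EFinM; congr EFin; field.
  apply/seteqP; split => x /=; rewrite !in_itv/= ltr_ndivlMr// ler_ndivrMr//;
    by rewrite ltrBlDr lerBrDr (mulrC x) andbC.
Qed.

Lemma ge0_integral_affine (a b : R) (g : TR -> \bar R) : a != 0%R ->
  measurable_fun setT g -> (forall x, 0 <= g x) ->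
  `|a|%:E * \int[mu]_x g (a * x + b)%R = \int[mu]_x g x.
Proof.
move=> a0 mg g0.
have na0 : (0 <= `|a|)%R by [].
pose na : {nonneg R} := NngNum na0.
transitivity (\int[mscale na (affine_image a b)]_x g x); last first.
  by apply: eq_measure_integral => A mA _; apply: lebesgue_measure_affine.
rewrite ge0_integral_mscale//=; congr (_ * _).
by rewrite ge0_integral_pushforward//; exact: measurable_affine.
Qed.

Lemma ge0_integral_shift (b : R) (g : TR -> \bar R) :
  measurable_fun setT g -> (forall x, 0 <= g x) ->
  \int[mu]_x g (x + b)%R = \int[mu]_x g x.
Proof.
move=> mg g0; rewrite -[RHS](@ge0_integral_affine 1 b)// ?oner_neq0// normr1 mul1e.
by apply: eq_integral => x _; rewrite mul1r.
Qed.

Lemma ge0_integral_reflect (b : R) (g : TR -> \bar R) :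
  measurable_fun setT g -> (forall x, 0 <= g x) ->
  \int[mu]_x g (b - x)%R = \int[mu]_x g x.
Proof.
move=> mg g0; rewrite -[RHS](@ge0_integral_affine (-1) b)// ?oppr_eq0 ?oner_neq0//.
rewrite normrN normr1 mul1e.
by apply: eq_integral => x _; rewrite mulN1r addrC.
Qed.

End change_of_variables.

(** * Epsilon criteria for null sequences in the extended reals *)

Section ereal_limits.
Variable R : realType.
Local Open Scope ereal_scope.

Lemma ereal_cvg0_near (u : nat -> \bar R) (e : R) : (0 < e)%R ->
  u @ \oo --> 0 -> \forall n \near \oo, u n < e%:E.
Proof.
move=> e0 u0; apply: (u0 [set y | y < e%:E]).
by apply: open_nbhs_nbhs; split; [exact: open_ereal_lt_ereal|rewrite /= lte_fin].
Qed.

Lemma ereal_cvg0 (u : nat -> \bar R) : (forall n, 0 <= u n) ->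
  (forall e : R, (0 < e)%R -> \forall n \near \oo, u n <= e%:E) -> u @ \oo --> 0.
Proof.
move=> u0 ue; apply/fine_cvgP; split.
  have := ue 1%R ltr01; apply: filterS => n un.
  by rewrite ge0_fin_numE// (le_lt_trans un)// ltry.
apply/cvgr0Pnorm_le => e e0; have := ue e e0; apply: filterS => n un /=.
rewrite ger0_norm ?fine_ge0// -lee_fin fineK// ge0_fin_numE//.
by rewrite (le_lt_trans un)// ltry.
Qed.

End ereal_limits.

(** * Plancherel on the real line *)

Section translation_continuity.
Variable R : realType.
Local Notation mu := (@lebesgue_measure R).
Local Notation TR := (measurableTypeR R).
Local Open Scope ereal_scope.

Lemma measurable_sqr_EFin d (T : measurableType d) (f : T -> R) :
  measurable_fun setT f -> measurable_fun setT (fun x => ((f x) ^+ 2)%:E).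
Proof. by move=> mf; apply/measurable_EFinP; exact: measurable_funX. Qed.

(** This consequence of [(f - g)^2 >= 0] serves as the triangle inequality for squared norms and
    keeps square roots of possibly infinite integrals out of the estimates. *)
Lemma integral_sqrD_le d (T : measurableType d) (m : {measure set T -> \bar R})
    (f g : T -> R) : measurable_fun setT f -> measurable_fun setT g ->
  \int[m]_x ((f x + g x) ^+ 2)%:E <=
  2%:E * \int[m]_x ((f x) ^+ 2)%:E + 2%:E * \int[m]_x ((g x) ^+ 2)%:E.
Proof.
move=> mf mg.
have mf2 := measurable_sqr_EFin mf; have mg2 := measurable_sqr_EFin mg.
rewrite -!ge0_integralZl_EFin//; do ?by move=> x _; rewrite lee_fin sqr_ge0.
rewrite -ge0_integralD//; last 4 first.
- by move=> x _; rewrite mule_ge0// lee_fin sqr_ge0.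
- exact: measurable_funeM.
- by move=> x _; rewrite mule_ge0// lee_fin sqr_ge0.
- exact: measurable_funeM.
apply: ge0_le_integral => //.
- by move=> x _; rewrite lee_fin sqr_ge0.
- by apply: measurable_sqr_EFin; exact: measurable_funD.
- by apply: emeasurable_funD; exact: measurable_funeM.
move=> x _; rewrite -!EFinM -EFinD lee_fin.
have := sqr_ge0 (f x - g x)%R; nra.
Qed.

Lemma measurable_shift (h : R) (f : TR -> R) : measurable_fun setT f ->
  measurable_fun [set: TR] (fun x : R => f (x + h)%R).
Proof.
move=> mf; apply: (measurableT_comp mf (g := (fun x : R => (x + h)%R) : TR -> TR)).
exact: measurable_funD.
Qed.

(** [b] is bounded by [n], vanishes off [[-n, n]] and is continuous away from the two endpoints, so
    dominated convergence applies: the shifts stay below [M], hence all integrands live on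
    [[-(n + M), n + M]] and are at most [(2n)^2]. *)
Lemma clipped_translation_cvg (g : R -> R) (n M : R) (h : nat -> R) :
  (0 <= n)%R -> continuous g -> (forall x, `|g x| <= n)%R ->
  (forall k, `|h k| <= M)%R -> h @ \oo --> (0:R)%R ->
  let b := (g \* \1_(`[(- n)%R, n]%classic))%R in
  \int[mu]_x ((b (x + h k) - b x) ^+ 2)%:E @[k --> \oo] --> 0.
Proof.
move=> n0 cg gn hM h0 b.
have mg : measurable_fun [set: TR] g by exact: continuous_measurable_fun.
have mb : measurable_fun [set: TR] b.
  by apply: measurable_funM => //; exact: measurable_indic.
have bn x : (`|b x| <= n)%R.
  rewrite /b /= normrM indicE; case: (_ \in _); rewrite ?normr1 ?mulr1//.
  by rewrite normr0 mulr0.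
have bo x : (n < `|x|)%R -> b x = 0%R.
  move=> nx; rewrite /b /= indicE memNset ?mulr0//= in_itv/= => /andP[h1 h2].
  by move: nx; rewrite ltNge ler_norml h1 h2.
have M0 : (0 <= M)%R by exact: le_trans (hM 0%N).
pose G x : \bar R := (((2 * n) ^+ 2) * \1_(`[(- (n + M))%R, (n + M)%R]%classic) x)%:E.
pose F k (x : TR) : \bar R := ((b (x + h k) - b x) ^+ 2)%:E.
have mF k : measurable_fun setT (F k).
  apply: measurable_sqr_EFin; apply: measurable_funB => //.
  exact: measurable_shift.
have Fcvg : {ae mu, forall x, setT x -> F ^~ x @ \oo --> (cst 0 : TR -> \bar R) x}.
  exists [set (- n)%R; n]; split.
  + by apply: measurableU; exact: measurable_set1.
  + apply: countable_lebesgue_measure0; apply: finite_set_countable.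
    exact: finite_set2.
  move=> x /= H; apply: contrapT => xn; apply: H => _.
  have bx : b y @[y --> x] --> b x.
    have [xln|nlx] := ltP `|x|%R n.
      rewrite [b x](_ : _ = g x); last first.
        rewrite /b /= indicE mem_set ?mulr1//= in_itv/=.
        by rewrite -ler_norml ltW.
      apply: cvg_trans (cg x); apply: near_eq_cvg.
      near=> y; rewrite /b /= indicE mem_set ?mulr1//= in_itv/=.
      rewrite -ler_norml; near: y.
      have : \forall y \near x, (`|y| < n)%R.
        by apply: (@cvgr_lt _ _ (nbhs x) _ (fun y => `|y|%R) `|x|%R) => //; exact: cvg_norm.
      by apply: filterS => y /ltW.
    have nx : (n < `|x|)%R.
      rewrite lt_neqAle nlx andbT; apply/eqP => nE; apply: xn.
      have [x0|x0] := lerP 0%R x; [right|left].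
        by rewrite nE ger0_norm.
      by rewrite nE ltr0_norm// opprK.
    rewrite [b x]bo//; apply: cvg_near_cst.
    near=> y; apply: bo; near: y.
    by apply: (@cvgr_gt _ _ (nbhs x) _ (fun y => `|y|%R) `|x|%R) => //; exact: cvg_norm.
  have bh : b (x + h k)%R @[k --> \oo] --> b x.
    have hx : (x + h k)%R @[k --> \oo] --> (x + 0 : R)%R.
      by apply: cvgD => //; exact: cvg_cst.
    rewrite addr0 in hx.
    exact: (cvg_comp _ _ hx bx).
  have d0 : (b (x + h k) - b x)%R @[k --> \oo] --> (0:R)%R.
    by rewrite -(subrr (b x)); apply: cvgB => //; exact: cvg_cst.
  apply: cvg_EFin; first exact: nearW.
  by rewrite -(mulr0 (0:R)%R); exact: cvgM.
have iG : mu.-integrable setT G.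
  exact: (integrableZl measurableT _ (integrable_indic_itv _ _ _ _)).
have FG : {ae mu, forall x k, setT x -> `|F k x| <= G x}.
  apply: aeW => x k _; rewrite gee0_abs ?lee_fin ?sqr_ge0//.
  rewrite /G indicE; case: (boolP (x \in _)) => [xG|].
    rewrite mulr1 -[leLHS]real_normK ?num_real//.
    rewrite ler_sqr ?nnegrE// ?mulr_ge0//.
    by rewrite (le_trans (ler_normB _ _))// mulr_natl mulr2n lerD.
  rewrite notin_setE /= in_itv/= -ler_norml => /negP; rewrite -ltNge => nMx.
  rewrite !bo ?subrr ?expr0n ?mulr0//.
    by rewrite (le_lt_trans _ nMx)// lerDl.
  move: nMx; have := ler_normD (x + h k)%R (- h k)%R.
  rewrite addrK normrN; have := hM k; lra.
have [_ _] := dominated_convergence measurableT mF (measurable_cst _) Fcvg iG FG.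
by rewrite integral0.
Unshelve. all: by end_near. Qed.

(** Clipping is the projection onto [[-n, n]], which cannot increase the distance to a point of that
    interval. *)
Lemma ler_dist_clip (n p q : R) : (- n <= p <= n)%R ->
  (`|p - Num.max (- n) (Num.min n q)| <= `|p - q|)%R.
Proof.
move=> /andP[np pn]; have := ler_norm (p - q); have := ler_norm (- (p - q)).
rewrite normrN /Order.max /Order.min.
by case: (ltP n q) => h1; case: ltP => h2 h3 h4; rewrite ler_norml; lra.
Qed.

Lemma L2_truncation (a : TR -> R) : measurable_fun setT a ->
  \int[mu]_x ((a x) ^+ 2)%:E < +oo ->
  \int[mu]_x ((a x - (if (`|x : R| <= k%:R) && (`|a x| <= k%:R) then a x else 0)) ^+ 2)%:E
    @[k --> \oo] --> 0.
Proof.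
move=> ma a2.
pose f k (x : TR) := if (`|x : R| <= k%:R)%R && (`|a x| <= k%:R)%R then a x else 0%R.
have mf k : measurable_fun setT (f k).
  apply: measurable_fun_ifT => //; apply: measurable_and.
    by apply: measurable_fun_ler => //; exact: measurableT_comp.
  by apply: measurable_fun_ler => //; exact: measurableT_comp.
have mF k : measurable_fun setT (fun x => ((a x - f k x) ^+ 2)%:E).
  by apply: measurable_sqr_EFin; exact: measurable_funB.
have cF : {ae mu, forall x, setT x ->
    (fun k => ((a x - f k x) ^+ 2)%:E) @ \oo --> (cst 0 : TR -> \bar R) x}.
  apply: aeW => x _; apply: cvg_near_cst; near=> k.
  rewrite /f !ifT ?subrr ?expr0n//; apply/andP; split; near: k.
    exact: nbhs_infty_ger.
  exact: nbhs_infty_ger.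
have ia : mu.-integrable setT (fun x => ((a x) ^+ 2)%:E).
  apply/integrableP; split; first exact: measurable_sqr_EFin.
  by under eq_integral do rewrite gee0_abs ?lee_fin ?sqr_ge0//.
have dF : {ae mu, forall x k, setT x ->
    `|((a x - f k x) ^+ 2)%:E| <= ((a x) ^+ 2)%:E}.
  apply: aeW => x k _; rewrite gee0_abs ?lee_fin ?sqr_ge0// /f.
  by case: ifP; rewrite ?subrr ?subr0// expr0n sqr_ge0.
have [_ _] := dominated_convergence measurableT mF (measurable_cst _) cF ia dF.
by rewrite integral0.
Unshelve. all: by end_near. Qed.

(** Continuous functions approximate in L^1 on a set of finite measure. This becomes an L^2
    approximation because the truncation [f] and the clipped function [g] are both bounded by [N],
    so that |f - g|^2 is at most 2N |f - g|. *)
Lemma L2_clipped_continuous_approx (a : TR -> R) (e : R) :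
  measurable_fun setT a -> \int[mu]_x ((a x) ^+ 2)%:E < +oo -> (0 < e)%R ->
  exists g : R -> R, exists n : R, [/\ (0 <= n)%R, continuous g,
    (forall x, `|g x| <= n)%R &
    \int[mu]_x ((a x - (g \* \1_(`[(- n)%R, n]%classic)) x) ^+ 2)%:E <= e%:E].
Proof.
move=> ma a2 e0.
have [N _ /(_ N (leqnn N)) aN] := ereal_cvg0_near (divr_gt0 e0 (ltr0n _ 4)) (L2_truncation ma a2).
set f := (fun x : TR => if (`|x : R| <= N%:R)%R && (`|a x| <= N%:R)%R then a x else 0%R) in aN.
have mf : measurable_fun setT f.
  apply: measurable_fun_ifT => //; apply: measurable_and.
    by apply: measurable_fun_ler => //; exact: measurableT_comp.
  by apply: measurable_fun_ler => //; exact: measurableT_comp.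
have fN x : (`|f x| <= N%:R)%R.
  by rewrite /f; case: ifP => [/andP[]//|_]; rewrite normr0.
pose D : set TR := `[(- N%:R)%R, N%:R]%classic.
have mD : measurable D by exact: measurable_itv.
have Dfin : mu D < +oo.
  by rewrite lebesgue_measure_itv/=; case: ifPn => _; rewrite ?ltry// -EFinB ltry.
have fi : mu.-integrable D (EFin \o f).
  apply: measurable_bounded_integrable => //; first exact: measurable_funTS.
  by exists N%:R; split; [exact: num_real|move=> y Ny x _; exact: le_trans (fN x) (ltW Ny)].
have [g_ [cg ig fg]] := approximation_continuous_integrable mD Dfin fi.
(* Chosen so that 2N times this error stays below e/4; the successor guards against [N = 0]. *)
have c0 : (0 < e / (8 * N.+1%:R))%R by rewrite divr_gt0// mulr_gt0.
have [K _ /(_ K (leqnn K)) fgK] := ereal_cvg0_near c0 fg.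
pose g x := Num.max (- N%:R)%R (Num.min N%:R (g_ K x)).
have gN x : (`|g x| <= N%:R)%R.
  rewrite ler_norml /g le_max lexx /= ge_max ge_min lexx /= andbT.
  by rewrite (@le_trans _ _ 0%R)// oppr_le0.
exists g, N%:R; split => //.
  move=> x; apply: (@continuous_max R R (fun=> (- N%:R)%R : R^o)
    (fun x => Num.min N%:R (g_ K x) : R^o) x); first exact: cst_continuous.
  by apply: (@continuous_min R R (fun=> N%:R : R^o) (g_ K : R -> R^o) x);
    [exact: cst_continuous|exact: cg].
have mg : measurable_fun [set: TR] g.
  apply: measurable_maxr => //; apply: measurable_minr => //.
  exact: continuous_measurable_fun.
have mb : measurable_fun [set: TR] (g \* \1_D)%R.
  by apply: measurable_funM => //; exact: measurable_indic.
have fb : \int[mu]_x ((f x - (g \* \1_D) x) ^+ 2)%:E <= (e / 4)%:E.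
  have step x : ((f x - (g \* \1_D) x) ^+ 2)%:E <=
      ((2 * N%:R)%:E * (fun z => `|(f z - g_ K z)%:E|) \_ D x).
    rewrite patchE /= indicE; case: ifPn => xD.
      rewrite mulr1 -EFinM lee_fin -[leLHS]real_normK ?num_real// expr2.
      rewrite ler_pM//.
        by rewrite (le_trans (ler_normB _ _))// mulr_natl mulr2n lerD.
      by apply: ler_dist_clip; rewrite -ler_norml.
    move: xD; rewrite notin_setE /D /= in_itv/= -ler_norml => /negP xD.
    by rewrite /f (negbTE xD)/= mulr0 subrr expr0n mule0.
  apply: le_trans.
    apply: ge0_le_integral => //; last by move=> x _; exact: step.
    - by move=> x _; rewrite lee_fin sqr_ge0.
    - by apply: measurable_sqr_EFin; exact: measurable_funB.
    - apply: measurable_funeM; apply/(measurable_restrictT _ _).1 => //.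
      apply: measurableT_comp => //; apply/measurable_EFinP; apply: measurable_funB.
        exact: measurable_funTS.
      by apply: measurable_funTS; exact: continuous_measurable_fun.
  rewrite ge0_integralZl_EFin ?mulr_ge0//; last 2 first.
  - by move=> x _; rewrite patchE; case: ifP.
  - apply/(measurable_restrictT _ _).1 => //.
    apply: measurableT_comp => //; apply/measurable_EFinP; apply: measurable_funB.
      exact: measurable_funTS.
    by apply: measurable_funTS; exact: continuous_measurable_fun.
  rewrite -integral_mkcond; apply: (@le_trans _ _ ((2 * N%:R)%:E * (e / (8 * N.+1%:R))%:E)).
    by rewrite lee_wpmul2l ?lee_fin ?mulr_ge0// ltW.
  rewrite -EFinM lee_fin -natr1 mulrA ler_pdivrMr ?mulr_gt0// ?ltr_wpDl//.
  have : (0 <= N%:R :> R)%R by []. nra.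
have -> : (fun x => ((a x - (g \* \1_D) x) ^+ 2)%:E) =
  (fun x => (((a x - f x) + (f x - (g \* \1_D) x)) ^+ 2)%:E).
  by apply/funext => x; rewrite addrA subrK.
apply: (le_trans (integral_sqrD_le _ _ _)); try exact: measurable_funB.
rewrite (_ : e%:E = 2%:E * (e / 4)%:E + 2%:E * (e / 4)%:E); last first.
  by rewrite -EFinM -EFinD; congr EFin; field.
by rewrite leeD// lee_wpmul2l// ltW.
Qed.

Lemma L2_translation_cvg (a : TR -> R) (h : nat -> R) (M : R) :
  measurable_fun setT a -> \int[mu]_x ((a x) ^+ 2)%:E < +oo ->
  (forall k, `|h k| <= M)%R -> h @ \oo --> (0:R)%R ->
  \int[mu]_x ((a (x + h k)%R - a x) ^+ 2)%:E @[k --> \oo] --> 0.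
Proof.
move=> ma a2 hM h0; apply: ereal_cvg0.
  by move=> n; apply: integral_ge0 => x _; rewrite lee_fin sqr_ge0.
move=> e e0.
(* Two uses of [integral_sqrD_le] double the errors: 2 (e/12) + 2 (2 (e/8) + 2 (e/12)) = e. *)
have e12 : (0 < e / 12)%R by rewrite divr_gt0.
have [g [n [n0 cg gn ag]]] := L2_clipped_continuous_approx ma a2 e12.
have := clipped_translation_cvg n0 cg gn hM h0.
set b := (g \* _)%R in ag * => /= bcvg.
have mb : measurable_fun [set: TR] b.
  apply: measurable_funM; last exact: measurable_indic.
  exact: continuous_measurable_fun.
have e6 : (0 < e / 8)%R by rewrite divr_gt0.
have := ereal_cvg0_near e6 bcvg; apply: filterS => k bk.
have ab2 : \int[mu]_x ((a (x + h k)%R - b (x + h k)%R) ^+ 2)%:E <= (e / 12)%:E.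
  rewrite (@ge0_integral_shift R (h k) (fun x => ((a x - b x) ^+ 2)%:E))//.
    by apply: measurable_sqr_EFin; exact: measurable_funB.
  by move=> x; rewrite lee_fin sqr_ge0.
have -> : (fun x : TR => ((a (x + h k)%R - a x) ^+ 2)%:E) = (fun x : TR =>
  (((a (x + h k) - b (x + h k)) + ((b (x + h k) - b x) + (b x - a x))) ^+ 2)%R%:E).
  by apply/funext => x; rewrite !addrA !subrK.
have msa := measurable_shift (h k) ma; have msb := measurable_shift (h k) mb.
apply: (le_trans (integral_sqrD_le _ _ _)).
- exact: measurable_funB.
- by apply: measurable_funD; exact: measurable_funB.
rewrite (_ : e%:E = 2%:E * (e / 12)%:E + 2%:E * (2%:E * (e / 8)%:E + 2%:E * (e / 12)%:E)); last first.
  by rewrite -!(EFinM, EFinD); congr EFin; field.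
apply: leeD; first exact: lee_wpmul2l.
apply: lee_wpmul2l => //.
apply: (le_trans (integral_sqrD_le _ _ _)); try exact: measurable_funB.
apply: leeD; apply: lee_wpmul2l => //; first exact: ltW.
apply: le_trans ag; rewrite le_eqVlt; apply/orP; left; apply/eqP.
by apply: eq_integral => x _; rewrite -sqrrN opprB.
Qed.

End translation_continuity.

(** * The Poisson kernel as a cosine transform *)

Section poisson_kernel.
Variable R : realType.
Local Notation mu := (@lebesgue_measure R).
Local Notation TR := (measurableTypeR R).

Lemma norm_cos_le1 (x : R) : `|cos x| <= 1.
Proof. by rewrite ler_norml cos_geN1 cos_le1. Qed.

Lemma norm_sin_le1 (x : R) : `|sin x| <= 1.
Proof. by rewrite ler_norml sin_geN1 sin_le1. Qed.

Definition poisson_weight (e x : R) : R := expR (- (e * `|x|)).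

(** The cosine transform of [poisson_weight e]. It is left unnormalised: its mass [2 * pi], the same
    for every positive [e], is the constant of Plancherel's identity. *)
Definition poisson_kernel (e h : R) : R := 2 * e / (e ^+ 2 + h ^+ 2).

Lemma poisson_kernel_ge0 e h : 0 < e -> 0 <= poisson_kernel e h.
Proof.
by move=> e0; rewrite divr_ge0 ?mulr_ge0 ?addr_ge0 ?sqr_ge0// ltW.
Qed.

Lemma continuous_poisson_weight (e : R) : continuous (poisson_weight e).
Proof.
move=> x; apply: (@continuous_comp _ _ _ (fun x : R => - (e * `|x|)) expR).
  by apply: cvgN; apply: cvgM; [exact: cvg_cst|exact: cvg_norm].
exact: continuous_expR.
Qed.

(** The primitive of the integrand of [integral0y_poisson] that vanishes at infinity, so that minus
    its value at 0 is the integral. *)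
Let F (e h x : R) : R :=
  expR (- (e * x)) * ((h * sin (h * x) - e * cos (h * x)) / (e ^+ 2 + h ^+ 2) - e^-1).

(** The summand 1 makes the integrand nonnegative, the setting in which the fundamental theorem is
    applied on the half-line; the pure cosine integral is recovered later by subtracting the
    integral of the weight. *)
Lemma integral0y_poisson (e h : R) : 0 < e ->
  (\int[mu]_(x in `[0%R, +oo[) (expR (- (e * x)) * (1 + cos (h * x)))%:E =
  (e^-1 + e / (e ^+ 2 + h ^+ 2))%:E)%E.
Proof.
move=> e0.
have eh0 : e ^+ 2 + h ^+ 2 != 0 by rewrite gt_eqF// ltr_pwDl// ?sqr_ge0// exprn_gt0.
have e0' : e != 0 by rewrite gt_eqF.
have dF (x : R) : is_derive x (1:R) (F e h) (expR (- (e * x)) * (1 + cos (h * x))).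
  rewrite /F; apply: is_derive_eq.
  rewrite /GRing.scale /=.
  by field; rewrite e0' eh0.
have cf : continuous (fun x => expR (- (e * x)) * (1 + cos (h * x))).
  move=> x; apply: cvgM.
    apply: (@continuous_comp _ _ _ (fun x : R => - (e * x)) expR).
      by apply: cvgN; apply: cvgM; [exact: cvg_cst|exact: cvg_id].
    exact: continuous_expR.
  apply: cvgD; first exact: cvg_cst.
  apply: (@continuous_comp _ _ _ (fun x : R => h * x) cos).
    by apply: cvgM; [exact: cvg_cst|exact: cvg_id].
  exact: continuous_cos.
rewrite (@ge0_continuous_FTC2y R _ (F e h) 0 0)//.
- rewrite /F !mulr0 oppr0 expR0 sin0 cos0 -EFinB; congr EFin.
  by field; rewrite e0' eh0.
- exact: continuous_subspaceT.
- pose K := (`|h| + e) / (e ^+ 2 + h ^+ 2) + e^-1.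
  have w0 : expR (- (e * x)) * K @[x --> +oo] --> (0:R).
    rewrite -(mul0r K); apply: cvgM; last exact: cvg_cst.
    apply: (cvg_comp (fun x => e * x) (fun x => expR (- x))); last exact: cvgr_expR.
    by apply: gt0_cvgMry => //; exact: cvg_id.
  have Nw0 : - (expR (- (e * x)) * K) @[x --> +oo] --> (0:R).
    by rewrite -oppr0; exact: cvgN.
  apply: (squeeze_cvgr _ Nw0 w0); apply: nearW => x.
  rewrite -ler_norml /F normrM ger0_norm ?expR_ge0// ler_wpM2l ?expR_ge0//.
  rewrite (le_trans (ler_normB _ _))// /K lerD//; last by rewrite ger0_norm// invr_ge0 ltW.
  rewrite normrM [`|_^-1|]ger0_norm; last by rewrite invr_ge0 addr_ge0 ?sqr_ge0.
  rewrite ler_wpM2r ?invr_ge0 ?addr_ge0 ?sqr_ge0//.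
  rewrite (le_trans (ler_normB _ _))// !normrM (gtr0_norm e0) lerD//.
    by rewrite ler_piMr//; exact: norm_sin_le1.
  by rewrite ler_piMr ?(ltW e0)//; exact: norm_cos_le1.
- apply: cvg_at_right_filter; apply: differentiable_continuous.
  by apply/derivable1_diffP; exact: ex_derive.
- by move=> x _; rewrite derive1E; exact: derive_val.
Qed.

Lemma measurable_cosM (h : R) : measurable_fun [set: TR] (fun x : R => cos (h * x)).
Proof.
apply: continuous_measurable_fun => x.
apply: (@continuous_comp _ _ _ (fun x : R => h * x) cos).
  by apply: cvgM; [exact: cvg_cst|exact: cvg_id].
exact: continuous_cos.
Qed.

Lemma measurable_poisson_weight (e : R) : measurable_fun [set: TR] (poisson_weight e).
Proof. by apply: continuous_measurable_fun; exact: continuous_poisson_weight. Qed.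

Lemma integral_poisson_weight1Dcos (e h : R) : 0 < e ->
  (\int[mu]_x (poisson_weight e x * (1 + cos (h * x)))%:E =
  (2 / e + poisson_kernel e h)%:E)%E.
Proof.
move=> e0.
have c0 x : 0 <= 1 + cos (h * x) by rewrite -lerBlDl sub0r cos_geN1.
rewrite (@ge0_symfun_integralT R)//=; last 3 first.
- by move=> x; rewrite mulr_ge0 ?expR_ge0.
- move=> x; apply: cvgM; first exact: continuous_poisson_weight.
  apply: cvgD; first exact: cvg_cst.
  apply: (@continuous_comp _ _ _ (fun x : R => h * x) cos).
    by apply: cvgM; [exact: cvg_cst|exact: cvg_id].
  exact: continuous_cos.
- by move=> x; rewrite /poisson_weight /= normrN mulrN cosN.
rewrite -set_itvcy.
under eq_integral => x.
  rewrite inE/= in_itv/= andbT => x0; rewrite /poisson_weight ger0_norm//.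
  over.
rewrite integral0y_poisson// -EFinM; congr EFin.
rewrite /poisson_kernel; field.
by rewrite !gt_eqF// ltr_pwDl ?sqr_ge0// exprn_gt0.
Qed.

Lemma integral_poisson_weight (e : R) : 0 < e ->
  (\int[mu]_x (poisson_weight e x)%:E = (2 / e)%:E)%E.
Proof.
(* At frequency 0 the factor [1 + cos (h * x)] equals 2, so the integral of the weight is half of
   the known one. *)
move=> e0; have := integral_poisson_weight1Dcos 0 e0.
under eq_integral do rewrite mul0r cos0 EFinM.
rewrite ge0_integralZr//; last 2 first.
- by apply/measurable_EFinP; exact: measurable_poisson_weight.
- by move=> x _; rewrite lee_fin expR_ge0.
rewrite /poisson_kernel (_ : 2 / e + _ = 2 / e * (1 + 1)); last first.
  by field; rewrite gt_eqF.
rewrite EFinM => /(congr1 (fun z => (2^-1)%:E * z)%E).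
rewrite ![((2^-1)%:E * _)%E]muleC -!muleA -EFinM divff ?mule1//.
Qed.

Lemma integrable_poisson_weight (e : R) : 0 < e ->
  mu.-integrable setT (EFin \o poisson_weight e).
Proof.
move=> e0; apply/integrableP; split.
  by apply/measurable_EFinP; exact: measurable_poisson_weight.
under eq_integral do rewrite /= ger0_norm ?expR_ge0//.
by rewrite integral_poisson_weight// ltry.
Qed.

Lemma integrable_poisson_weight_cos (e h : R) : 0 < e ->
  mu.-integrable setT (fun x => (poisson_weight e x * cos (h * x))%:E).
Proof.
move=> e0; apply: le_integrable (integrable_poisson_weight e0) => //.
  apply/measurable_EFinP; apply: measurable_funM; first exact: measurable_poisson_weight.
  exact: measurable_cosM.
move=> x _; rewrite lee_fin normrM ler_piMr//; exact: norm_cos_le1.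
Qed.

Lemma integral_poisson_weight_cos (e h : R) : 0 < e ->
  (\int[mu]_x (poisson_weight e x * cos (h * x))%:E = (poisson_kernel e h)%:E)%E.
Proof.
move=> e0; have := integral_poisson_weight1Dcos h e0.
under eq_integral do rewrite mulrDr mulr1 EFinD.
rewrite integralD//; [|exact: integrable_poisson_weight|exact: integrable_poisson_weight_cos].
rewrite integral_poisson_weight//.
have := integrable_fin_num measurableT (integrable_poisson_weight_cos h e0).
by case: (\int[_]_x _)%E => // r _ [] /addrI ->.
Qed.

Lemma measurable_poisson_kernel (e : R) : 0 < e ->
  measurable_fun [set: TR] (poisson_kernel e).
Proof.
move=> e0; apply: continuous_measurable_fun => x; apply: cvgM; first exact: cvg_cst.
apply: cvgV; first by rewrite gt_eqF// ltr_pwDl ?sqr_ge0// exprn_gt0.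
by apply: cvgD; [exact: cvg_cst|exact: exprn_continuous].
Qed.

Lemma integral_poisson_kernel1 :
  (\int[mu]_x (poisson_kernel 1 x)%:E = (2 * pi)%:E)%E.
Proof.
have E x : poisson_kernel 1 x = 2 * (oneDsqr x)^-1.
  by rewrite /poisson_kernel mulr1 expr1n.
under eq_integral do rewrite E EFinM.
rewrite ge0_integralZl//; last first.
  apply/measurable_EFinP; apply: continuous_measurable_fun.
  exact: continuous_oneDsqrV.
rewrite (@ge0_symfun_integralT R)//=; last 2 first.
- exact: continuous_oneDsqrV.
- by move=> x /=; rewrite /oneDsqr sqrrN.
rewrite -set_itvcy integral0y_oneDsqr -!EFinM; congr EFin; lra.
Qed.

End poisson_kernel.

(** * Parametrised real integrals and tensor products *)

Section product_integrals.
Context d1 d2 (T1 : measurableType d1) (T2 : measurableType d2) (R : realType).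
Variables (m1 : {sigma_finite_measure set T1 -> \bar R})
  (m2 : {sigma_finite_measure set T2 -> \bar R}).
Local Open Scope ereal_scope.

(** Positive and negative parts are covered separately by Tonelli, and [fine] is measurable, so
    sections whose integral diverges do no harm. *)
Lemma measurable_Rintegral1 (f : T1 * T2 -> R) : measurable_fun setT f ->
  measurable_fun setT (fun x => (\int[m2]_y f (x, y))%R).
Proof.
move=> mf; rewrite /Rintegral.
apply: (measurableT_comp (fine_measurable measurableT)).
under eq_fun do rewrite integralE.
have mF : measurable_fun setT (EFin \o f) by exact/measurable_EFinP.
apply: emeasurable_funB.
  have := @measurable_fun_fubini_tonelli_F _ _ T1 T2 R m2 (EFin \o f)^\+
    (measurable_funepos mF) (fun _ => funepos_ge0 _ _).
  by apply: eq_measurable_fun => x _; apply: eq_integral => y _; rewrite !unlock.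
have := @measurable_fun_fubini_tonelli_F _ _ T1 T2 R m2 (EFin \o f)^\-
  (measurable_funeneg mF) (fun _ => funeneg_ge0 _ _).
by apply: eq_measurable_fun => x _; apply: eq_integral => y _; rewrite !unlock.
Qed.

Lemma integrable_prodM (f : T1 -> R) (g : T2 -> R) :
  m1.-integrable setT (EFin \o f) -> m2.-integrable setT (EFin \o g) ->
  (m1 \x m2).-integrable setT (fun z => (f z.1 * g z.2)%:E).
Proof.
move=> fi gi.
have mf : measurable_fun setT f by apply/measurable_EFinP; case/integrableP : fi.
have mg : measurable_fun setT g by apply/measurable_EFinP; case/integrableP : gi.
have mfg : measurable_fun setT (fun z : T1 * T2 => (f z.1 * g z.2)%:E).
  by apply/measurable_EFinP; apply: measurable_funM; exact: measurableT_comp.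
apply/(integrable12ltyP m1 m2 mfg) => /=.
under eq_integral => x _.
  under eq_integral do rewrite normrM EFinM.
  rewrite ge0_integralZl_EFin//; last first.
    by do 2 apply: measurableT_comp => //.
  over.
rewrite ge0_integralZr//; last 2 first.
- by do 2 apply: measurableT_comp => //.
- exact: integral_ge0.
by apply: lte_mul_pinfty; [exact: integral_ge0| |];
  [apply: integrable_fin_num => //; exact: integrable_norm|
   case/integrableP : gi].
Qed.

Lemma Rintegral_prodM (f : T1 -> R) (g : T2 -> R) :
  m1.-integrable setT (EFin \o f) -> m2.-integrable setT (EFin \o g) ->
  \int[m1 \x m2]_z (f z.1 * g z.2)%:E =
  ((\int[m1]_x f x) * (\int[m2]_y g y))%R%:E.
Proof.
move=> fi gi; rewrite -(integral12_prod_meas1 (integrable_prodM fi gi)) /fubini_F /=.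
under eq_integral => x _.
  under eq_integral do rewrite EFinM.
  rewrite integralZl//; over.
have gfin : \int[m2]_y (g y)%:E \is a fin_num by exact: integrable_fin_num.
rewrite -(fineK gfin).
by rewrite integralZr// /Rintegral EFinM !fineK//; exact: integrable_fin_num.
Qed.

End product_integrals.

(** * The spectrum integrated against the Poisson weight *)

Section power_spectrum.
Variable R : realType.
Local Notation mu := (@lebesgue_measure R).
Local Notation TR := (measurableTypeR R).
Local Notation mu2 := (@lebesgue2 R).
Implicit Types (a : TR -> R).

Lemma measurable_cos : measurable_fun [set: TR] (@cos R).
Proof. by apply: continuous_measurable_fun; exact: continuous_cos. Qed.

Lemma measurable_sin : measurable_fun [set: TR] (@sin R).
Proof. by apply: continuous_measurable_fun; exact: continuous_sin. Qed.

Lemma integrableM_bounded d (T : measurableType d) (m : {measure set T -> \bar R})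
    (f g : T -> R) : m.-integrable setT (EFin \o f) -> measurable_fun setT g ->
  (forall x, `|g x| <= 1) -> m.-integrable setT (fun x => (f x * g x)%:E).
Proof.
move=> fi mg g1.
have mf : measurable_fun setT f by apply/measurable_EFinP; case/integrableP : fi.
apply: le_integrable fi => //.
  by apply/measurable_EFinP; exact: measurable_funM.
by move=> x _; rewrite lee_fin normrM ler_piMr.
Qed.

Definition cos_transform a (xi : R) : R := \int[mu]_x (a x * cos (x * xi)).
Definition sin_transform a (xi : R) : R := \int[mu]_x (a x * sin (x * xi)).

(** The squared modulus of the Fourier transform of the real function [a]. *)
Definition power_spectrum a (xi : R) : R :=
  cos_transform a xi ^+ 2 + sin_transform a xi ^+ 2.

Lemma measurable_power_spectrum a : measurable_fun setT a ->
  measurable_fun [set: TR] (power_spectrum a).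
Proof.
move=> ma; apply: measurable_funD; apply: measurable_funX.
  apply: (@measurable_Rintegral1 _ _ TR TR R mu (fun z => a z.2 * cos ((z.2 : R) * z.1))).
  apply: measurable_funM; first exact: measurableT_comp.
  apply: (measurableT_comp measurable_cos).
  exact: measurable_funM.
apply: (@measurable_Rintegral1 _ _ TR TR R mu (fun z => a z.2 * sin ((z.2 : R) * z.1))).
apply: measurable_funM; first exact: measurableT_comp.
apply: (measurableT_comp measurable_sin).
exact: measurable_funM.
Qed.

(** The addition formula for the cosine of a difference separates the variables. Read backwards, it
    makes the spectrum an autocorrelation integral to which Fubini can be applied. *)
Lemma power_spectrumE a xi : mu.-integrable setT (EFin \o a) ->
  (\int[mu2]_z (a z.1 * a z.2 * cos (((z.1 : R) - z.2) * xi))%:E =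
  (power_spectrum a xi)%:E)%E.
Proof.
move=> ia.
have ic : mu.-integrable setT (EFin \o (fun x => a x * cos (x * xi))).
  apply: integrableM_bounded => //; last by move=> x; exact: norm_cos_le1.
  by under eq_fun do rewrite mulrC; exact: measurable_cosM.
have is_ : mu.-integrable setT (EFin \o (fun x => a x * sin (x * xi))).
  apply: integrableM_bounded => //; last by move=> x; exact: norm_sin_le1.
  by apply: (measurableT_comp measurable_sin); exact: measurable_funM.
rewrite /power_spectrum EFinD !expr2 -!Rintegral_prodM// -integralD//; last 2 first.
- exact: (integrable_prodM ic ic).
- exact: (integrable_prodM is_ is_).
apply: eq_integral => z _; rewrite -EFinD; congr EFin.
by rewrite mulrBl cosB; ring.
Qed.

Lemma integrable_poisson_autocorrelation a e : 0 < e ->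
  mu.-integrable setT (EFin \o a) ->
  (mu \x mu2)%E.-integrable setT
   (fun p : TR * (TR * TR) => ((poisson_weight e p.1 * (a p.2.1 * a p.2.2)) *
      cos (((p.2.1 : R) - p.2.2) * p.1))%:E).
Proof.
move=> e0 ia.
apply: integrableM_bounded.
- have i2 : mu2.-integrable setT (EFin \o (fun z : TR * TR => a z.1 * a z.2)).
    exact: integrable_prodM.
  exact: (integrable_prodM (integrable_poisson_weight e0) i2).
- apply: (measurableT_comp measurable_cos); apply: measurable_funM => //.
  apply: measurable_funB.
    exact: (measurableT_comp measurable_fst measurable_snd).
  exact: (measurableT_comp measurable_snd measurable_snd).
- by move=> x; exact: norm_cos_le1.
Qed.

(** The weight makes the triple integral absolutely convergent. Integrating first in the frequency
    leaves the cosine transform of the weight at [z.1 - z.2], which is the Poisson kernel. *)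
Lemma integral_poisson_power_spectrum a e : 0 < e -> mu.-integrable setT (EFin \o a) ->
  (\int[mu]_xi (poisson_weight e xi * power_spectrum a xi)%:E =
  \int[mu2]_z (a z.1 * a z.2 * poisson_kernel e ((z.1 : R) - z.2))%:E)%E.
Proof.
move=> e0 ia.
have := Fubini (integrable_poisson_autocorrelation e0 ia) => /=.
under eq_integral => xi _.
  under eq_integral do rewrite -mulrA EFinM.
  rewrite integralZl//; last first.
    apply: integrableM_bounded; first exact: integrable_prodM.
      apply: (measurableT_comp measurable_cos); apply: measurable_funM => //.
      exact: measurable_funB.
    by move=> x; exact: norm_cos_le1.
  rewrite power_spectrumE// -EFinM.
  over.
move=> ->; apply: eq_integral => z _.
under eq_integral do rewrite mulrAC mulrC EFinM.
rewrite integralZl//; last exact: integrable_poisson_weight_cos.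
by rewrite integral_poisson_weight_cos.
Qed.

End power_spectrum.

(** * Plancherel's identity for real functions *)

Section plancherel_real_line.
Variable R : realType.
Local Notation mu := (@lebesgue_measure R).
Local Notation TR := (measurableTypeR R).
Local Notation mu2 := (@lebesgue2 R).
Implicit Types (a : TR -> R).
Local Open Scope ereal_scope.

Definition sqr_translation a (h : R) : \bar R :=
  \int[mu]_x ((a ((x : R) + h)%R - a x) ^+ 2)%:E.

Lemma ge0_integral_poisson_scale (g : TR -> \bar R) (e : R) : (0 < e)%R ->
  measurable_fun setT g -> (forall x, 0 <= g x) ->
  \int[mu]_x ((poisson_kernel e x)%:E * g x) =
  \int[mu]_x ((poisson_kernel 1 x)%:E * g (e * x)%R).
Proof.
move=> e0 mg g0.
have mP := measurable_poisson_kernel e0.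
have mF : measurable_fun [set: TR] (fun x : TR => (poisson_kernel e x)%:E * g x).
  by apply: emeasurable_funM => //; exact/measurable_EFinP.
have F0 (x : TR) : 0 <= (poisson_kernel e x)%:E * g x.
  by rewrite mule_ge0// lee_fin poisson_kernel_ge0.
rewrite -(@ge0_integral_affine R e 0%R (fun x => (poisson_kernel e x)%:E * g x))//; last first.
  by rewrite gt_eqF.
rewrite -ge0_integralZl_EFin//; last first.
  have /= := @measurable_affine R e 0 => h.
  exact: (measurableT_comp mF h).
apply: eq_integral => x _; rewrite addr0 muleA -EFinM gtr0_norm//.
congr ((_)%:E * _); rewrite /poisson_kernel; field.
by rewrite !gt_eqF// ?ltr_pwDl ?sqr_ge0// exprn_gt0.
Qed.

Lemma integral_poisson_kernel (e x : R) : (0 < e)%R ->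
  \int[mu]_y (poisson_kernel e (x - y)%R)%:E = (2 * pi)%:E.
Proof.
move=> e0; have mP := measurable_poisson_kernel e0.
rewrite (@ge0_integral_reflect R x (fun t => (poisson_kernel e t)%:E)); last 2 first.
- exact/measurable_EFinP.
- by move=> t; rewrite lee_fin poisson_kernel_ge0.
have := @ge0_integral_poisson_scale (cst 1) e e0 (measurable_cst _) (fun=> lee01).
under eq_integral do rewrite mule1.
under [in X in _ = X -> _]eq_integral do rewrite mule1.
by move=> ->; exact: integral_poisson_kernel1.
Qed.

Lemma measurable_sub2 : measurable_fun [set: TR * TR]
  (fun z => (z.1 : R) - z.2 : TR)%R.
Proof. exact: measurable_funB. Qed.

Lemma measurable_poisson_sub (e : R) : (0 < e)%R ->
  measurable_fun [set: TR * TR] (fun z => poisson_kernel e ((z.1 : R) - z.2)%R).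
Proof.
move=> e0; exact: (measurableT_comp (measurable_poisson_kernel e0) measurable_sub2).
Qed.

Lemma integral2_sqr_poisson1 a e : (0 < e)%R -> measurable_fun setT a ->
  \int[mu2]_z ((a z.1) ^+ 2 * poisson_kernel e ((z.1 : R) - z.2)%R)%:E =
  (2 * pi)%:E * \int[mu]_x ((a x) ^+ 2)%:E.
Proof.
move=> e0 ma.
have mF : measurable_fun [set: TR * TR]
    (fun z => ((a z.1) ^+ 2 * poisson_kernel e ((z.1 : R) - z.2)%R)%:E).
  apply/measurable_EFinP; apply: measurable_funM; last exact: measurable_poisson_sub.
  by apply: measurable_funX; exact: measurableT_comp.
rewrite (fubini_tonelli1 _ mF) => [|z]; last first.
  by rewrite lee_fin mulr_ge0 ?sqr_ge0// poisson_kernel_ge0.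
rewrite /fubini_F /=.
under eq_integral => x _.
  under eq_integral do rewrite EFinM.
  rewrite ge0_integralZl_EFin ?sqr_ge0//; last 2 first.
  - by move=> y _; rewrite lee_fin poisson_kernel_ge0.
  - apply/measurable_EFinP.
    exact: (measurable_fun_pair2 x (measurable_poisson_sub e0)).
  rewrite integral_poisson_kernel//.
  over.
rewrite ge0_integralZr ?lee_fin ?mulr_ge0 ?pi_ge0//; first by rewrite muleC.
- exact: measurable_sqr_EFin.
- by move=> x _; rewrite lee_fin sqr_ge0.
Qed.

Lemma integral2_sqr_poisson2 a e : (0 < e)%R -> measurable_fun setT a ->
  \int[mu2]_z ((a z.2) ^+ 2 * poisson_kernel e ((z.1 : R) - z.2)%R)%:E =
  (2 * pi)%:E * \int[mu]_x ((a x) ^+ 2)%:E.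
Proof.
move=> e0 ma; rewrite -(integral2_sqr_poisson1 e0 ma).
have mF : measurable_fun [set: TR * TR]
    (fun z => ((a z.2) ^+ 2 * poisson_kernel e ((z.1 : R) - z.2)%R)%:E).
  apply/measurable_EFinP; apply: measurable_funM; last exact: measurable_poisson_sub.
  by apply: measurable_funX; exact: measurableT_comp.
have mG : measurable_fun [set: TR * TR]
    (fun z => ((a z.1) ^+ 2 * poisson_kernel e ((z.1 : R) - z.2)%R)%:E).
  apply/measurable_EFinP; apply: measurable_funM; last exact: measurable_poisson_sub.
  by apply: measurable_funX; exact: measurableT_comp.
rewrite (fubini_tonelli2 _ mF) => [|z]; last first.
  by rewrite lee_fin mulr_ge0 ?sqr_ge0// poisson_kernel_ge0.
rewrite (fubini_tonelli1 _ mG) => [|z]; last first.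
  by rewrite lee_fin mulr_ge0 ?sqr_ge0// poisson_kernel_ge0.
apply: eq_integral => x _; apply: eq_integral => y _ /=.
by rewrite /poisson_kernel -[in LHS](sqrrN (y - x)%R) opprB.
Qed.

(** After the substitution x = y + h and the scaling h = e t, the parameter [e] survives only in the
    translation, while the weight is a fixed integrable function. This prepares dominated
    convergence as [e] tends to 0. *)
Lemma integral2_sqr_diff_poisson a e : (0 < e)%R -> measurable_fun setT a ->
  \int[mu2]_z ((a z.1 - a z.2) ^+ 2 * poisson_kernel e ((z.1 : R) - z.2)%R)%:E =
  \int[mu]_t ((poisson_kernel 1 t)%:E * sqr_translation a (e * t)%R).
Proof.
move=> e0 ma.
pose f (z : TR * TR) : \bar R :=
  ((a z.1 - a z.2) ^+ 2 * poisson_kernel e ((z.1 : R) - z.2)%R)%:E.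
have mf : measurable_fun [set: TR * TR] f.
  apply/measurable_EFinP; apply: measurable_funM; last exact: measurable_poisson_sub.
  by apply: measurable_funX; apply: measurable_funB; exact: measurableT_comp.
have f0 z : 0 <= f z by rewrite lee_fin mulr_ge0 ?sqr_ge0// poisson_kernel_ge0.
pose g (z : TR * TR) : \bar R :=
  (poisson_kernel e z.1)%:E * ((a ((z.2 : R) + z.1)%R - a z.2) ^+ 2)%:E.
have mD : measurable_fun [set: TR * TR] (fun z => (z.2 : R) + z.1 : TR)%R.
  exact: measurable_funD.
have ms : measurable_fun [set: TR * TR]
    (fun z => ((a ((z.2 : R) + z.1)%R - a z.2) ^+ 2)%:E).
  apply: measurable_sqr_EFin; apply: measurable_funB; last exact: measurableT_comp.
  exact: (measurableT_comp ma mD).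
have mg : measurable_fun [set: TR * TR] g.
  apply: emeasurable_funM => //; apply/measurable_EFinP.
  exact: (measurableT_comp (measurable_poisson_kernel e0)).
have g0 z : 0 <= g z by rewrite mule_ge0// lee_fin ?sqr_ge0// poisson_kernel_ge0.
rewrite (fubini_tonelli2 _ mf f0).
transitivity (\int[mu]_y \int[mu]_h g (h, y)).
  apply: eq_integral => y _; rewrite /fubini_G.
  rewrite -(@ge0_integral_shift R y (fun x => f (x, y)))//; last first.
    exact: (measurable_fun_pair1 y mf).
  apply: eq_integral => h _; rewrite /f /g /= addrK -EFinM mulrC.
  by rewrite (addrC y h).
rewrite -(fubini_tonelli _ mg g0).
rewrite -ge0_integral_poisson_scale//.
- apply: eq_integral => h _; rewrite /g /= ge0_integralZl_EFin ?poisson_kernel_ge0//.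
  + by move=> y _; rewrite lee_fin sqr_ge0.
  + exact: (measurable_fun_pair2 h ms).
- apply: (measurable_fun_fubini_tonelli_F (m2 := mu) _ ms) => z.
  by rewrite lee_fin sqr_ge0.
- by move=> h; apply: integral_ge0 => x _; rewrite lee_fin sqr_ge0.
Qed.

(** Polarisation: 2ab = a^2 + b^2 - (a - b)^2 is integrated against the kernel, with a and b the
    values at two points. The squares give the norm because the kernel has constant mass; the
    difference gives the defect. *)
Lemma poisson_power_spectrumE a e : (0 < e)%R ->
  mu.-integrable setT (EFin \o a) -> \int[mu]_x ((a x) ^+ 2)%:E < +oo ->
  \int[mu]_xi (poisson_weight e xi * power_spectrum a xi)%:E +
    2^-1%:E * \int[mu]_t ((poisson_kernel 1 t)%:E * sqr_translation a (e * t)%R) =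
  (2 * pi)%:E * \int[mu]_x ((a x) ^+ 2)%:E.
Proof.
move=> e0 ia a2.
have ma : measurable_fun setT a by apply/measurable_EFinP; case/integrableP : ia.
rewrite integral_poisson_power_spectrum// -integral2_sqr_diff_poisson//.
have mP := measurable_poisson_sub e0.
have ma1 : measurable_fun [set: TR * TR] (fun z => a z.1) by exact: measurableT_comp.
have ma2 : measurable_fun [set: TR * TR] (fun z => a z.2) by exact: measurableT_comp.
have A0 : 0 <= \int[mu]_x ((a x) ^+ 2)%:E.
  by apply: integral_ge0 => x _; rewrite lee_fin sqr_ge0.
have Afin : (2 * pi)%:E * \int[mu]_x ((a x) ^+ 2)%:E < +oo.
  by rewrite lte_mul_pinfty// lee_fin mulr_ge0 ?pi_ge0.
pose p (z : TR * TR) := poisson_kernel e ((z.1 : R) - z.2)%R.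
have p0 z : (0 <= p z)%R by exact: poisson_kernel_ge0.
have sp0 (x : R) z : (0 <= x ^+ 2 * p z)%R by rewrite mulr_ge0// sqr_ge0.
have i1 : mu2.-integrable setT (EFin \o (fun z => (a z.1) ^+ 2 * p z)%R).
  apply/integrableP; split.
    by apply/measurable_EFinP; apply: measurable_funM => //; exact: measurable_funX.
  under eq_integral => z _ do
    rewrite /= ger0_norm//.
  by rewrite integral2_sqr_poisson1.
have i2 : mu2.-integrable setT (EFin \o (fun z => (a z.2) ^+ 2 * p z)%R).
  apply/integrableP; split.
    by apply/measurable_EFinP; apply: measurable_funM => //; exact: measurable_funX.
  under eq_integral => z _ do
    rewrite /= ger0_norm//.
  by rewrite integral2_sqr_poisson2.
have i3 : mu2.-integrable setT (EFin \o (fun z => (a z.1 - a z.2) ^+ 2 * p z)%R).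
  apply: le_integrable (integrableZl measurableT 2 (integrableD measurableT i1 i2)) => //.
    apply/measurable_EFinP; apply: measurable_funM => //.
    by apply: measurable_funX; exact: measurable_funB.
  move=> z _ /=; rewrite lee_fin ger0_norm ?sp0// ger0_norm; last first.
    by rewrite mulr_ge0// addr_ge0.
  have : ((a z.1 - a z.2) ^+ 2 <= 2 * (a z.1 ^+ 2 + a z.2 ^+ 2))%R.
    by have := sqr_ge0 (a z.1 + a z.2)%R; nra.
  by move=> /(ler_wpM2r (p0 z)) /le_trans; apply; rewrite -mulrA (mulrDl (a z.1 ^+ 2)%R).
rewrite -(integralZl measurableT i3) -integralD//; last 2 first.
- apply: le_integrable (integrableD measurableT i1 i2) => //.
    by apply/measurable_EFinP; apply: measurable_funM => //; exact: measurable_funM.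
  move=> z _ /=; rewrite lee_fin normrM (normrM (a z.1)) [leRHS]ger0_norm ?addr_ge0//.
  rewrite -/(p z) (ger0_norm (p0 z)) -mulrDl ler_wpM2r//.
  have := sqr_ge0 (`|a z.1| - `|a z.2|)%R.
  rewrite -(real_normK (num_real (a z.1))) -(real_normK (num_real (a z.2))).
  have := normr_ge0 (a z.1); have := normr_ge0 (a z.2); nra.
- exact: (integrableZl measurableT _ i3).
transitivity (2^-1%:E * (\int[mu2]_z (((a z.1) ^+ 2 * p z)%R%:E + ((a z.2) ^+ 2 * p z)%R%:E))).
  rewrite -integralZl//; last exact: (integrableD measurableT i1 i2).
  apply: eq_integral => z _; rewrite -/(p z) /=; congr EFin.
  by field.
rewrite (integralD measurableT i1 i2) integral2_sqr_poisson1// integral2_sqr_poisson2//.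
move: A0 a2; case: (\int[mu]_x _) => // r _ _.
by congr EFin; field.
Qed.

Lemma sqr_translation_le a h : measurable_fun setT a ->
  sqr_translation a h <= 4%:E * \int[mu]_x ((a x) ^+ 2)%:E.
Proof.
move=> ma; have msa := measurable_shift h ma.
apply: (le_trans (integral_sqrD_le _ msa (measurable_funN ma))).
rewrite (@ge0_integral_shift R h (fun x => ((a x) ^+ 2)%:E)); last 2 first.
- exact: measurable_sqr_EFin.
- by move=> x; rewrite lee_fin sqr_ge0.
under [X in _ + _ * X <= _]eq_integral do rewrite /= sqrrN.
rewrite -ge0_muleDl ?lee_fin// -EFinD (_ : 2 + 2 = 4)%R//.
lra.
Qed.

Lemma measurable_sqr_translation a (e : R) : measurable_fun setT a ->
  measurable_fun [set: TR] (fun t : TR => sqr_translation a (e * t)%R).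
Proof.
move=> ma.
have ms : measurable_fun [set: TR * TR]
    (fun z => ((a ((z.2 : R) + e * z.1)%R - a z.2) ^+ 2)%:E).
  apply: measurable_sqr_EFin; apply: measurable_funB; last exact: measurableT_comp.
  apply: (measurableT_comp ma (g := fun z : TR * TR => ((z.2 : R) + e * z.1)%R : TR)).
  by apply: measurable_funD => //; exact: measurable_funM.
apply: (measurable_fun_fubini_tonelli_F (m2 := mu) _ ms) => z.
by rewrite lee_fin sqr_ge0.
Qed.

(** For each [t] the integrand tends to 0 by continuity of translations in L^2, and
    [sqr_translation_le] provides a majorant proportional to the kernel of parameter 1. *)
Lemma poisson_defect_cvg0 a : measurable_fun setT a ->
  \int[mu]_x ((a x) ^+ 2)%:E < +oo ->
  \int[mu]_t ((poisson_kernel 1 t)%:E * sqr_translation a (k.+1%:R^-1 * t)%R)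
    @[k --> \oo] --> 0.
Proof.
move=> ma a2.
have A0 : 0 <= \int[mu]_x ((a x) ^+ 2)%:E.
  by apply: integral_ge0 => x _; rewrite lee_fin sqr_ge0.
have mP := measurable_poisson_kernel (@ltr01 R).
have s0 h : 0 <= sqr_translation a h.
  by apply: integral_ge0 => x _; rewrite lee_fin sqr_ge0.
have mF k : measurable_fun [set: TR] (fun t : TR =>
    (poisson_kernel 1 t)%:E * sqr_translation a (k.+1%:R^-1 * t)%R).
  apply: emeasurable_funM; last exact: measurable_sqr_translation.
  exact/measurable_EFinP.
have cF : {ae mu, forall t : TR, setT t -> (fun k => (poisson_kernel 1 t)%:E *
    sqr_translation a (k.+1%:R^-1 * t)%R) @ \oo --> (cst 0 : TR -> \bar R) t}.
  apply: aeW => t _; rewrite /= -(mule0 (poisson_kernel 1 t)%:E); apply: cvgeZl => //.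
  apply: (@L2_translation_cvg R a (fun k => k.+1%:R^-1 * t)%R `|t : R|%R) => //.
    move=> k; rewrite normrM ler_piMl// ger0_norm// invf_le1// ler1n//.
  rewrite -(mul0r (t : R)); apply: cvgM; last exact: cvg_cst.
  exact: cvg_harmonic.
pose G (t : TR) : \bar R := (poisson_kernel 1 t)%:E * (4%:E * \int[mu]_x ((a x) ^+ 2)%:E).
have iG : mu.-integrable setT G.
  rewrite /G -(@fineK _ (\int[mu]_x _)) ?ge0_fin_numE// -EFinM.
  apply: integrableZr => //.
  apply/integrableP; split; first exact/measurable_EFinP.
  under eq_integral do rewrite gee0_abs ?lee_fin ?poisson_kernel_ge0//.
  by rewrite integral_poisson_kernel1 ltry.
have dF : {ae mu, forall (t : TR) k, setT t -> `|(poisson_kernel 1 t)%:E *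
    sqr_translation a (k.+1%:R^-1 * t)%R| <= G t}.
  apply: aeW => t k _; rewrite gee0_abs ?mule_ge0 ?lee_fin ?poisson_kernel_ge0//.
  by rewrite lee_wpmul2l ?lee_fin ?poisson_kernel_ge0// sqr_translation_le.
have [_ _] := dominated_convergence measurableT mF (measurable_cst _) cF iG dF.
by rewrite integral0.
Qed.

(** Along the scales 1/(k+1) the weighted spectrum increases to the full one and the defect tends to
    0, while the sum of the two terms is independent of k. *)
Lemma plancherel_real a : mu.-integrable setT (EFin \o a) ->
  \int[mu]_x ((a x) ^+ 2)%:E < +oo ->
  \int[mu]_xi (power_spectrum a xi)%:E = (2 * pi)%:E * \int[mu]_x ((a x) ^+ 2)%:E.
Proof.
move=> ia a2.
have ma : measurable_fun setT a by apply/measurable_EFinP; case/integrableP : ia.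
have S0 xi : (0 <= power_spectrum a xi)%R by rewrite addr_ge0 ?sqr_ge0.
have mS := measurable_power_spectrum ma.
have lim1 : \int[mu]_xi (poisson_weight k.+1%:R^-1 xi * power_spectrum a xi)%:E
    @[k --> \oo] --> \int[mu]_xi (power_spectrum a xi)%:E.
  have := @cvg_monotone_convergence _ TR R mu setT measurableT
    (fun k xi => (poisson_weight k.+1%:R^-1 xi * power_spectrum a xi)%:E).
  have -> : (fun x : TR => limn ((fun k xi => (poisson_weight k.+1%:R^-1 xi * power_spectrum a xi)%:E) ^~ x)) =
      (fun x : TR => (power_spectrum a x)%:E).
    apply/funext => x; apply/cvg_lim => //; apply: cvg_EFin; first exact: nearW.
    rewrite -[X in _ --> X]mul1r; apply: cvgM; last exact: cvg_cst.
    have hx : (- (k.+1%:R^-1 * `|x : R|))%R @[k --> \oo] --> (0:R)%R.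
      rewrite -oppr0 -(mul0r `|x : R|%R); apply: cvgN; apply: cvgM; last exact: cvg_cst.
      exact: cvg_harmonic.
    have he : expR (- (k.+1%:R^-1 * `|x : R|))%R @[k --> \oo] --> expR (0:R)%R.
      exact: (cvg_comp _ _ hx (@continuous_expR R 0%R)).
    by rewrite expR0 in he.
  apply.
  - move=> k; apply/measurable_EFinP; apply: measurable_funM => //.
    exact: measurable_poisson_weight.
  - by move=> k x _; rewrite lee_fin mulr_ge0 ?expR_ge0.
  - move=> x _ m n mn; rewrite lee_fin ler_wpM2r// ler_expR lerN2 ler_wpM2r//.
    by rewrite lef_pV2 ?posrE// ler_nat.
have lim2 := cvgeZl (y := 2^-1%:E) isT (poisson_defect_cvg0 ma a2).
rewrite mule0 in lim2.
have fd : \int[mu]_xi (power_spectrum a xi)%:E +? 0 by exact: fin_num_adde_defl.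
have lim3 : (2 * pi)%:E * \int[mu]_x ((a x) ^+ 2)%:E @[_ --> \oo] -->
    \int[mu]_xi (power_spectrum a xi)%:E.
  rewrite -[X in _ --> X]adde0; apply: cvg_trans (cvgeD fd lim1 lim2).
  by apply: near_eq_cvg; apply: nearW => k; rewrite poisson_power_spectrumE.
exact: (cvg_unique (@ereal_hausdorff R) lim3 (cvg_cst _)).
Qed.

End plancherel_real_line.

(** * The Fourier transform on space-time *)

Section oscillatory_plancherel.
Variable R : realType.
Local Open Scope ereal_scope.

(* [p + i q] is transformed with the kernel [exp (- i phi)] *)
Definition hat_re d (T : measurableType d) (m : {measure set T -> \bar R})
    (phi : T * T -> R) (p q : T -> R) (xi : T) : R :=
  (\int[m]_x (p x * cos (phi (x, xi)) + q x * sin (phi (x, xi))))%R.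

Definition hat_im d (T : measurableType d) (m : {measure set T -> \bar R})
    (phi : T * T -> R) (p q : T -> R) (xi : T) : R :=
  (\int[m]_x (q x * cos (phi (x, xi)) - p x * sin (phi (x, xi))))%R.

(** Stated for an abstract measure and phase because in this form the identity is stable under
    products and can be iterated from dimension one to dimension four. *)
Definition plancherel_phase d (T : measurableType d) (m : {measure set T -> \bar R})
    (phi : T * T -> R) (c : R) : Prop := forall p q : T -> R,
  m.-integrable setT (EFin \o p) -> m.-integrable setT (EFin \o q) ->
  \int[m]_x ((p x) ^+ 2 + (q x) ^+ 2)%:E < +oo ->
  \int[m]_xi ((hat_re m phi p q xi) ^+ 2 + (hat_im m phi p q xi) ^+ 2)%:E =
  c%:E * \int[m]_x ((p x) ^+ 2 + (q x) ^+ 2)%:E.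

Section measurability.
Context d (T : measurableType d) (m : {sigma_finite_measure set T -> \bar R}).
Variables (phi : T * T -> R) (p q : T -> R).
Hypotheses (mphi : measurable_fun setT phi) (mp : measurable_fun setT p)
  (mq : measurable_fun setT q).

Lemma measurable_swap_phase : measurable_fun setT (fun z : T * T => phi (z.2, z.1)).
Proof. by apply: (measurableT_comp mphi); exact: measurable_fun_pair. Qed.

Lemma measurable_hat_re : measurable_fun setT (hat_re m phi p q).
Proof.
apply: (@measurable_Rintegral1 _ _ T T R m
  (fun z => (p z.2 * cos (phi (z.2, z.1)) + q z.2 * sin (phi (z.2, z.1)))%R)).
have ms := measurable_swap_phase.
apply: measurable_funD; apply: measurable_funM; try exact: measurableT_comp.
  exact: (measurableT_comp (@measurable_cos R) ms).
exact: (measurableT_comp (@measurable_sin R) ms).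
Qed.

Lemma measurable_hat_im : measurable_fun setT (hat_im m phi p q).
Proof.
apply: (@measurable_Rintegral1 _ _ T T R m
  (fun z => (q z.2 * cos (phi (z.2, z.1)) - p z.2 * sin (phi (z.2, z.1)))%R)).
have ms := measurable_swap_phase.
apply: measurable_funB; apply: measurable_funM; try exact: measurableT_comp.
  exact: (measurableT_comp (@measurable_cos R) ms).
exact: (measurableT_comp (@measurable_sin R) ms).
Qed.

End measurability.

Section integrability.
Context d (T : measurableType d) (m : {measure set T -> \bar R}).
Variables (psi : T -> R) (p : T -> R).
Hypotheses (mpsi : measurable_fun setT psi) (ip : m.-integrable setT (EFin \o p)).

Lemma integrableM_cos : m.-integrable setT (fun x => (p x * cos (psi x))%:E).
Proof.
apply: integrableM_bounded => //; last by move=> x; exact: norm_cos_le1.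
exact: (measurableT_comp (@measurable_cos R) mpsi).
Qed.

Lemma integrableM_sin : m.-integrable setT (fun x => (p x * sin (psi x))%:E).
Proof.
apply: integrableM_bounded => //; last by move=> x; exact: norm_sin_le1.
exact: (measurableT_comp (@measurable_sin R) mpsi).
Qed.

End integrability.

Section real_line.
Local Notation mu := (@lebesgue_measure R).
Local Notation TR := (measurableTypeR R).

Definition phase1 (z : TR * TR) : R := ((z.1 : R) * z.2)%R.

Lemma measurable_phase1 : measurable_fun setT phase1.
Proof. exact: measurable_funM. Qed.

(** For real and imaginary parts [p] and [q], the squared modulus of the transform is the sum of the
    two spectra plus the cross term 2 (Ac Bs - As Bc), which is odd in the frequency. The integral
    is added to its reflection so that this term cancels pointwise. *)
Lemma plancherel_phase1 : plancherel_phase mu phase1 (2 * pi).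
Proof.
move=> p q ip iq pq.
have mp : measurable_fun setT p by apply/measurable_EFinP; case/integrableP : ip.
have mq : measurable_fun setT q by apply/measurable_EFinP; case/integrableP : iq.
have mp2 := measurable_sqr_EFin mp; have mq2 := measurable_sqr_EFin mq.
have Dpq : \int[mu]_x ((p x) ^+ 2 + (q x) ^+ 2)%:E =
    \int[mu]_x ((p x) ^+ 2)%:E + \int[mu]_x ((q x) ^+ 2)%:E.
  under eq_integral do rewrite EFinD.
  by rewrite ge0_integralD// => x _; rewrite lee_fin sqr_ge0.
have p2 : \int[mu]_x ((p x) ^+ 2)%:E < +oo.
  apply: le_lt_trans pq; rewrite Dpq leeDl//; apply: integral_ge0 => x _.
  by rewrite lee_fin sqr_ge0.
have q2 : \int[mu]_x ((q x) ^+ 2)%:E < +oo.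
  apply: le_lt_trans pq; rewrite Dpq leeDr//; apply: integral_ge0 => x _.
  by rewrite lee_fin sqr_ge0.
pose Ac := cos_transform p; pose As := sin_transform p.
pose Bc := cos_transform q; pose Bs := sin_transform q.
have mx (xi : R) : measurable_fun [set: TR] (fun x : TR => ((x : R) * xi)%R).
  exact: measurable_funM.
have reE xi : hat_re mu phase1 p q xi = (Ac xi + Bs xi)%R.
  rewrite /hat_re RintegralD//; first exact: (integrableM_cos (mx xi) ip).
  exact: (integrableM_sin (mx xi) iq).
have imE xi : hat_im mu phase1 p q xi = (Bc xi - As xi)%R.
  rewrite /hat_im RintegralB//; first exact: (integrableM_cos (mx xi) iq).
  exact: (integrableM_sin (mx xi) ip).
pose S xi := ((power_spectrum p xi + power_spectrum q xi)%R%:E).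
pose g xi : \bar R := ((hat_re mu phase1 p q xi) ^+ 2 + (hat_im mu phase1 p q xi) ^+ 2)%:E.
have mg : measurable_fun [set: TR] g.
  apply/measurable_EFinP; apply: measurable_funD; apply: measurable_funX.
    exact: (measurable_hat_re mu measurable_phase1 mp mq).
  exact: (measurable_hat_im mu measurable_phase1 mp mq).
have g0 xi : 0 <= g xi by rewrite lee_fin addr_ge0 ?sqr_ge0.
have evenC a (xi : R) : cos_transform a (0 - xi)%R = cos_transform a xi.
  by apply: eq_Rintegral => x _; rewrite sub0r mulrN cosN.
have oddS a (xi : R) : mu.-integrable setT (EFin \o a) ->
    sin_transform a (0 - xi)%R = (- sin_transform a xi)%R.
  move=> ia; rewrite /sin_transform -[RHS]mulN1r -RintegralZl//; last exact: (integrableM_sin (mx xi) ia).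
  by apply: eq_Rintegral => x _; rewrite sub0r mulrN sinN mulrN mulN1r.
have sumE : \int[mu]_xi g xi + \int[mu]_xi g xi = \int[mu]_xi S xi + \int[mu]_xi S xi.
  have mS : measurable_fun [set: TR] S.
    apply/measurable_EFinP; apply: measurable_funD; exact: measurable_power_spectrum.
  have S0 xi : 0 <= S xi by rewrite lee_fin !addr_ge0 ?sqr_ge0.
  have mg' : measurable_fun [set: TR] (fun xi => g (0 - xi)%R).
    apply: (measurableT_comp mg (g := (fun xi : R => (0 - xi)%R) : TR -> TR)).
    exact: measurable_funB.
  rewrite -[X in _ + X](@ge0_integral_reflect R 0)//.
  rewrite -!ge0_integralD//.
  apply: eq_integral => xi _; rewrite /g /S -!EFinD; congr EFin.
  rewrite !reE !imE /power_spectrum /Ac /As /Bc /Bs !evenC !oddS//.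
  ring.
rewrite -/g Dpq muleDr//; last first.
  by rewrite ge0_adde_def// inE; apply: integral_ge0 => x _; rewrite lee_fin sqr_ge0.
rewrite -!plancherel_real// -ge0_integralD//; last 4 first.
- by move=> x _; rewrite lee_fin addr_ge0 ?sqr_ge0.
- by apply/measurable_EFinP; exact: measurable_power_spectrum.
- by move=> x _; rewrite lee_fin addr_ge0 ?sqr_ge0.
- by apply/measurable_EFinP; exact: measurable_power_spectrum.
move/(congr1 (fun z => 2^-1%:E * z)) : sumE.
(* A doubled value can be halved in the extended reals even when it is infinite. *)
have half (x : \bar R) : 2^-1%:E * (x + x) = x.
  case: x => [r| |]; first by congr EFin; field.
    by rewrite addye// gt0_muley// lte_fin.
  by rewrite addNye gt0_muleNy// lte_fin.
by rewrite !half => ->.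
Qed.

End real_line.

End oscillatory_plancherel.

(** * Plancherel's identity on product spaces *)

Section product_plancherel.
Context d1 d2 (T1 : measurableType d1) (T2 : measurableType d2) (R : realType).
Variables (m1 : {sigma_finite_measure set T1 -> \bar R})
  (m2 : {sigma_finite_measure set T2 -> \bar R}).
Variables (phi1 : T1 * T1 -> R) (phi2 : T2 * T2 -> R).
Hypotheses (mphi1 : measurable_fun setT phi1) (mphi2 : measurable_fun setT phi2).
Local Open Scope ereal_scope.

Definition phase_prod (z : (T1 * T2) * (T1 * T2)) : R :=
  (phi1 (z.1.1, z.2.1) + phi2 (z.1.2, z.2.2))%R.

Lemma measurable_phase_prod : measurable_fun setT phase_prod.
Proof.
have c11 : measurable_fun [set: (T1 * T2) * (T1 * T2)] (fun z => z.1.1).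
  exact: (measurableT_comp measurable_fst measurable_fst).
have c12 : measurable_fun [set: (T1 * T2) * (T1 * T2)] (fun z => z.1.2).
  exact: (measurableT_comp measurable_snd measurable_fst).
have c21 : measurable_fun [set: (T1 * T2) * (T1 * T2)] (fun z => z.2.1).
  exact: (measurableT_comp measurable_fst measurable_snd).
have c22 : measurable_fun [set: (T1 * T2) * (T1 * T2)] (fun z => z.2.2).
  exact: (measurableT_comp measurable_snd measurable_snd).
apply: measurable_funD.
  exact: (measurableT_comp mphi1 (measurable_fun_pair c11 c21)).
exact: (measurableT_comp mphi2 (measurable_fun_pair c12 c22)).
Qed.

Lemma norm_fine_le (x : \bar R) : (`|fine x|%R)%:E <= `|x|.
Proof. by case: x => [r| |] //=; rewrite normr0 leey. Qed.

Section fixed_function.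
Variables (p q : T1 * T2 -> R).
Hypotheses (ip : (m1 \x m2).-integrable setT (EFin \o p))
  (iq : (m1 \x m2).-integrable setT (EFin \o q)).

Let mp : measurable_fun setT p.
Proof. by apply/measurable_EFinP; case/integrableP : ip. Qed.
Let mq : measurable_fun setT q.
Proof. by apply/measurable_EFinP; case/integrableP : iq. Qed.

(** The transform in the first variable alone: [z.1] is a frequency, while [z.2] is still a point of
    the original space. *)
Definition partial_hat_re (z : T1 * T2) : R :=
  hat_re m1 phi1 (fun x => p (x, z.2)) (fun x => q (x, z.2)) z.1.
Definition partial_hat_im (z : T1 * T2) : R :=
  hat_im m1 phi1 (fun x => p (x, z.2)) (fun x => q (x, z.2)) z.1.

Let mpr (f : T1 * T2 -> R) : measurable_fun setT f ->
  measurable_fun setT (fun w : (T1 * T2) * T1 => f (w.2, w.1.2)).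
Proof.
move=> mf; apply: (measurableT_comp mf); apply: measurable_fun_pair => //.
exact: (measurableT_comp measurable_snd measurable_fst).
Qed.

Let mph : measurable_fun setT (fun w : (T1 * T2) * T1 => phi1 (w.2, w.1.1)).
Proof.
apply: (measurableT_comp mphi1); apply: measurable_fun_pair => //.
exact: (measurableT_comp measurable_fst measurable_fst).
Qed.

Lemma measurable_partial_hat_re : measurable_fun setT partial_hat_re.
Proof.
apply: (@measurable_Rintegral1 _ _ (T1 * T2)%type T1 R m1 (fun w =>
  (p (w.2, w.1.2) * cos (phi1 (w.2, w.1.1)) + q (w.2, w.1.2) * sin (phi1 (w.2, w.1.1)))%R)).
apply: measurable_funD; apply: measurable_funM; try exact: mpr.
  exact: (measurableT_comp (@measurable_cos R) mph).
exact: (measurableT_comp (@measurable_sin R) mph).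
Qed.

Lemma measurable_partial_hat_im : measurable_fun setT partial_hat_im.
Proof.
apply: (@measurable_Rintegral1 _ _ (T1 * T2)%type T1 R m1 (fun w =>
  (q (w.2, w.1.2) * cos (phi1 (w.2, w.1.1)) - p (w.2, w.1.2) * sin (phi1 (w.2, w.1.1)))%R)).
apply: measurable_funB; apply: measurable_funM; try exact: mpr.
  exact: (measurableT_comp (@measurable_cos R) mph).
exact: (measurableT_comp (@measurable_sin R) mph).
Qed.

Let msec1 (xi : T1) : measurable_fun setT (fun x => phi1 (x, xi)).
Proof. exact: measurable_fun_pair1. Qed.
Let msec2 (xi : T2) : measurable_fun setT (fun x => phi2 (x, xi)).
Proof. exact: measurable_fun_pair1. Qed.

(** A partial transform at a fixed frequency is at most the L^1 norm of a section, and by Tonelli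
    these norms are integrable in the other variable. *)
Lemma integrable_partial_hat (f : T1 * T2 -> R) (g : T2 -> R) :
  (m1 \x m2).-integrable setT (EFin \o f) -> measurable_fun setT g ->
  (forall y, (`|g y|%R)%:E <= \int[m1]_x `|(f (x, y))%:E|) ->
  m2.-integrable setT (EFin \o g).
Proof.
move=> fi mg gf; apply/integrableP; split; first exact/measurable_EFinP.
have mf : measurable_fun setT (EFin \o f) by case/integrableP : fi.
apply: le_lt_trans ((integrable21ltyP m1 m2 mf).1 fi).
apply: ge0_le_integral => //.
- by apply/measurable_EFinP; exact: measurableT_comp.
- apply: (measurable_fun_fubini_tonelli_G (m1 := m1) (abse \o (EFin \o f))).
    exact: measurableT_comp.
  by move=> z; exact: abse_ge0.
- by move=> y _; exact: gf.
Qed.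

Lemma integrable_partial_hat_re (xi : T1) :
  m2.-integrable setT (EFin \o (fun y => partial_hat_re (xi, y))).
Proof.
have i3 : (m1 \x m2).-integrable setT (EFin \o (fun z =>
    (p z * cos (phi1 (z.1, xi)) + q z * sin (phi1 (z.1, xi)))%R)).
  have mz : measurable_fun setT (fun z : T1 * T2 => phi1 (z.1, xi)).
    exact: (measurableT_comp (msec1 xi)).
  exact: integrableD (integrableM_cos mz ip) (integrableM_sin mz iq).
apply: (integrable_partial_hat i3).
  exact: (measurable_fun_pair2 xi measurable_partial_hat_re).
move=> y; apply: le_trans (norm_fine_le _) _; apply: le_abse_integral => //.
have m3 : measurable_fun setT (EFin \o (fun z : T1 * T2 =>
    (p z * cos (phi1 (z.1, xi)) + q z * sin (phi1 (z.1, xi)))%R)) by case/integrableP : i3.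
exact: (measurable_fun_pair1 y m3).
Qed.

Lemma integrable_partial_hat_im (xi : T1) :
  m2.-integrable setT (EFin \o (fun y => partial_hat_im (xi, y))).
Proof.
have i3 : (m1 \x m2).-integrable setT (EFin \o (fun z =>
    (q z * cos (phi1 (z.1, xi)) - p z * sin (phi1 (z.1, xi)))%R)).
  have mz : measurable_fun setT (fun z : T1 * T2 => phi1 (z.1, xi)).
    exact: (measurableT_comp (msec1 xi)).
  exact: integrableB (integrableM_cos mz iq) (integrableM_sin mz ip).
apply: (integrable_partial_hat i3).
  exact: (measurable_fun_pair2 xi measurable_partial_hat_im).
move=> y; apply: le_trans (norm_fine_le _) _; apply: le_abse_integral => //.
have m3 : measurable_fun setT (EFin \o (fun z : T1 * T2 =>
    (q z * cos (phi1 (z.1, xi)) - p z * sin (phi1 (z.1, xi)))%R)) by case/integrableP : i3.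
exact: (measurable_fun_pair1 y m3).
Qed.

Let ae_sections : {ae m2, forall y, m1.-integrable setT (fun x => (p (x, y))%:E) /\
  m1.-integrable setT (fun x => (q (x, y))%:E)}.
Proof. by apply: filterS2 (ae_integrable2 ip) (ae_integrable2 iq) => y. Qed.

(** Fubini with the first variable innermost, and the addition formulas. The sections are integrable
    for almost every [y] only, so the inner integrals are compared almost everywhere. *)
Lemma hat_re_prod (xi : T1 * T2) : hat_re (m1 \x m2) phase_prod p q xi =
  hat_re m2 phi2 (fun y => partial_hat_re (xi.1, y))
    (fun y => partial_hat_im (xi.1, y)) xi.2.
Proof.
have mz : measurable_fun setT (fun z => phase_prod (z, xi)).
  exact: (measurable_fun_pair1 xi measurable_phase_prod).
pose F z := (p z * cos (phase_prod (z, xi)) + q z * sin (phase_prod (z, xi)))%R.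
have iF : (m1 \x m2).-integrable setT (EFin \o F).
  exact: integrableD (integrableM_cos mz ip) (integrableM_sin mz iq).
rewrite /hat_re -/(F _) /Rintegral; congr fine.
rewrite -(integral21_prod_meas1 iF); apply: ae_eq_integral => //.
- exact: measurable_fubini_G iF.
- apply/measurable_EFinP; apply: measurable_funD; apply: measurable_funM.
  + exact: (measurable_fun_pair2 _ measurable_partial_hat_re).
  + exact: (measurableT_comp (@measurable_cos R) (msec2 _)).
  + exact: (measurable_fun_pair2 _ measurable_partial_hat_im).
  + exact: (measurableT_comp (@measurable_sin R) (msec2 _)).
apply: filterS ae_sections => y [py qy] _.
have ire := integrableD measurableT (integrableM_cos (msec1 xi.1) py) (integrableM_sin (msec1 xi.1) qy).
have iim := integrableB measurableT (integrableM_cos (msec1 xi.1) qy) (integrableM_sin (msec1 xi.1) py).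
rewrite /partial_hat_re /partial_hat_im /hat_re /hat_im /=.
rewrite -!RintegralZr// -RintegralD//; last 2 first.
- exact: (integrableZr measurableT _ ire).
- exact: (integrableZr measurableT _ iim).
rewrite /fubini_G /Rintegral fineK.
  apply: eq_integral => x _; rewrite /F /phase_prod /= cosD sinD; congr EFin; ring.
apply: integrable_fin_num => //.
exact: (integrableD measurableT (integrableZr measurableT _ ire) (integrableZr measurableT _ iim)).
Qed.

Lemma hat_im_prod (xi : T1 * T2) : hat_im (m1 \x m2) phase_prod p q xi =
  hat_im m2 phi2 (fun y => partial_hat_re (xi.1, y))
    (fun y => partial_hat_im (xi.1, y)) xi.2.
Proof.
have mz : measurable_fun setT (fun z => phase_prod (z, xi)).
  exact: (measurable_fun_pair1 xi measurable_phase_prod).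
pose F z := (q z * cos (phase_prod (z, xi)) - p z * sin (phase_prod (z, xi)))%R.
have iF : (m1 \x m2).-integrable setT (EFin \o F).
  exact: integrableB (integrableM_cos mz iq) (integrableM_sin mz ip).
rewrite /hat_im -/(F _) /Rintegral; congr fine.
rewrite -(integral21_prod_meas1 iF); apply: ae_eq_integral => //.
- exact: measurable_fubini_G iF.
- apply/measurable_EFinP; apply: measurable_funB; apply: measurable_funM.
  + exact: (measurable_fun_pair2 _ measurable_partial_hat_im).
  + exact: (measurableT_comp (@measurable_cos R) (msec2 _)).
  + exact: (measurable_fun_pair2 _ measurable_partial_hat_re).
  + exact: (measurableT_comp (@measurable_sin R) (msec2 _)).
apply: filterS ae_sections => y [py qy] _.
have ire := integrableD measurableT (integrableM_cos (msec1 xi.1) py) (integrableM_sin (msec1 xi.1) qy).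
have iim := integrableB measurableT (integrableM_cos (msec1 xi.1) qy) (integrableM_sin (msec1 xi.1) py).
rewrite /partial_hat_re /partial_hat_im /hat_re /hat_im /=.
rewrite -!RintegralZr// -RintegralB//; last 2 first.
- exact: (integrableZr measurableT _ iim).
- exact: (integrableZr measurableT _ ire).
rewrite /fubini_G /Rintegral fineK.
  apply: eq_integral => x _; rewrite /F /phase_prod /= cosD sinD; congr EFin; ring.
apply: integrable_fin_num => //.
exact: (integrableB measurableT (integrableZr measurableT _ iim) (integrableZr measurableT _ ire)).
Qed.

End fixed_function.

(** [P1] is applied to almost every section in the first variable, then [P2] to the partial
    transform in the second; Tonelli for squared moduli links the two. *)
Lemma plancherel_phase_prod (c1 c2 : R) : (0 <= c1)%R -> (0 <= c2)%R ->
  plancherel_phase m1 phi1 c1 -> plancherel_phase m2 phi2 c2 ->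
  plancherel_phase (m1 \x m2) phase_prod (c2 * c1).
Proof.
move=> c10 c20 P1 P2 p q ip iq pq.
have mp : measurable_fun setT p by apply/measurable_EFinP; case/integrableP : ip.
have mq : measurable_fun setT q by apply/measurable_EFinP; case/integrableP : iq.
pose E (z : T1 * T2) : \bar R := ((p z) ^+ 2 + (q z) ^+ 2)%:E.
have mE : measurable_fun setT E.
  by apply/measurable_EFinP; apply: measurable_funD; exact: measurable_funX.
have E0 z : 0 <= E z by rewrite lee_fin addr_ge0 ?sqr_ge0.
have iE : (m1 \x m2).-integrable setT E.
  apply/integrableP; split => //.
  by under eq_integral do rewrite gee0_abs//.
pose Gr := partial_hat_re p q; pose Gi := partial_hat_im p q.
have mGr : measurable_fun setT Gr by exact: measurable_partial_hat_re.
have mGi : measurable_fun setT Gi by exact: measurable_partial_hat_im.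
pose G (z : T1 * T2) : \bar R := ((Gr z) ^+ 2 + (Gi z) ^+ 2)%:E.
have mG : measurable_fun setT G.
  by apply/measurable_EFinP; apply: measurable_funD; exact: measurable_funX.
have G0 z : 0 <= G z by rewrite lee_fin addr_ge0 ?sqr_ge0.
have intG : \int[m1]_x \int[m2]_y G (x, y) = c1%:E * \int[m1 \x m2]_z E z.
  rewrite (fubini_tonelli G mG G0) (fubini_tonelli2 E mE E0).
  rewrite -ge0_integralZl//; last 2 first.
  - exact: (measurable_fun_fubini_tonelli_G (m1 := m1) E mE E0).
  - by move=> y _; apply: integral_ge0.
  apply: ge0_ae_eq_integral => //.
  - exact: (measurable_fun_fubini_tonelli_G (m1 := m1) G mG G0).
  - by apply: measurable_funeM;
      exact: (measurable_fun_fubini_tonelli_G (m1 := m1) E mE E0).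
  - by move=> y _; apply: integral_ge0.
  - by move=> y _; rewrite mule_ge0 ?lee_fin//; apply: integral_ge0.
  apply: filterS3 (ae_integrable2 ip) (ae_integrable2 iq) (ae_integrable2 iE) => y py qy Ey _.
  rewrite /G /Gr /Gi /partial_hat_re /partial_hat_im /=.
  rewrite (P1 (fun x => p (x, y)) (fun x => q (x, y)))//.
  case/integrableP : Ey => _ /=.
  by under eq_integral do rewrite ger0_norm ?addr_ge0 ?sqr_ge0//.
have Efin : c1%:E * \int[m1 \x m2]_z E z < +oo.
  by rewrite lte_mul_pinfty// ?lee_fin// ; apply: integral_ge0.
have mint : measurable_fun setT (fun x => \int[m2]_y G (x, y)).
  exact: (measurable_fun_fubini_tonelli_F (m2 := m2) G mG G0).
(* [P2] requires a finite L^2 norm in the second variable; this holds for almost every frequency [x]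
   because the total in [intG] is finite. *)
have aeG : {ae m1, forall x, \int[m2]_y G (x, y) < +oo}.
  have iG : m1.-integrable setT (fun x => \int[m2]_y G (x, y)).
    apply/integrableP; split => //.
    under eq_integral do rewrite gee0_abs ?integral_ge0//.
    by rewrite intG.
  have := integrable_ae measurableT iG; apply: filterS => x /(_ I).
  by rewrite ge0_fin_numE// integral_ge0.
pose H (xi : T1 * T2) : \bar R :=
  ((hat_re m2 phi2 (fun y => Gr (xi.1, y)) (fun y => Gi (xi.1, y)) xi.2) ^+ 2 +
   (hat_im m2 phi2 (fun y => Gr (xi.1, y)) (fun y => Gi (xi.1, y)) xi.2) ^+ 2)%:E.
have mH : measurable_fun setT H.
  have msw (f : T1 * T2 -> R) : measurable_fun setT f ->
      measurable_fun setT (fun w : (T1 * T2) * T2 => f (w.1.1, w.2)).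
    move=> mf; apply: (measurableT_comp mf); apply: measurable_fun_pair => //.
    exact: (measurableT_comp measurable_fst measurable_fst).
  have mph : measurable_fun setT (fun w : (T1 * T2) * T2 => phi2 (w.2, w.1.2)).
    apply: (measurableT_comp mphi2); apply: measurable_fun_pair => //.
    exact: (measurableT_comp measurable_snd measurable_fst).
  apply/measurable_EFinP; apply: measurable_funD; apply: measurable_funX.
    apply: (@measurable_Rintegral1 _ _ (T1 * T2)%type T2 R m2 (fun w =>
      (Gr (w.1.1, w.2) * cos (phi2 (w.2, w.1.2)) + Gi (w.1.1, w.2) * sin (phi2 (w.2, w.1.2)))%R)).
    apply: measurable_funD; apply: measurable_funM; try exact: msw.
      exact: (measurableT_comp (@measurable_cos R) mph).
    exact: (measurableT_comp (@measurable_sin R) mph).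
  apply: (@measurable_Rintegral1 _ _ (T1 * T2)%type T2 R m2 (fun w =>
    (Gi (w.1.1, w.2) * cos (phi2 (w.2, w.1.2)) - Gr (w.1.1, w.2) * sin (phi2 (w.2, w.1.2)))%R)).
  apply: measurable_funB; apply: measurable_funM; try exact: msw.
    exact: (measurableT_comp (@measurable_cos R) mph).
  exact: (measurableT_comp (@measurable_sin R) mph).
have H0 z : 0 <= H z by rewrite lee_fin addr_ge0 ?sqr_ge0.
under eq_integral do rewrite hat_re_prod// hat_im_prod//.
rewrite (fubini_tonelli1 H mH H0) EFinM -muleA -intG -ge0_integralZl//; last first.
  by move=> x _; apply: integral_ge0.
apply: ge0_ae_eq_integral => //.
- exact: (measurable_fun_fubini_tonelli_F (m2 := m2) H mH H0).
- exact: measurable_funeM.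
- by move=> y _; apply: integral_ge0.
- by move=> y _; rewrite mule_ge0 ?lee_fin//; apply: integral_ge0.
apply: filterS aeG => x Gx _; rewrite /fubini_F /H /=.
by rewrite (P2 (fun y => Gr (x, y)) (fun y => Gi (x, y)))//;
  [exact: integrable_partial_hat_re|exact: integrable_partial_hat_im].
Qed.

End product_plancherel.

Section plancherel_R13.
Variable R : realType.

Definition phase2 := phase_prod (@phase1 R) (@phase1 R).
Definition phase3 := phase_prod phase2 (@phase1 R).
(** Nested exactly as the products that make up [R13], so that [phase13 (x, X)] is convertible with
    [dot13 x X]. *)
Definition phase13 := phase_prod (@phase1 R) phase3.

Lemma plancherel_phase13 :
  plancherel_phase (@lebesgue13 R) phase13 ((2 * pi) ^+ 4).
Proof.
have pi0 : 0 <= 2 * pi :> R by rewrite mulr_ge0// pi_ge0.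
have m1 := @measurable_phase1 R.
have m2 : measurable_fun setT phase2 by exact: measurable_phase_prod.
have m3 : measurable_fun setT phase3 by exact: measurable_phase_prod.
have P1 := @plancherel_phase1 R.
have P2 : plancherel_phase (@lebesgue2 R) phase2 ((2 * pi) * (2 * pi)).
  exact: (plancherel_phase_prod m1 m1).
have P3 : plancherel_phase (@lebesgue3 R) phase3 ((2 * pi) * ((2 * pi) * (2 * pi))).
  by apply: (plancherel_phase_prod m2 m1) => //; rewrite mulr_ge0.
rewrite (_ : (2 * pi) ^+ 4 = (2 * pi) * ((2 * pi) * (2 * pi)) * (2 * pi)); last by ring.
by apply: (plancherel_phase_prod m1 m3) => //; rewrite !mulr_ge0// pi_ge0.
Qed.

End plancherel_R13.

(** * Norm bounds for the L^2 Fourier transform *)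

Section fourier_L2.
Variable R : realType.
Local Notation mu := (@lebesgue13 R).
Local Notation Re := (@complex.Re R).
Local Notation Im := (@complex.Im R).
Implicit Types (f g u v w : R13 R -> R[i]).
Local Open Scope ereal_scope.

(** The squared L^2 norm as a plain integral, to which Tonelli and pointwise inequalities apply
    directly; [Lpnorm2E] and [sqnormE] convert it. *)
Definition sqnorm f : \bar R := \int[mu]_x ((Re (f x)) ^+ 2 + (Im (f x)) ^+ 2)%:E.

Lemma sqnorm_ge0 f : 0 <= sqnorm f.
Proof. by apply: integral_ge0 => x _; rewrite lee_fin addr_ge0 ?sqr_ge0. Qed.

Lemma normc_Re_Im (z : R[i]) : Normc.normc z = Num.sqrt (Re z ^+ 2 + Im z ^+ 2).
Proof. by case: z. Qed.

Lemma Lpnorm2E f : Lpnorm 2 f = sqnorm f `^ 2^-1.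
Proof.
rewrite /Lpnorm unlock /sqnorm; congr (_ `^ _); apply: eq_integral => x _.
rewrite normc_Re_Im /= ger0_norm ?sqrtr_ge0//.
by rewrite powR_mulrn ?sqrtr_ge0// sqr_sqrtr// addr_ge0 ?sqr_ge0.
Qed.

Lemma sqnormE f : sqnorm f = Lpnorm 2 f `^ 2.
Proof. by rewrite Lpnorm2E -poweRrM mulVf// poweRe1// sqnorm_ge0. Qed.

Lemma measurable_sqnorm f : cmeasurable f ->
  measurable_fun setT (fun x => ((Re (f x)) ^+ 2 + (Im (f x)) ^+ 2)%:E).
Proof.
by move=> [mr mi]; apply/measurable_EFinP; apply: measurable_funD; exact: measurable_funX.
Qed.

Lemma sqnorm_lty f : in_Lp 2 f -> sqnorm f < +oo.
Proof. by move=> [_ f2]; rewrite sqnormE poweR_lty. Qed.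

Lemma in_L2P f : cmeasurable f -> sqnorm f < +oo -> in_Lp 2 f.
Proof. by move=> mf f2; split => //; rewrite Lpnorm2E poweR_lty. Qed.

Lemma in_L1_integrable f : in_Lp 1 f ->
  mu.-integrable setT (EFin \o (Re \o f)) /\ mu.-integrable setT (EFin \o (Im \o f)).
Proof.
move=> [[mr mi]]; rewrite /Lpnorm Lnorm1 => f1.
have mn : measurable_fun setT (fun x => Normc.normc (f x)).
  under eq_fun do rewrite normc_Re_Im.
  apply: (measurableT_comp (@measurable_sqrt R)).
  by apply: measurable_funD; exact: measurable_funX.
have ile (h : R13 R -> R) : measurable_fun setT h ->
    (forall x, h x ^+ 2 <= (Re (f x)) ^+ 2 + (Im (f x)) ^+ 2)%R ->
    mu.-integrable setT (EFin \o h).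
  move=> mh hle; apply/integrableP; split; first exact/measurable_EFinP.
  apply: le_lt_trans f1; apply: ge0_le_integral => //.
  - by apply/measurable_EFinP; exact: measurableT_comp.
  - by apply/measurable_EFinP; exact: measurableT_comp.
  move=> x _; rewrite /= lee_fin normc_Re_Im [leRHS]ger0_norm ?sqrtr_ge0//.
  by rewrite -sqrtr_sqr ler_wsqrtr.
split; apply: ile => // x; first by rewrite lerDl sqr_ge0.
by rewrite lerDr sqr_ge0.
Qed.

Lemma sqnormD_le f g : cmeasurable f -> cmeasurable g ->
  sqnorm (f \+ g)%R <= 2%:E * sqnorm f + 2%:E * sqnorm g.
Proof.
move=> mf mg; have mf2 := measurable_sqnorm mf; have mg2 := measurable_sqnorm mg.
have p0 h x : 0 <= ((Re (h x)) ^+ 2 + (Im (h x)) ^+ 2)%:E.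
  by rewrite lee_fin addr_ge0 ?sqr_ge0.
rewrite /sqnorm -!ge0_integralZl_EFin// -ge0_integralD//; last 4 first.
- by move=> x _; rewrite mule_ge0// p0.
- exact: measurable_funeM.
- by move=> x _; rewrite mule_ge0// p0.
- exact: measurable_funeM.
apply: ge0_le_integral => //.
- apply: measurable_sqnorm; case: mf mg => [mr mi] [nr ni].
  split; [under eq_fun do rewrite raddfD|under eq_fun do rewrite raddfD];
    exact: measurable_funD.
- by apply: emeasurable_funD; exact: measurable_funeM.
move=> x _; rewrite /= !raddfD lee_fin.
have := sqr_ge0 (Re (f x) - Re (g x))%R; have := sqr_ge0 (Im (f x) - Im (g x))%R.
by set a := Re _; set b := Re _; set c := Im _; set d := Im _; nra.
Qed.

Lemma cmeasurableD f g : cmeasurable f -> cmeasurable g -> cmeasurable (f \+ g)%R.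
Proof.
move=> [mr mi] [nr ni]; split; under eq_fun do rewrite raddfD; exact: measurable_funD.
Qed.

Lemma cmeasurableN f : cmeasurable f -> cmeasurable (\- f)%R.
Proof.
move=> [mr mi]; split; under eq_fun do rewrite raddfN; exact: measurable_funN.
Qed.

Lemma cmeasurableB f g : cmeasurable f -> cmeasurable g -> cmeasurable (f \- g)%R.
Proof. by move=> mf mg; exact: cmeasurableD mf (cmeasurableN mg). Qed.

Lemma sqnormN f : sqnorm (\- f)%R = sqnorm f.
Proof. by apply: eq_integral => x _; rewrite /= !raddfN !sqrrN. Qed.

Lemma sqnormB_le f g : cmeasurable f -> cmeasurable g ->
  sqnorm (f \- g)%R <= 2%:E * sqnorm f + 2%:E * sqnorm g.
Proof.
by move=> mf mg; rewrite -(sqnormN g); exact: sqnormD_le mf (cmeasurableN mg).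
Qed.

Lemma fourier_integralE f X : fourier_integral f X = Complex
  (hat_re mu (@phase13 R) (Re \o f) (Im \o f) X)
  (hat_im mu (@phase13 R) (Re \o f) (Im \o f) X).
Proof.
rewrite /fourier_integral /cintegral; congr Complex; apply: eq_Rintegral => x _;
  rewrite -[dot13 x X]/(phase13 (x, X)) /=; case: (f x) => p q /=; ring.
Qed.

Lemma measurable_phase13 : measurable_fun setT (@phase13 R).
Proof.
apply: measurable_phase_prod; first exact: measurable_phase1.
apply: measurable_phase_prod; last exact: measurable_phase1.
by apply: measurable_phase_prod; exact: measurable_phase1.
Qed.

Lemma cmeasurable_fourier_integral f : cmeasurable f -> cmeasurable (fourier_integral f).
Proof.
move=> [mr mi]; split; under eq_fun do rewrite fourier_integralE /=.
  exact: (measurable_hat_re mu measurable_phase13 mr mi).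
exact: (measurable_hat_im mu measurable_phase13 mr mi).
Qed.

Let c : R := ((2 * pi) ^+ 4)%R.

Let c0 : (0 < c)%R. Proof. by rewrite exprn_gt0// mulr_gt0// pi_gt0. Qed.

Lemma sqnorm_fourier_integral f : in_Lp 1 f -> in_Lp 2 f ->
  sqnorm (fourier_integral f) = c%:E * sqnorm f.
Proof.
move=> f1 f2; have [ir ii] := in_L1_integrable f1.
rewrite /sqnorm; under eq_integral do rewrite fourier_integralE /=.
by apply: plancherel_phase13 => //; exact: sqnorm_lty.
Qed.

Lemma fourier_integralB f g : in_Lp 1 f -> in_Lp 1 g ->
  fourier_integral (f \- g)%R = (fourier_integral f \- fourier_integral g)%R.
Proof.
move=> /in_L1_integrable[fr fi] /in_L1_integrable[gr gi].
apply/funext => X; rewrite /= !fourier_integralE.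
have mX : measurable_fun setT (fun x => phase13 (x, X)).
  exact: (measurable_fun_pair1 X measurable_phase13).
have E (a b a' b' : R) : (Complex a b - Complex a' b' = Complex (a - a') (b - b'))%R by [].
rewrite E; congr Complex; rewrite /hat_re /hat_im -RintegralB//.
- by apply: eq_Rintegral => x _ /=; case: (f x) => a b; case: (g x) => a' b' /=; ring.
- exact: integrableD (integrableM_cos mX fr) (integrableM_sin mX fi).
- exact: integrableD (integrableM_cos mX gr) (integrableM_sin mX gi).
- by apply: eq_Rintegral => x _ /=; case: (f x) => a b; case: (g x) => a' b' /=; ring.
- exact: integrableB (integrableM_cos mX fi) (integrableM_sin mX fr).
- exact: integrableB (integrableM_cos mX gi) (integrableM_sin mX gr).
Qed.

Lemma Lpnorm2_cvg0 (h : nat -> R13 R -> R[i]) (e : R) : (0 < e)%R ->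
  (fun n => Lpnorm 2 (h n)) @ \oo --> 0 -> \forall n \near \oo, sqnorm (h n) <= e%:E.
Proof.
move=> e0 h0; have se : (0 < Num.sqrt e)%R by rewrite sqrtr_gt0.
have := ereal_cvg0_near se h0; apply: filterS => n hn; rewrite sqnormE.
have -> : e%:E = (Num.sqrt e)%:E `^ 2.
  by rewrite poweR_EFin powR_mulrn ?sqrtr_ge0// sqr_sqrtr// ltW.
apply: gt0_ler_poweR => //.
- by rewrite in_itv/= leey andbT Lnorm_ge0.
- by rewrite in_itv/= leey andbT lee_fin sqrtr_ge0.
- exact: ltW.
Qed.

Lemma lee_of_forall_eps (x y : \bar R) (k : R) : (0 <= k)%R ->
  (forall e : R, (0 < e)%R -> x <= y + k%:E * e%:E) -> x <= y.
Proof.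
move=> k0 H; apply/lee_addgt0Pr => e e0.
have ke : (0 < e / (k + 1))%R by rewrite divr_gt0// ltr_wpDl.
apply: le_trans (H _ ke) _; rewrite leeD2l// -EFinM lee_fin.
by rewrite mulrA ler_pdivrMr ?ltr_wpDl// mulrDr mulr1 mulrC lerDl ltW.
Qed.

(** Plancherel is exact for the approximants. Going from the limit to an approximant and back costs
    a factor 2 each time, whence the 4. *)
Lemma is_fourier_le u v : is_fourier u v ->
  sqnorm v <= (4 * c)%:E * sqnorm u /\ sqnorm u <= (4 / c)%:E * sqnorm v.
Proof.
move=> [[mu_ u2] [mv v2] [f [fL fu fv]]].
have approx (e : R) : (0 < e)%R -> exists n, sqnorm (f n \- u)%R <= e%:E /\
    sqnorm (fourier_integral (f n) \- v)%R <= e%:E.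
  move=> e0; have [N _ H] := filterI (Lpnorm2_cvg0 e0 fu) (Lpnorm2_cvg0 e0 fv).
  by exists N; exact: H (leqnn N).
have m n : cmeasurable (f n) by case: (fL n) => -[].
have mF n : cmeasurable (fourier_integral (f n)) by exact: cmeasurable_fourier_integral.
have back (g h : R13 R -> R[i]) : cmeasurable g -> cmeasurable h ->
    sqnorm h <= 2%:E * sqnorm g + 2%:E * sqnorm (g \- h)%R.
  move=> mg mh; rewrite {1}(_ : h = (g \- (g \- h))%R).
    by apply: sqnormB_le => //; exact: cmeasurableB.
  by apply/funext => x /=; rewrite opprB addrC subrK.
have fore (g h : R13 R -> R[i]) : cmeasurable g -> cmeasurable h ->
    sqnorm g <= 2%:E * sqnorm h + 2%:E * sqnorm (g \- h)%R.
  move=> mg mh; rewrite {1}(_ : g = (h \+ (g \- h))%R).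
    by apply: sqnormD_le => //; exact: cmeasurableB.
  by apply/funext => x /=; rewrite addrC subrK.
split.
- apply: (@lee_of_forall_eps _ _ (4 * c + 2)%R); first by rewrite addr_ge0// mulr_ge0// ltW.
  move=> e e0; have [n [nu nv]] := approx e e0.
  apply: le_trans (back _ _ (mF n) mv) _.
  rewrite sqnorm_fourier_integral; [|by case: (fL n)|by case: (fL n)].
  have H1 : sqnorm (f n) <= 2%:E * sqnorm u + 2%:E * e%:E.
    by apply: le_trans (fore _ _ (m n) mu_) _; rewrite leeD2l// lee_wpmul2l.
  apply: (@le_trans _ _ (2%:E * (c%:E * (2%:E * sqnorm u + 2%:E * e%:E)) + 2%:E * e%:E)).
    by rewrite leeD// lee_wpmul2l// lee_wpmul2l// lee_fin ltW.
  move: (sqnorm_lty (conj mu_ u2)) (sqnorm_ge0 u); case: (sqnorm u) => // r _ _.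
  by rewrite -!(EFinM, EFinD) lee_fin; nra.
- have k0 : (0 <= 4 / c + 2)%R by rewrite addr_ge0// divr_ge0// ltW.
  apply: (@lee_of_forall_eps _ _ (4 / c + 2)%R) => // e e0.
  have [n [nu nv]] := approx e e0.
  apply: le_trans (back _ _ (m n) mu_) _.
  have H1 : sqnorm (fourier_integral (f n)) <= 2%:E * sqnorm v + 2%:E * e%:E.
    by apply: le_trans (fore _ _ (mF n) mv) _; rewrite leeD2l// lee_wpmul2l.
  have H2 : sqnorm (f n) = (c^-1)%:E * sqnorm (fourier_integral (f n)).
    rewrite sqnorm_fourier_integral; [|by case: (fL n)|by case: (fL n)].
    by rewrite muleA -EFinM mulVf ?mul1e// gt_eqF.
  rewrite H2; have ci : (0 < c^-1)%R by rewrite invr_gt0.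
  apply: (@le_trans _ _ (2%:E * (c^-1%:E * (2%:E * sqnorm v + 2%:E * e%:E)) + 2%:E * e%:E)).
    by rewrite leeD// lee_wpmul2l// lee_wpmul2l// lee_fin ltW.
  move: (sqnorm_lty (conj mv v2)) (sqnorm_ge0 v); case: (sqnorm v) => // r _ _.
  by rewrite -!(EFinM, EFinD) lee_fin; nra.
Qed.

(** The two sequences that approximate [u] may differ, but [f N - g N] is small in L^2, and by
    Plancherel so is the difference of the transforms. *)
Lemma is_fourier_unique u v v' : is_fourier u v -> is_fourier u v' -> sqnorm (v \- v')%R = 0.
Proof.
move=> [[mu_ u2] [mv v2] [f [fL fu fv]]] [_ [mv' v2'] [g [gL gu gv]]].
apply/eqP; rewrite eq_le sqnorm_ge0 andbT.
apply: (@lee_of_forall_eps _ _ (8 + 16 * c)%R).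
  by rewrite addr_ge0// mulr_ge0// ltW.
move=> e e0; rewrite add0e.
have [N _ H] := filterI (filterI (Lpnorm2_cvg0 e0 fu) (Lpnorm2_cvg0 e0 fv))
  (filterI (Lpnorm2_cvg0 e0 gu) (Lpnorm2_cvg0 e0 gv)).
have [[Hfu Hfv] [Hgu Hgv]] := H N (leqnn N).
have [f1 f2] := fL N; have [g1 g2] := gL N.
have [mf _] := f1; have [mg _] := g1.
have mFf := cmeasurable_fourier_integral mf; have mFg := cmeasurable_fourier_integral mg.
have dfg : sqnorm (f N \- g N)%R <= (4 * e)%:E.
  rewrite (_ : (f N \- g N = (f N \- u) \- (g N \- u))%R); last first.
    by apply/funext => x /=; rewrite opprB addrA subrK.
  apply: le_trans (sqnormB_le (cmeasurableB mf mu_) (cmeasurableB mg mu_)) _.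
  rewrite (_ : (4 * e)%:E = 2%:E * e%:E + 2%:E * e%:E).
    by rewrite leeD// lee_wpmul2l.
  by rewrite -!EFinM -EFinD; congr EFin; ring.
have mfg : cmeasurable (f N \- g N)%R by exact: cmeasurableB.
have fg2 : in_Lp 2 (f N \- g N)%R.
  by apply: in_L2P => //; rewrite (le_lt_trans dfg)// ltry.
have dF : sqnorm (fourier_integral (f N) \- fourier_integral (g N))%R <= (c * (4 * e))%:E.
  rewrite -fourier_integralB//.
  have [[fr fi] [gr gi]] := (in_L1_integrable f1, in_L1_integrable g1).
  rewrite /sqnorm; under eq_integral do rewrite fourier_integralE /=.
  rewrite plancherel_phase13.
  - by rewrite [leRHS]EFinM lee_wpmul2l ?lee_fin// ltW.
  - have := integrableB measurableT fr gr; apply: eq_integrable => // x _ /=.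
    by rewrite raddfB.
  - have := integrableB measurableT fi gi; apply: eq_integrable => // x _ /=.
    by rewrite raddfB.
  - exact: sqnorm_lty.
(* [D - (A - B)] telescopes to [v - v'], and each of the three pieces is already known to be
   small. *)
pose A := (fourier_integral (f N) \- v)%R; pose B := (fourier_integral (g N) \- v')%R.
pose D := (fourier_integral (f N) \- fourier_integral (g N))%R.
have -> : (v \- v' = D \- (A \- B))%R.
  by apply/funext => x; rewrite /A /B /D /=; ring.
have mA : cmeasurable A by exact: cmeasurableB.
have mB : cmeasurable B by exact: cmeasurableB.
apply: le_trans (sqnormB_le (cmeasurableB mFf mFg) (cmeasurableB mA mB)) _.
have AB := sqnormB_le mA mB.
apply: (@le_trans _ _ (2%:E * (c * (4 * e))%:E + 2%:E * (2%:E * e%:E + 2%:E * e%:E))).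
  rewrite leeD// lee_wpmul2l//; apply: le_trans AB _.
  by rewrite leeD// lee_wpmul2l.
rewrite -!(EFinM, EFinD) lee_fin.
have : (0 <= c * e)%R by rewrite mulr_ge0// ltW.
nra.
Qed.

Lemma cmeasurable0 : cmeasurable (cst 0%R : R13 R -> R[i]).
Proof. by split; exact: measurable_cst. Qed.

Lemma sqnorm0 : sqnorm (cst 0%R : R13 R -> R[i]) = 0.
Proof.
by rewrite /sqnorm; under eq_integral do rewrite /= expr0n addr0; rewrite integral0.
Qed.

(** The second alternative is the default value of [xget]; the norm bounds below are trivial for
    it. *)
Lemma fourierP u : is_fourier u (fourier u) \/ fourier u = cst 0%R.
Proof. by rewrite /fourier; case: xgetP => [v -> fv|_]; [left|right]. Qed.

Lemma inv_fourierP v : is_fourier (inv_fourier v) v \/ inv_fourier v = cst 0%R.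
Proof. by rewrite /inv_fourier; case: xgetP => [u -> fu|_]; [left|right]. Qed.

Lemma cmeasurable_fourier u : cmeasurable (fourier u).
Proof. by case: (fourierP u) => [[_ [mf _] _]|->]; [exact: mf|exact: cmeasurable0]. Qed.

Lemma sqnorm_fourier_le u : sqnorm (fourier u) <= (4 * c)%:E * sqnorm u.
Proof.
case: (fourierP u) => [/is_fourier_le[]//|->]; rewrite sqnorm0 mule_ge0 ?sqnorm_ge0//.
by rewrite lee_fin mulr_ge0// ltW.
Qed.

Lemma sqnorm_inv_fourier_le v : sqnorm (inv_fourier v) <= (4 / c)%:E * sqnorm v.
Proof.
case: (inv_fourierP v) => [/is_fourier_le[]//|->]; rewrite sqnorm0 mule_ge0 ?sqnorm_ge0//.
by rewrite lee_fin divr_ge0// ltW.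
Qed.

Lemma sqnorm_eq0 f : cmeasurable f -> sqnorm f = 0 -> {ae mu, forall x, f x = 0%R}.
Proof.
move=> mf f0; have mf2 := measurable_sqnorm mf.
have := (ae_eq_integral_abs mu measurableT mf2).1.
rewrite -{1}f0 => H; have {H} : ae_eq mu setT
    (fun x => ((Re (f x)) ^+ 2 + (Im (f x)) ^+ 2)%:E) (cst 0).
  by apply: H; apply: eq_integral => x _; rewrite gee0_abs// lee_fin addr_ge0 ?sqr_ge0.
apply: filterS => x /(_ I) /= [] /eqP.
rewrite paddr_eq0 ?sqr_ge0// !sqrf_eq0 => /andP[/eqP fr /eqP fi].
by case: (f x) fr fi => a b /= -> ->.
Qed.

Lemma ae_eq_sqnorm f g : cmeasurable f -> cmeasurable g ->
  {ae mu, forall x, f x = g x} -> sqnorm f = sqnorm g.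
Proof.
move=> mf mg fg; apply: ge0_ae_eq_integral => //.
- exact: measurable_sqnorm.
- exact: measurable_sqnorm.
- by move=> x _; rewrite lee_fin addr_ge0 ?sqr_ge0.
- by move=> x _; rewrite lee_fin addr_ge0 ?sqr_ge0.
by apply: filterS fg => x -> _.
Qed.

(* If the inverse transform defining the multiplier does not exist, then the
   default value makes its Fourier transform vanish. *)
Lemma fourier_multiplier (A : set (R13 R)) u :
  {ae mu, forall X, fourier (multiplier A u) X = ((\1_A X)%:C%C * fourier u X)%R} \/
  {ae mu, forall X, fourier (multiplier A u) X = 0%R}.
Proof.
pose w X := ((\1_A X)%:C%C * fourier u X)%R.
rewrite -[multiplier A u]/(inv_fourier w).
case: (inv_fourierP w) => [Fw|w0].
- have [FF|F0] := fourierP (inv_fourier w).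
    have mw : cmeasurable w by case: Fw => _ [].
    left; have := sqnorm_eq0 (cmeasurableB (cmeasurable_fourier _) mw)
      (is_fourier_unique FF Fw).
    by apply: filterS => x /= /eqP; rewrite subr_eq0 => /eqP.
  by right; rewrite F0; exact: aeW.
- right; rewrite w0; apply: sqnorm_eq0; first exact: cmeasurable_fourier.
  apply/eqP; rewrite eq_le sqnorm_ge0 andbT.
  by rewrite (le_trans (sqnorm_fourier_le _))// sqnorm0 mule0.
Qed.

Lemma sqnorm_fourier_multiplier_le (A : set (R13 R)) u :
  sqnorm (fourier (multiplier A u)) <= (4 * c)%:E * sqnorm u.
Proof.
have mF := cmeasurable_fourier u; have mM := cmeasurable_fourier (multiplier A u).
case: (fourier_multiplier A u) => H; last first.
  rewrite (ae_eq_sqnorm mM cmeasurable0 H) sqnorm0 mule_ge0 ?sqnorm_ge0//.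
  by rewrite lee_fin mulr_ge0// ltW.
apply: le_trans (sqnorm_fourier_le u); apply: ae_ge0_le_integral => //.
- by move=> x _; rewrite lee_fin addr_ge0 ?sqr_ge0.
- exact: measurable_sqnorm.
- by move=> x _; rewrite lee_fin addr_ge0 ?sqr_ge0.
- exact: measurable_sqnorm.
apply: filterS H => x -> _; rewrite lee_fin indicE; case: (_ \in A).
  by rewrite mul1r.
by rewrite mul0r /= expr0n addr0 addr_ge0 ?sqr_ge0.
Qed.

End fourier_L2.

(** * Integration along rays *)

Section ray_estimate.
Variable R : realType.
Local Notation mu := (@lebesgue_measure R).
Local Notation TR := (measurableTypeR R).

Lemma cos_sqr_ge_half (t : R) : 0 <= t <= pi / 4 -> 2^-1 <= cos t ^+ 2.
Proof.
move=> /andP[t0 t4]; have p0 := pi_gt0 R.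
have : 0 <= cos (t *+ 2).
  by apply: cos_ge0_pihalf; rewrite (mulr2n t); apply/andP; split; lra.
rewrite cos_mulr2n; lra.
Qed.

(** By the mean value theorem sin t = t cos c for some c between 0 and pi/4, where cos^2 is at least
    1/2. *)
Lemma sin_sqr_ge (t : R) : 0 <= t <= pi / 4 -> t ^+ 2 / 2 <= sin t ^+ 2.
Proof.
move=> /andP[]; rewrite le_eqVlt => /predU1P[<- _|t0 t4].
  by rewrite sin0 expr0n mul0r.
have [|c ct] := @MVT R sin cos 0 t t0 (fun x _ => is_derive_sin x).
  by apply: continuous_subspaceT; exact: continuous_sin.
rewrite sin0 !subr0 => ->; move: ct; rewrite in_itv/= => /andP[c0 ct].
have : 2^-1 <= cos c ^+ 2.
  by apply: cos_sqr_ge_half; rewrite (ltW c0)/= (le_trans (ltW ct)).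
by move=> h; rewrite exprMn mulrC ler_wpM2r ?sqr_ge0.
Qed.

(** Two duplications give 1 - cos t = 8 sin^2(t/4) cos^2(t/4). The quarter angle stays in [0, pi/4]
    for every t up to pi, so the two previous bounds make the right-hand side at least t^2/8. *)
Lemma acos_sqr_le (x : R) : -1 <= x <= 1 -> acos x ^+ 2 <= 8 * (1 - x).
Proof.
move=> x1; have t0 := acos_ge0 x1; have tpi := acos_lepi x1.
have xE : cos (acos x) = x by rewrite acosK// in_itv.
set t := acos x in t0 tpi xE *.
have t4 : 0 <= t / 4 <= pi / 4 by lra.
have c4 := cos_sqr_ge_half t4; have s4 := sin_sqr_ge t4.
have -> : 1 - x = 8 * (sin (t / 4) ^+ 2 * cos (t / 4) ^+ 2).
  have tE : t = ((t / 4) *+ 2) *+ 2 by rewrite -mulrnA -mulr_natr; field.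
  have sE : sin (t / 4) ^+ 2 = 1 - cos (t / 4) ^+ 2.
    by have := cos2Dsin2 (t / 4); lra.
  by rewrite sE -xE {1}tE !cos_mulr2n; ring.
have := ler_pM _ _ s4 c4; rewrite divr_ge0 ?sqr_ge0// invr_ge0 => /(_ isT (ler0n _ _)).
rewrite exprMn; set a := sin _ ^+ 2 * _; move: (t ^+ 2) => t2; lra.
Qed.

Section regularised.
Variables (b d m M : R) (s1 s2 : bool).
Hypotheses (d0 : 0 <= d) (M0 : 0 < M).

(** For [e = d] the root is, up to the length of the direction vector, the distance from the point
    of parameter [z] to a fixed point whose foot on the line has parameter [b]. A positive [e]
    smooths the corner that occurs when [d = 0]. *)
Definition ray_phase (e z : R) : R :=
  sgn R s1 * z + sgn R s2 * Num.sqrt ((z - b) ^+ 2 + e).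

(** [sgn R s1] times the derivative of [ray_phase]. On an actual ray this is 1 - cos theta12, by
    [ray_angleE]. *)
Definition ray_speed (e z : R) : R :=
  1 - sgn R s1 * sgn R s2 * (b - z) / Num.sqrt ((z - b) ^+ 2 + e).

(** A majorant of the indicator of |x - m| <= M whose primitive 2M atan((x - m)/M) is bounded. *)
Definition bump (x : R) : R := 2 / (1 + ((x - m) / M) ^+ 2).

Lemma bump_ge0 x : 0 <= bump x.
Proof. by rewrite divr_ge0// addr_ge0 ?sqr_ge0. Qed.

Lemma bump_le2 x : bump x <= 2.
Proof. by rewrite ler_pdivrMr ?ltr_pwDl ?sqr_ge0// ler_peMr// lerDl sqr_ge0. Qed.

Lemma bump_ge1 x : `|x - m| <= M -> 1 <= bump x.
Proof.
move=> xm; rewrite ler_pdivlMr ?ltr_pwDl ?sqr_ge0// mul1r.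
have : ((x - m) / M) ^+ 2 <= 1.
  rewrite -real_normK ?num_real// expr_le1//.
  by rewrite normrM normfV (gtr0_norm M0) ler_pdivrMr// mul1r.
lra.
Qed.

Lemma continuous_bump : continuous bump.
Proof.
move=> x; apply: cvgM; first exact: cvg_cst.
apply: cvgV; first by rewrite gt_eqF// ltr_pwDl ?sqr_ge0.
apply: cvgD; first exact: cvg_cst.
apply: (@continuous_comp _ _ _ (fun x : R => (x - m) / M) (fun x => x ^+ 2)).
  by apply: cvgM; [apply: cvgB; [exact: cvg_id|exact: cvg_cst]|exact: cvg_cst].
exact: exprn_continuous.
Qed.

Lemma sgn_sqr s : sgn R s * sgn R s = 1.
Proof. by case: s; rewrite /sgn ?mulr1// mulrNN mulr1. Qed.

Lemma norm_sgn s : `|sgn R s| = 1.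
Proof. by case: s; rewrite /sgn ?normrN normr1. Qed.

Lemma ray_ratio_le1 e z : 0 <= e ->
  `|sgn R s1 * sgn R s2 * (b - z) / Num.sqrt ((z - b) ^+ 2 + e)| <= 1.
Proof.
move=> e0; rewrite !normrM !norm_sgn !mul1r normfV [`|Num.sqrt _|]ger0_norm ?sqrtr_ge0//.
have h : `|b - z| <= Num.sqrt ((z - b) ^+ 2 + e).
  by rewrite distrC -sqrtr_sqr ler_wsqrtr// lerDl.
have [->|n0] := eqVneq (Num.sqrt ((z - b) ^+ 2 + e)) 0; first by rewrite invr0 mulr0.
by rewrite ler_pdivrMr ?mul1r// lt_neqAle eq_sym n0 sqrtr_ge0.
Qed.

Lemma ray_speed_ge0 e z : 0 <= e -> 0 <= ray_speed e z.
Proof. by move=> /(ray_ratio_le1 z); rewrite ler_norml subr_ge0 => /andP[]. Qed.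

Lemma ray_speed_le2 e z : 0 <= e -> ray_speed e z <= 2.
Proof. by move=> /(ray_ratio_le1 z); rewrite ler_norml /ray_speed => /andP[]; lra. Qed.

Let q0 e z : 0 < e -> 0 < (z - b) ^+ 2 + e.
Proof. by move=> e0; rewrite ltr_wpDl// sqr_ge0. Qed.

Lemma continuous_ray_phase e : continuous (ray_phase e).
Proof.
move=> x; apply: cvgD; first by apply: cvgM; [exact: cvg_cst|exact: cvg_id].
apply: cvgM; first exact: cvg_cst.
apply: (@continuous_comp _ _ _ (fun z : R => (z - b) ^+ 2 + e) Num.sqrt).
  apply: cvgD; last exact: cvg_cst.
  apply: (@continuous_comp _ _ _ (fun z : R => z - b) (fun x => x ^+ 2)).
    by apply: cvgB; [exact: cvg_id|exact: cvg_cst].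
  exact: exprn_continuous.
exact: sqrt_continuous.
Qed.

Lemma continuous_ray_speed e : 0 < e -> continuous (ray_speed e).
Proof.
move=> e0 x; apply: cvgB; first exact: cvg_cst.
apply: cvgM; first by apply: cvgM; [exact: cvg_cst|apply: cvgB; [exact: cvg_cst|exact: cvg_id]].
apply: cvgV; first by rewrite gt_eqF// sqrtr_gt0 q0.
apply: (@continuous_comp _ _ _ (fun z : R => (z - b) ^+ 2 + e) Num.sqrt).
  apply: cvgD; last exact: cvg_cst.
  apply: (@continuous_comp _ _ _ (fun z : R => z - b) (fun x => x ^+ 2)).
    by apply: cvgB; [exact: cvg_id|exact: cvg_cst].
  exact: exprn_continuous.
exact: sqrt_continuous.
Qed.

(** A primitive of speed times bump: the sign in front turns the derivative of the phase into
    [ray_speed], since it squares to 1. *)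
Let F e (z : R) : R := sgn R s1 * (2 * M * atan ((ray_phase e z - m) / M)).

Let dF e (z : R) : 0 < e ->
  is_derive z (1:R) (F e) (ray_speed e z * bump (ray_phase e z)).
Proof.
move=> e0; have q := q0 z e0.
have dq : is_derive z (1:R) (fun z => (z - b) ^+ 2 + e) (2 * (z - b)).
  by apply: is_derive_eq; rewrite /GRing.scale /=; ring.
have ds : is_derive z (1:R) (fun z => Num.sqrt ((z - b) ^+ 2 + e))
    ((z - b) / Num.sqrt ((z - b) ^+ 2 + e)).
  have := is_derive1_sqrt q => dsq.
  apply: (is_derive_eq (@is_derive1_comp R Num.sqrt (fun z => (z - b) ^+ 2 + e) z _ _ dsq dq)).
  by field; rewrite gt_eqF// sqrtr_gt0.
have dp : is_derive z (1:R) (fun z => (ray_phase e z - m) / M)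
    ((sgn R s1 + sgn R s2 * ((z - b) / Num.sqrt ((z - b) ^+ 2 + e))) / M).
  rewrite /ray_phase; apply: is_derive_eq; rewrite /GRing.scale /=; field.
  by rewrite !gt_eqF// sqrtr_gt0.
have da : is_derive z (1:R) (fun z => atan ((ray_phase e z - m) / M)) _ :=
  @is_derive1_comp R atan (fun z => (ray_phase e z - m) / M) z _ _ (is_derive1_atan _) dp.
rewrite /F; apply: is_derive_eq; rewrite /GRing.scale /=.
rewrite /ray_speed /bump.
have n1 : 1 + ((ray_phase e z - m) / M) ^+ 2 != 0.
  by rewrite gt_eqF// ltr_pwDl ?sqr_ge0.
have n2 : Num.sqrt ((z - b) ^+ 2 + e) != 0 by rewrite gt_eqF// sqrtr_gt0.
have ss := sgn_sqr s1.
move: ss n1 n2; set a := sgn R s1; set a' := sgn R s2; set Q := Num.sqrt _.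
set P := (ray_phase e z - m) / M => ss n1 n2.
have -> : 1 - a * a' * (b - z) / Q = a * a - a * a' * (b - z) / Q by rewrite ss.
by field; rewrite n1 n2 gt_eqF.
Qed.

(** The bound is uniform in [e] and [N] because two values of the arctangent differ by at most
    pi. *)
Lemma integral_regularised_ray e N : 0 < e -> 0 < N ->
  (\int[mu]_(z in `[0%R, N]) (ray_speed e z * bump (ray_phase e z))%:E
    <= (2 * M * pi)%:E)%E.
Proof.
move=> e0 N0.
have cf : continuous (fun z => ray_speed e z * bump (ray_phase e z)).
  move=> x; apply: cvgM; first exact: continuous_ray_speed.
  by apply: (@continuous_comp _ _ _ (ray_phase e) bump);
    [exact: continuous_ray_phase|exact: continuous_bump].
have cF x : F e z @[z --> x] --> F e x.
  by apply: differentiable_continuous; apply/derivable1_diffP; exact: (@ex_derive _ _ _ _ _ _ _ (dF x e0)).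
rewrite (@continuous_FTC2 R _ (F e) 0 N)//.
- rewrite -EFinB lee_fin /F.
  set A := atan _; set B := atan _.
  have hA1 : - (pi / 2) < A := atan_gtNpi2 _; have hA2 : A < pi / 2 := atan_ltpi2 _.
  have hB1 : - (pi / 2) < B := atan_gtNpi2 _; have hB2 : B < pi / 2 := atan_ltpi2 _.
  have H : `|A - B| <= pi by rewrite ler_norml; apply/andP; split; lra.
  rewrite -mulrBr -mulrBr; apply: le_trans (ler_norm _) _.
  by rewrite normrM norm_sgn mul1r normrM gtr0_norm ?mulr_gt0// ler_pM2l// mulr_gt0.
- exact: continuous_subspaceT.
- split; [|exact/cvg_at_right_filter/cF|exact/cvg_at_left_filter/cF].
  by move=> x _; exact: (@ex_derive _ _ _ _ _ _ _ (dF x e0)).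
- by move=> x _; rewrite derive1E; exact: (@derive_val _ _ _ _ _ _ _ (dF x e0)).
Qed.

Let ed n : 0 < d + n.+1%:R^-1.
Proof. by rewrite ltr_wpDl// invr_gt0. Qed.

Let ecvg : d + n.+1%:R^-1 @[n --> \oo] --> d.
Proof.
rewrite -[X in _ --> X]addr0; apply: cvgD; first exact: cvg_cst.
exact: cvg_harmonic.
Qed.

Let sqrt_cvg z : Num.sqrt ((z - b) ^+ 2 + (d + n.+1%:R^-1)) @[n --> \oo]
  --> Num.sqrt ((z - b) ^+ 2 + d).
Proof.
have h : (z - b) ^+ 2 + (d + n.+1%:R^-1) @[n --> \oo] --> (z - b) ^+ 2 + d.
  by apply: cvgD; [exact: cvg_cst|exact: ecvg].
exact: (cvg_comp _ _ h (@sqrt_continuous _ _)).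
Qed.

Lemma ray_phase_cvg z : ray_phase (d + n.+1%:R^-1) z @[n --> \oo] --> ray_phase d z.
Proof.
apply: cvgD; first exact: cvg_cst.
by apply: cvgM; [exact: cvg_cst|exact: sqrt_cvg].
Qed.

Lemma ray_speed_cvg z : ray_speed (d + n.+1%:R^-1) z @[n --> \oo] --> ray_speed d z.
Proof.
(* If the limiting root vanishes then z = b, and the numerator is 0 in every term as well as in the
   limit; so the value of the division by 0 is consistent. *)
have [S0|S0] := eqVneq (Num.sqrt ((z - b) ^+ 2 + d)) 0.
  have zb : b - z = 0.
    have : (z - b) ^+ 2 + d = 0.
      apply/eqP; rewrite eq_le -sqrtr_eq0 S0 eqxx /=.
      by rewrite addr_ge0 ?sqr_ge0.
    move=> /eqP; rewrite paddr_eq0 ?sqr_ge0// => /andP[]; rewrite sqrf_eq0.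
    by move=> /eqP h _; rewrite -opprB h oppr0.
  rewrite /ray_speed zb; under eq_fun do rewrite mulr0 mul0r subr0.
  by rewrite mulr0 mul0r subr0; exact: cvg_cst.
apply: cvgB; first exact: cvg_cst.
by apply: cvgM; [exact: cvg_cst|apply: cvgV => //; exact: sqrt_cvg].
Qed.

Lemma measurable_ray_integrand n : measurable_fun [set: TR]
  (fun z : TR => (ray_speed (d + n.+1%:R^-1) z * bump (ray_phase (d + n.+1%:R^-1) z))%:E).
Proof.
apply/measurable_EFinP; apply: continuous_measurable_fun => x.
apply: cvgM; first exact: continuous_ray_speed.
by apply: (@continuous_comp _ _ _ (ray_phase _) bump);
  [exact: continuous_ray_phase|exact: continuous_bump].
Qed.

Lemma ray_integrand_cvg z :
  (ray_speed (d + n.+1%:R^-1) z * bump (ray_phase (d + n.+1%:R^-1) z))%:E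
  @[n --> \oo] --> (ray_speed d z * bump (ray_phase d z))%:E.
Proof.
apply: cvg_EFin; first exact: nearW.
apply: cvgM; first exact: ray_speed_cvg.
exact: (cvg_comp _ _ (@ray_phase_cvg z) (@continuous_bump _)).
Qed.

Lemma measurable_ray_integrand0 : measurable_fun [set: TR]
  (fun z : TR => (ray_speed d z * bump (ray_phase d z))%:E).
Proof.
apply: (emeasurable_fun_cvg (fun n (z : TR) => (ray_speed (d + n.+1%:R^-1) z *
  bump (ray_phase (d + n.+1%:R^-1) z))%:E)).
  by move=> n; exact: measurable_ray_integrand.
by move=> z _; exact: ray_integrand_cvg.
Qed.

(** The regularised bounds pass to the limit: speed and bump are each at most 2, so the constant 4
    is an integrable majorant on the bounded interval. *)
Lemma integral_ray N : 0 < N ->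
  (\int[mu]_(z in `[0%R, N]) (ray_speed d z * bump (ray_phase d z))%:E
    <= (2 * M * pi)%:E)%E.
Proof.
move=> N0; pose D : set TR := `[0%R, N]%classic.
have mD : measurable D by exact: measurable_itv.
have Dfin : (mu D < +oo)%E.
  by rewrite lebesgue_measure_itv/=; case: ifPn => _; rewrite ?ltry// -EFinB ltry.
pose g4 : TR -> \bar R := EFin \o (fun=> 4 : R).
have i4 : mu.-integrable D g4.
  by apply: measurable_bounded_integrable => //; exact: bounded_cst.
pose f n (z : TR) : \bar R := (ray_speed (d + n.+1%:R^-1) z *
  bump (ray_phase (d + n.+1%:R^-1) z))%:E.
have mf n : measurable_fun D (f n).
  by apply: measurable_funTS; exact: measurable_ray_integrand.
have mf0 : measurable_fun D (fun z => (ray_speed d z * bump (ray_phase d z))%:E).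
  by apply: measurable_funTS; exact: measurable_ray_integrand0.
have cf : {ae mu, forall z, D z -> f ^~ z @ \oo --> (ray_speed d z * bump (ray_phase d z))%:E}.
  by apply: aeW => z _; exact: ray_integrand_cvg.
have df : {ae mu, forall z n, D z -> (`|f n z| <= g4 z)%E}.
  apply: aeW => z n _; rewrite /f /g4 /= lee_fin.
  have s0 := ray_speed_ge0 z (ltW (ed n)); have s2' := ray_speed_le2 z (ltW (ed n)).
  have b0 := bump_ge0 (ray_phase (d + n.+1%:R^-1) z); have b2 := bump_le2 (ray_phase (d + n.+1%:R^-1) z).
  rewrite ger0_norm; last exact: mulr_ge0.
  by rewrite (_ : 4 = 2 * 2); [exact: ler_pM|ring].
have [_ _ lim] := dominated_convergence mD mf mf0 cf i4 df.
rewrite -(cvg_lim _ lim)//; apply: lime_le; first by apply/cvg_ex; eexists; exact: lim.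
by apply: nearW => n; exact: integral_regularised_ray.
Qed.

End regularised.
End ray_estimate.

(** * Rays, angles and tubes in R^3 *)

Section geometry.
Variable R : realType.
Implicit Types (a b w : R3 R).

Lemma dot3_ge0 a : 0 <= dot3 a a.
Proof. by rewrite /dot3 -!expr2 !addr_ge0 ?sqr_ge0. Qed.

Lemma norm3_ge0 a : 0 <= norm3 a. Proof. exact: sqrtr_ge0. Qed.

Lemma norm3_sqr a : norm3 a ^+ 2 = dot3 a a.
Proof. by rewrite sqr_sqrtr// dot3_ge0. Qed.

Lemma norm3_scale s a : norm3 (scale3 s a) = `|s| * norm3 a.
Proof.
rewrite /norm3 -sqrtr_sqr -sqrtrM ?sqr_ge0//; congr Num.sqrt.
by rewrite /dot3 /scale3 /=; ring.
Qed.

(** Lagrange's identity: the difference of the two sides is the squared length of the cross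
    product. *)
Lemma dot3_sqr_le a b : dot3 a b ^+ 2 <= dot3 a a * dot3 b b.
Proof.
rewrite -subr_ge0 (_ : _ - _ = (a.1.1 * b.1.2 - a.1.2 * b.1.1) ^+ 2 +
  (a.1.1 * b.2 - a.2 * b.1.1) ^+ 2 + (a.1.2 * b.2 - a.2 * b.1.2) ^+ 2).
  by rewrite !addr_ge0 ?sqr_ge0.
by rewrite /dot3; ring.
Qed.

Lemma norm_dot3_le a b : `|dot3 a b| <= norm3 a * norm3 b.
Proof.
rewrite -(ger0_norm (mulr_ge0 (norm3_ge0 a) (norm3_ge0 b))).
by rewrite -ler_sqr ?nnegrE// !real_normK ?num_real// exprMn !norm3_sqr dot3_sqr_le.
Qed.

Lemma cos_angle_bound a b : -1 <= dot3 a b / (norm3 a * norm3 b) <= 1.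
Proof.
rewrite -ler_norml normrM normfV [X in _ / X]ger0_norm ?mulr_ge0 ?norm3_ge0//.
have [->|n0] := eqVneq (norm3 a * norm3 b) 0; first by rewrite invr0 mulr0.
by rewrite ler_pdivrMr ?mul1r ?norm_dot3_le// lt_neqAle eq_sym n0 mulr_ge0// norm3_ge0.
Qed.

Lemma angle_sqr_le a b :
  angle a b ^+ 2 <= 8 * (1 - dot3 a b / (norm3 a * norm3 b)).
Proof. exact: acos_sqr_le (cos_angle_bound a b). Qed.

Section ray.
Variables (w xi0 : R3 R).
Hypothesis w0 : 0 < norm3 w.

(** The parameter of the foot of the perpendicular from [xi0] to the line of [w]; [ray_offset] is
    the squared distance from [xi0] to that line in units of the length of [w], which on a cube face
    is not 1. *)
Definition ray_center : R := dot3 xi0 w / norm3 w ^+ 2.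
Definition ray_offset : R := dot3 xi0 xi0 / norm3 w ^+ 2 - ray_center ^+ 2.

Lemma ray_offset_ge0 : 0 <= ray_offset.
Proof.
rewrite /ray_offset /ray_center subr_ge0 expr_div_n ler_pdivrMr ?exprn_gt0//.
rewrite [X in _ <= _ / _ * X]expr2 mulrA divfK ?gt_eqF ?exprn_gt0//.
by rewrite norm3_sqr dot3_sqr_le.
Qed.

Lemma norm3_ray z : norm3 (xi0 - scale3 z w) =
  norm3 w * Num.sqrt ((z - ray_center) ^+ 2 + ray_offset).
Proof.
rewrite -{1}(ger0_norm (norm3_ge0 w)) -sqrtr_sqr -sqrtrM ?sqr_ge0//.
congr Num.sqrt; rewrite /ray_offset /ray_center.
rewrite [RHS](_ : _ = z ^+ 2 * norm3 w ^+ 2 - 2 * z * dot3 xi0 w + dot3 xi0 xi0).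
  rewrite norm3_sqr /dot3 /scale3 /=; ring.
by field; rewrite gt_eqF.
Qed.

Lemma ray_phaseE s1 s2 z : 0 < z ->
  sgn R s1 * norm3 (scale3 z w) + sgn R s2 * norm3 (xi0 - scale3 z w) =
  norm3 w * ray_phase ray_center s1 s2 ray_offset z.
Proof. by move=> z0; rewrite norm3_scale norm3_ray gtr0_norm// /ray_phase; ring. Qed.

(** The scalar product of zw with xi0 - zw is z |w|^2 (b - z), with b the ray center, and the
    positive factor z |w|^2 cancels against the norms. If the ray point is [xi0] itself, both sides
    are 1 because a quotient by 0 is 0. *)
Lemma ray_angleE s1 s2 z : 0 < z ->
  1 - dot3 (scale3 (sgn R s1) (scale3 z w)) (scale3 (sgn R s2) (xi0 - scale3 z w)) /
      (norm3 (scale3 (sgn R s1) (scale3 z w)) *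
       norm3 (scale3 (sgn R s2) (xi0 - scale3 z w))) =
  ray_speed ray_center s1 s2 ray_offset z.
Proof.
move=> z0; rewrite /ray_speed; congr (1 - _).
rewrite !norm3_scale !norm_sgn !mul1r norm3_ray (gtr0_norm z0).
set Q := Num.sqrt _.
have -> : dot3 (scale3 (sgn R s1) (scale3 z w)) (scale3 (sgn R s2) (xi0 - scale3 z w)) =
    sgn R s1 * sgn R s2 * (ray_center - z) * (z * norm3 w ^+ 2).
  rewrite /ray_center mulrBr mulrBl.
  rewrite (_ : sgn R s1 * sgn R s2 * (dot3 xi0 w / norm3 w ^+ 2) * (z * norm3 w ^+ 2) =
    sgn R s1 * sgn R s2 * dot3 xi0 w * z); last by field; rewrite gt_eqF.
  by rewrite norm3_sqr /dot3 /scale3 /=; ring.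
rewrite (_ : z * norm3 w * (norm3 w * Q) = (z * norm3 w ^+ 2) * Q); last by ring.
rewrite invfM mulrA -(mulrA _ (z * norm3 w ^+ 2)) divff ?mulr1//.
by rewrite mulf_neq0// ?expf_neq0// gt_eqF.
Qed.

End ray.

(** The components of the cross product of [xi] and [omega]: a substitute for the distance to the
    axis that is visibly measurable. The bound is 2r and not r because the infimum in [dist3] is
    only approached, with error r. *)
Definition cross_le (r : R) (omega xi : R3 R) : bool :=
  [&& `|xi.1.1 * omega.1.2 - xi.1.2 * omega.1.1| <= 2 * r,
      `|xi.1.1 * omega.2 - xi.2 * omega.1.1| <= 2 * r &
      `|xi.1.2 * omega.2 - xi.2 * omega.1.2| <= 2 * r].

(* Directions of the points of the tube at distance comparable to [N] from the
   origin fill a square of side comparable to [r / N]. *)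
Lemma tube_direction_localised (o1 o2 o3 r N : R) :
  o1 ^+ 2 + o2 ^+ 2 + o3 ^+ 2 = 1 -> 0 < r -> 0 < N ->
  exists a b : R, forall z u v : R, N < 4 * `|z| -> `|u| <= 1 -> `|v| <= 1 ->
    `|z * (u * o3 - o1)| <= 2 * r -> `|z * (v * o3 - o2)| <= 2 * r ->
    `|u - a| <= 64 * r / N /\ `|v - b| <= 64 * r / N.
Proof.
move=> o r0 N0.
have close z t : N < 4 * `|z| -> `|z * t| <= 2 * r -> `|t| <= 8 * r / N.
  move=> Nz; rewrite normrM => zt; rewrite ler_pdivlMr//.
  have := normr_ge0 t; have := normr_ge0 z; nra.
have [c3s|c3b] := ltP `|o3| 4^-1; last first.
  have o30 : o3 != 0 by apply: contraTneq c3b => ->; rewrite normr0 -ltNge.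
  exists (o1 / o3), (o2 / o3) => z u v Nz u1 v1 hu hv.
  have aux t p : `|t * o3 - p| <= 8 * r / N -> `|t - p / o3| <= 64 * r / N.
    move=> h; have {h} : `|t - p / o3| * `|o3| <= 8 * r / N.
      by rewrite -normrM mulrBl divfK.
    have N8 : 0 <= 8 * r / N by rewrite divr_ge0// ?mulr_ge0// ltW.
    rewrite (_ : 64 * r / N = 8 * (8 * r / N)); last by ring.
    have := normr_ge0 (t - p / o3); move: c3b N8; set A := `|o3|; set B := `|_|.
    by set D := _ / N; nra.
  by split; apply: aux; apply: close Nz _.
(* When [o3] is small the square of directions is all of the unit square: were 64 r / N below 1,
   both [o1] and [o2] would be at most 3/8 in modulus, and the three squares could not add up to
   1. *)
exists 0, 0 => z u v Nz u1 v1 hu hv; rewrite !subr0.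
have hu' := close _ _ Nz hu; have hv' := close _ _ Nz hv.
suff : 1 <= 64 * r / N by move=> h; split; exact: le_trans h.
set D := 8 * r / N in hu' hv'.
rewrite (_ : 64 * r / N = 8 * D); last by rewrite /D; ring.
have b1 : `|o1| <= 4^-1 + D.
  have h : `|u * o3| <= 4^-1 by rewrite normrM; have := normr_ge0 o3; have := normr_ge0 u; nra.
  have := ler_normB (u * o3) (u * o3 - o1); rewrite opprB addrC subrK; lra.
have b2 : `|o2| <= 4^-1 + D.
  have h : `|v * o3| <= 4^-1 by rewrite normrM; have := normr_ge0 o3; have := normr_ge0 v; nra.
  have := ler_normB (v * o3) (v * o3 - o2); rewrite opprB addrC subrK; lra.
have q1 : `|o1| ^+ 2 = o1 ^+ 2 by rewrite real_normK ?num_real.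
have q2 : `|o2| ^+ 2 = o2 ^+ 2 by rewrite real_normK ?num_real.
have q3 : `|o3| ^+ 2 = o3 ^+ 2 by rewrite real_normK ?num_real.
rewrite leNgt; apply/negP => D8.
have := normr_ge0 o1; have := normr_ge0 o2; have := normr_ge0 o3.
move: b1 b2 c3s o D8; rewrite -q1 -q2 -q3.
by set A := `|o1|; set B := `|o2|; set C := `|o3|; nra.
Qed.

Lemma measurable_acos :
  measurable_fun (`[(-1)%R, 1%R]%classic : set (measurableTypeR R)) (@acos R).
Proof.
apply: (@measurable_fun_itv_cc R (-1) 1 false true).
apply: open_continuous_measurable_fun; first exact: interval_open.
by move=> x; rewrite inE/= in_itv/= => x1; exact: continuous_acos.
Qed.

Section measurable_vectors.
Context d (T : measurableType d).
Implicit Types (f g : T -> R3 R).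

Lemma measurable_R3P f : measurable_fun setT f <->
  [/\ measurable_fun setT (fun x => (f x).1.1 : R),
      measurable_fun setT (fun x => (f x).1.2 : R) &
      measurable_fun setT (fun x => (f x).2 : R)].
Proof.
split=> [mf|[f1 f2 f3]].
  split; [exact: (measurableT_comp measurable_fst (measurableT_comp measurable_fst mf))
    |exact: (measurableT_comp measurable_snd (measurableT_comp measurable_fst mf))
    |exact: (measurableT_comp measurable_snd mf)].
apply/measurable_fun_pairP; split; last exact: f3.
by apply/measurable_fun_pairP; split; [exact: f1|exact: f2].
Qed.

Lemma measurable_dot3 f g : measurable_fun setT f -> measurable_fun setT g ->
  measurable_fun setT (fun x => dot3 (f x) (g x)).
Proof.
move=> /measurable_R3P[f1 f2 f3] /measurable_R3P[g1 g2 g3].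
by apply: measurable_funD; first apply: measurable_funD; exact: measurable_funM.
Qed.

Lemma measurable_norm3 f : measurable_fun setT f ->
  measurable_fun setT (fun x => norm3 (f x)).
Proof.
by move=> mf; apply: (measurableT_comp (@measurable_sqrt R)); exact: measurable_dot3.
Qed.

Lemma measurable_scale3 (h : T -> R) f : measurable_fun setT h ->
  measurable_fun setT f -> measurable_fun setT (fun x => scale3 (h x) (f x)).
Proof.
move=> mh /measurable_R3P[f1 f2 f3]; apply/measurable_R3P; split=> /=;
  exact: measurable_funM.
Qed.

Lemma measurable_sub3 f g : measurable_fun setT f -> measurable_fun setT g ->
  measurable_fun setT (fun x => f x - g x).
Proof.
move=> /measurable_R3P[f1 f2 f3] /measurable_R3P[g1 g2 g3].
by apply/measurable_R3P; split; exact: measurable_funB.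
Qed.

Lemma measurable_angle f g : measurable_fun setT f -> measurable_fun setT g ->
  measurable_fun setT (fun x => angle (f x) (g x)).
Proof.
move=> mf mg.
apply: (@measurable_comp _ _ _ _ _ _ (`[(-1)%R, 1%R]%classic : set (measurableTypeR R))
  (@acos R) setT (fun x => dot3 (f x) (g x) / (norm3 (f x) * norm3 (g x)))).
- exact: measurable_itv.
- by move=> _ [x _ <-] /=; rewrite in_itv/= cos_angle_bound.
- exact: measurable_acos.
apply: measurable_funM; first exact: measurable_dot3.
rewrite (_ : (fun x => _) = (fun x => (norm3 (f x) * norm3 (g x)) `^ (-1))).
  apply: (measurableT_comp (@measurable_powR R (-1))).
  by apply: measurable_funM; exact: measurable_norm3.
by apply/funext => x; rewrite powR_inv1// mulr_ge0// norm3_ge0.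
Qed.

Lemma measurable_cross_le (r : R) (omega : R3 R) f : measurable_fun setT f ->
  measurable_fun setT (fun x => cross_le r omega (f x)).
Proof.
move=> /measurable_R3P[f1 f2 f3].
have mc (p q : T -> R) (x y : R) : measurable_fun setT p -> measurable_fun setT q ->
    measurable_fun setT (fun t : T => `|p t * x - q t * y| <= 2 * r).
  move=> mp mq; apply: measurable_fun_ler => //; apply: measurableT_comp => //.
  by apply: measurable_funB; exact: measurable_funM.
by apply: measurable_and; [|apply: measurable_and]; exact: mc.
Qed.

End measurable_vectors.

(** What remains of the squared angle once the time frequency is integrated out: [m] will be the
    time component of X0 and [M] the sum [L1 + L2]. *)
Definition shell_weight (omega xi0 : R3 R) (N r m M : R) (s1 s2 : bool) (xi : R3 R) : R :=
  if [&& N / 2 < norm3 xi, norm3 xi <= N, cross_le r omega xi &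
      `|sgn R s1 * norm3 xi + sgn R s2 * norm3 (xi0 - xi) - m| <= M]
  then angle (scale3 (sgn R s1) xi) (scale3 (sgn R s2) (xi0 - xi)) ^+ 2 else 0.

Lemma shell_weight_ge0 omega xi0 N r m M s1 s2 xi :
  0 <= shell_weight omega xi0 N r m M s1 s2 xi.
Proof. by rewrite /shell_weight; case: ifP => // _; exact: sqr_ge0. Qed.

Lemma measurable_shell_weight d (T : measurableType d) (f : T -> R3 R) (m : T -> R)
    omega xi0 N r M s1 s2 : measurable_fun setT f -> measurable_fun setT m ->
  measurable_fun setT (fun x => shell_weight omega xi0 N r (m x) M s1 s2 (f x)).
Proof.
move=> mf mm.
have mn := measurable_norm3 mf.
have mx : measurable_fun setT (fun x => xi0 - f x) by exact: measurable_sub3.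
apply: measurable_fun_ifT => //.
- apply: measurable_and; first exact: measurable_fun_ltr.
  apply: measurable_and; first exact: measurable_fun_ler.
  apply: measurable_and; first exact: measurable_cross_le.
  apply: measurable_fun_ler => //; apply: measurableT_comp => //.
  apply: measurable_funB => //; apply: measurable_funD; apply: measurable_funM => //.
  exact: measurable_norm3.
- by apply: measurable_funX; apply: measurable_angle; exact: measurable_scale3.
Qed.

End geometry.

(** * The kernel bound *)

Section cone_estimate.
Variable R : realType.
Local Notation mu := (@lebesgue_measure R).
Local Notation TR := (measurableTypeR R).
Local Notation mu2 := (@lebesgue2 R).
Local Open Scope ereal_scope.

Section shell.
Variables (omega xi0 : R3 R) (N r m M : R) (s1 s2 : bool).
Hypotheses (N0 : (0 < N)%R) (M0 : (0 < M)%R).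
Local Notation sw := (shell_weight omega xi0 N r m M s1 s2).

(** The factor 8 is that of [angle_sqr_le]; [m] and [M] are divided by [norm3 w] because
    [ray_phaseE] brings out this factor. *)
Definition ray_majorant (w : R3 R) : TR -> \bar R :=
  (fun z : TR => (8 * (ray_speed (ray_center w xi0) s1 s2 (ray_offset w xi0) z *
    bump (m / norm3 w) (M / norm3 w)
      (ray_phase (ray_center w xi0) s1 s2 (ray_offset w xi0) z)))%:E) \_ `[0%R, N].

Section direction.
Variable w : R3 R.
Hypothesis w1 : (1 <= norm3 w)%R.

Let w0 : (0 < norm3 w)%R. Proof. exact: lt_le_trans w1. Qed.

Let Mw0 : (0 < M / norm3 w)%R. Proof. exact: divr_gt0. Qed.

Let sb0 z : (0 <= ray_speed (ray_center w xi0) s1 s2 (ray_offset w xi0) z *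
    bump (m / norm3 w) (M / norm3 w)
      (ray_phase (ray_center w xi0) s1 s2 (ray_offset w xi0) z))%R.
Proof.
apply: mulr_ge0; last exact: bump_ge0.
exact: (ray_speed_ge0 _ _ _ _ (ray_offset_ge0 xi0 w0)).
Qed.

Lemma ray_majorant_ge0 z : 0 <= ray_majorant w z.
Proof.
by rewrite /ray_majorant patchE; case: ifP => // _; rewrite lee_fin mulr_ge0.
Qed.

Lemma measurable_ray_majorant : measurable_fun setT (ray_majorant w).
Proof.
apply/(measurable_restrictT _ _).1 => //; apply: measurable_funTS.
under eq_fun do rewrite EFinM.
apply: measurable_funeM.
exact: (measurable_ray_integrand0 _ _ _ _ _ (ray_offset_ge0 xi0 w0)).
Qed.

Lemma integral_ray_majorant : \int[mu]_z ray_majorant w z <= (16 * pi * M)%:E.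
Proof.
rewrite /ray_majorant -integral_mkcond.
under eq_integral do rewrite EFinM.
rewrite ge0_integralZl_EFin//; last 2 first.
- by move=> z _; rewrite lee_fin.
- apply: measurable_funTS.
  exact: (measurable_ray_integrand0 _ _ _ _ _ (ray_offset_ge0 xi0 w0)).
have H := integral_ray (ray_center w xi0) (m / norm3 w) s1 s2 (ray_offset_ge0 xi0 w0) Mw0 N0.
apply: (le_trans (lee_wpmul2l _ H)) => //.
rewrite -EFinM lee_fin (_ : 8 * (2 * (M / norm3 w) * pi) = 16 * pi * (M / norm3 w))%R; last by ring.
rewrite ler_wpM2l ?mulr_ge0 ?pi_ge0// ler_pdivrMr//.
by rewrite ler_peMr// ltW.
Qed.

Lemma shell_weight_le_majorant z : (0 < z)%R ->
  (sw (scale3 z w))%:E <= ray_majorant w z.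
Proof.
move=> z0; have maj0 := ray_majorant_ge0 z; rewrite /shell_weight.
case: ifP => [/and4P[_ nN _ cond]|_]//.
rewrite /ray_majorant patchE mem_set /=; last first.
  rewrite in_itv/= (ltW z0)/=; apply: le_trans nN.
  by rewrite norm3_scale gtr0_norm// ler_peMr// ltW.
rewrite lee_fin; apply: le_trans (angle_sqr_le _ _) _.
rewrite (ray_angleE xi0 w0)// ler_wpM2l// ler_peMr//.
  exact: (ray_speed_ge0 _ _ _ _ (ray_offset_ge0 xi0 w0)).
apply: (bump_ge1 Mw0).
move: cond; rewrite (ray_phaseE xi0 w0)// => cond.
rewrite ler_pdivlMr// -{2}(gtr0_norm w0) -normrM mulrBl divfK ?gt_eqF//.
by rewrite mulrC.
Qed.

End direction.

Lemma shell_weight0 : sw (scale3 0 xi0) = 0%R.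
Proof.
rewrite /shell_weight norm3_scale normr0 mul0r ifF//.
by apply/negbTE; rewrite negb_and -leNgt divr_ge0// ltW.
Qed.

(** Negative [z] belong to the ray of direction -w, so the line costs twice the bound [16 * pi * M]
    of a ray. As [w] has length at least 1, z^2 is at most N^2 on the shell. *)
Lemma integral_shell_ray (w : R3 R) : (1 <= norm3 w)%R ->
  \int[mu]_z (z ^+ 2 * sw (scale3 z w))%:E <= (N ^+ 2 * (32 * pi * M))%:E.
Proof.
move=> w1; pose w' := scale3 (-1) w.
have w1' : (1 <= norm3 w')%R by rewrite norm3_scale normrN normr1 mul1r.
have mH := measurable_ray_majorant w1; have mH' := measurable_ray_majorant w1'.
have H0 := ray_majorant_ge0 w1; have H0' := ray_majorant_ge0 w1'.
have mHr : measurable_fun [set: TR] (fun z : R => ray_majorant w' (0 - z)%R).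
  apply: (measurableT_comp mH' (g := (fun z : R => (0 - z)%R) : TR -> TR)).
  exact: measurable_funB.
have pt z : (z ^+ 2 * sw (scale3 z w))%:E <=
    (N ^+ 2)%:E * (ray_majorant w z + ray_majorant w' (0 - z)%R).
  have [zN|Nz] := boolP (norm3 (scale3 z w) <= N)%R; last first.
    rewrite /shell_weight (negbTE Nz) /= andbF mulr0.
    by rewrite mule_ge0 ?adde_ge0// lee_fin sqr_ge0.
  have z2 : (z ^+ 2 <= N ^+ 2)%R.
    rewrite -(real_normK (num_real z)) ler_sqr ?nnegrE// ?(ltW N0)//.
    by apply: le_trans zN; rewrite norm3_scale ler_peMr.
  rewrite EFinM; apply: lee_pmul => //; rewrite ?lee_fin ?sqr_ge0 ?shell_weight_ge0//.
  have [z0|z0|->] := ltrgtP z 0%R.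
  - rewrite (_ : scale3 z w = scale3 (0 - z) w').
      by apply: le_trans (shell_weight_le_majorant w1' _) _; [rewrite sub0r oppr_gt0|rewrite leeDr].
    by rewrite /w' /scale3 /= !mulrA !(mulrN1 (0 - z)%R) sub0r opprK.
  - by apply: le_trans (shell_weight_le_majorant w1 z0) _; rewrite leeDl.
  - rewrite (_ : scale3 0 w = scale3 0 xi0); last by rewrite /scale3 !mul0r.
    by rewrite shell_weight0 adde_ge0.
apply: (@le_trans _ _ (\int[mu]_z ((N ^+ 2)%:E * (ray_majorant w z + ray_majorant w' (0 - z)%R)))).
  apply: ge0_le_integral => //.
  - by move=> z _; rewrite lee_fin mulr_ge0 ?sqr_ge0 ?shell_weight_ge0.
  - apply/measurable_EFinP; apply: measurable_funM; first exact: measurable_funX.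
    by apply: measurable_shell_weight => //; exact: measurable_scale3.
  - by apply: measurable_funeM; exact: emeasurable_funD.
have mHH : measurable_fun [set: TR] (fun z : R => ray_majorant w z + ray_majorant w' (0 - z)%R).
  exact: emeasurable_funD.
rewrite (ge0_integralZl_EFin _ measurableT _ mHH) ?sqr_ge0//; last first.
  by move=> z _; rewrite adde_ge0.
rewrite ge0_integralD// (@ge0_integral_reflect R 0)//.
rewrite [leRHS]EFinM lee_wpmul2l ?lee_fin ?sqr_ge0//.
rewrite (_ : (32 * pi * M)%:E = (16 * pi * M)%:E + (16 * pi * M)%:E).
  by rewrite leeD// integral_ray_majorant.
by rewrite -EFinD; congr EFin; ring.
Qed.

End shell.

Lemma ge0_integral2_dilation (z : R) (f : TR * TR -> \bar R) : z != 0%R ->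
  measurable_fun setT f -> (forall q, 0 <= f q) ->
  (z ^+ 2)%:E * \int[mu2]_q f ((z * q.1)%R, (z * q.2)%R) = \int[mu2]_q f q.
Proof.
move=> z0 mf f0.
have ms : measurable_fun [set: TR] (fun x : R => (z * x)%R : TR) by exact: measurable_funM.
have mfz : measurable_fun setT (fun q : TR * TR => f ((z * q.1)%R, (z * q.2)%R)).
  apply: (measurableT_comp mf (g := fun q : TR * TR => ((z * q.1)%R : TR, (z * q.2)%R : TR))).
  apply: measurable_fun_pair; first exact: (measurableT_comp ms measurable_fst).
  exact: (measurableT_comp ms measurable_snd).
rewrite (fubini_tonelli1 f mf f0) (fubini_tonelli1 _ mfz (fun _ => f0 _)) /fubini_F /=.
have mF := measurable_fun_fubini_tonelli_F (m2 := mu) f mf f0.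
have F0 y : 0 <= fubini_F mu f y by apply: integral_ge0.
rewrite -(ge0_integral_affine 0 z0 mF F0) /fubini_F.
rewrite -(real_normK (num_real z)) expr2 EFinM -muleA; congr (_ * _).
rewrite -ge0_integralZl_EFin//; last 2 first.
- by move=> y _; apply: integral_ge0.
- exact: (measurable_fun_fubini_tonelli_F (m2 := mu) _ mfz (fun _ => f0 _)).
apply: eq_integral => y _; rewrite addr0.
rewrite -(@ge0_integral_affine R z 0 (fun x => f ((z * y)%R, x)))//; last first.
  exact: (measurable_fun_pair2 _ mf).
by congr (_ * _); apply: eq_integral => x _; rewrite addr0.
Qed.

(** Polar coordinates over a plane: the point (z, zq) has direction q, the dilation by z has
    Jacobian z^2, and only directions in a square of side 2l contribute. At z = 0 the dilation
    degenerates, which is why [G] is asked to vanish there. *)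
Lemma cone_bound (G : TR * (TR * TR) -> R) (K a b l : R) :
  measurable_fun setT G -> (forall p, 0 <= G p)%R -> (0 <= K)%R -> (0 <= l)%R ->
  (forall q, G (0%R, q) = 0%R) ->
  (forall q : TR * TR, \int[mu]_z (z ^+ 2 * G (z, ((z * q.1)%R, (z * q.2)%R)))%:E <=
    (K * \1_(`[(a - l)%R, (a + l)%R] `*` `[(b - l)%R, (b + l)%R]) q)%:E) ->
  \int[mu]_z \int[mu2]_q (G (z, q))%:E <= (K * (2 * l * (2 * l)))%:E.
Proof.
move=> mG G0 K0 l0 Gz GK.
have ms : measurable_fun [set: TR * (TR * TR)]
    (fun p => (p.1, ((p.1 * p.2.1)%R, (p.1 * p.2.2)%R)) : TR * (TR * TR)).
  apply: measurable_fun_pair => //; apply: measurable_fun_pair; apply: measurable_funM => //.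
    exact: (measurableT_comp measurable_fst measurable_snd).
  exact: (measurableT_comp measurable_snd measurable_snd).
pose H (p : TR * (TR * TR)) : \bar R := (p.1 ^+ 2 * G (p.1, ((p.1 * p.2.1)%R, (p.1 * p.2.2)%R)))%:E.
have mH : measurable_fun setT H.
  apply/measurable_EFinP; apply: measurable_funM; first exact: measurable_funX.
  exact: (measurableT_comp mG ms).
have H0 p : 0 <= H p by rewrite lee_fin mulr_ge0 ?sqr_ge0.
have -> : \int[mu]_z \int[mu2]_q (G (z, q))%:E = \int[mu]_z \int[mu2]_q H (z, q).
  apply: eq_integral => z _; have [->|z0] := eqVneq (z : R) 0%R.
    by apply: eq_integral => q _; rewrite Gz /H /= expr0n mul0r.
  have mGz : measurable_fun setT (fun q => (G (z, q))%:E).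
    by apply/measurable_EFinP; exact: (measurable_fun_pair2 z mG).
  rewrite -(ge0_integral2_dilation z0 mGz) => [|q]; last by rewrite lee_fin.
  rewrite -ge0_integralZl_EFin ?sqr_ge0//.
  - by move=> q _; rewrite lee_fin.
  - apply/measurable_EFinP; exact: (measurable_fun_pair2 z (measurableT_comp mG ms)).
rewrite (fubini_tonelli (m1 := mu) (m2 := mu2) H mH H0).
set A := `[(a - l)%R, (a + l)%R] `*` `[(b - l)%R, (b + l)%R] in GK.
have mA : measurable A by apply: measurableX; exact: measurable_itv.
apply: (@le_trans _ _ (\int[mu2]_q (K * \1_A q)%:E)).
  apply: ge0_le_integral => //.
  - by move=> q _; apply: integral_ge0.
  - exact: (measurable_fun_fubini_tonelli_G (m1 := mu) H mH H0).
  - by apply/measurable_EFinP; apply: measurable_funM => //; exact: measurable_indic.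
  - by move=> q _; exact: GK.
under eq_integral do rewrite EFinM.
rewrite ge0_integralZl_EFin//; last first.
  by apply/measurable_EFinP; exact: measurable_indic.
rewrite integral_indic// setIT [leRHS]EFinM lee_wpmul2l ?lee_fin//.
rewrite /A [X in X <= _](product_measure1E (@lebesgue_measure R) (@lebesgue_measure R))//.
have itv c : mu `[(c - l)%R, (c + l)%R] <= (2 * l)%:E.
  rewrite lebesgue_measure_itv /=; case: ifP => _.
    by rewrite -EFinB lee_fin; lra.
  by rewrite lee_fin mulr_ge0.
by rewrite [leRHS]EFinM; apply: lee_pmul => //; exact: itv.
Qed.

(** The part of the shell seen through a pair of opposite faces of the cube: [p.1] is a coordinate
    of largest modulus, and [e] puts the three coordinates back in order. *)
Definition face_weight (omega xi0 : R3 R) (N r m M : R) (s1 s2 : bool)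
    (e : TR -> TR * TR -> R3 R) (p : TR * (TR * TR)) : R :=
  if (`|p.2.1 : R| <= `|p.1 : R|)%R && (`|p.2.2 : R| <= `|p.1 : R|)%R
  then shell_weight omega xi0 N r m M s1 s2 (e p.1 p.2) else 0%R.

(** The constant is the line bound N^2 (32 pi M) times the area (128 r / N)^2 of the square of
    directions: the powers of N cancel and 2^5 times 2^14 is 2^19. *)
Lemma integral_face_weight (omega xi0 : R3 R) (N r m M : R) (s1 s2 : bool)
    (e : TR -> TR * TR -> R3 R) :
  (0 < N)%R -> (0 < r)%R -> (0 < M)%R ->
  measurable_fun setT (fun p : TR * (TR * TR) => e p.1 p.2) ->
  (forall (z : R) q, e z ((z * q.1)%R, (z * q.2)%R) = scale3 z (e 1%R q)) ->
  (forall q, 1 <= norm3 (e 1%R q))%R ->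
  (forall q, `|q.1 : R| <= 1 -> `|q.2 : R| <= 1 -> norm3 (e 1 q) < 2)%R ->
  (exists a b : R, forall (z : R) q, (N < 4 * `|z|)%R ->
    (`|q.1 : R| <= 1)%R -> (`|q.2 : R| <= 1)%R ->
    cross_le r omega (scale3 z (e 1%R q)) ->
    (`|(q.1 : R) - a| <= 64 * r / N)%R /\ (`|(q.2 : R) - b| <= 64 * r / N)%R) ->
  \int[mu]_z \int[mu2]_q (face_weight omega xi0 N r m M s1 s2 e (z, q))%:E <=
  (2 ^+ 19 * pi * (r ^+ 2 * M))%:E.
Proof.
move=> N0 r0 M0 me he hn hs [a [b hl]].
set G := face_weight omega xi0 N r m M s1 s2 e.
have l0 : (0 <= 64 * r / N)%R by rewrite divr_ge0// ?mulr_ge0// ltW.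
have K0 : (0 <= N ^+ 2 * (32 * pi * M))%R.
  by rewrite mulr_ge0 ?sqr_ge0// !mulr_ge0 ?pi_ge0// ltW.
have G0 p : (0 <= G p)%R.
  by rewrite /G /face_weight; case: ifP => // _; exact: shell_weight_ge0.
rewrite (_ : (2 ^+ 19 * pi * (r ^+ 2 * M) =
  N ^+ 2 * (32 * pi * M) * (2 * (64 * r / N) * (2 * (64 * r / N))))%R); last first.
  by field; rewrite gt_eqF.
have mG : measurable_fun setT G.
  apply: measurable_fun_ifT => //.
    have m1 : measurable_fun [set: TR * (TR * TR)] (fun p => `|p.2.1 : R|%R).
      apply: measurableT_comp => //; exact: (measurableT_comp measurable_fst measurable_snd).
    have m2 : measurable_fun [set: TR * (TR * TR)] (fun p => `|p.2.2 : R|%R).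
      apply: measurableT_comp => //; exact: (measurableT_comp measurable_snd measurable_snd).
    have m0 : measurable_fun [set: TR * (TR * TR)] (fun p => `|p.1 : R|%R).
      by apply: measurableT_comp.
    by apply: measurable_and; exact: measurable_fun_ler.
  by apply: measurable_shell_weight.
apply: (@cone_bound G _ a b _ mG G0 K0 l0).
- move=> q; rewrite /G /face_weight /=; case: ifP => //.
  rewrite normr0 !normr_le0 => /andP[/eqP q1 /eqP q2].
  have := he 0%R q; rewrite !mul0r => e0.
  rewrite (_ : q = (0%R, 0%R)); last by case: q q1 q2 {e0} => x y /= -> ->.
  rewrite e0 (_ : scale3 0 _ = scale3 0 xi0); last by rewrite /scale3 !mul0r.
  exact: shell_weight0.
move=> q.
have GE z : (G (z, ((z * q.1)%R, (z * q.2)%R)) <=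
    shell_weight omega xi0 N r m M s1 s2 (scale3 z (e 1%R q)))%R.
  rewrite /G /face_weight /= he; case: ifP => // _; exact: shell_weight_ge0.
have mshell : measurable_fun [set: TR] (fun z : TR =>
    ((z : R) ^+ 2 * shell_weight omega xi0 N r m M s1 s2 (scale3 z (e 1%R q)))%:E).
  apply/measurable_EFinP; apply: measurable_funM; first exact: measurable_funX.
  by apply: measurable_shell_weight => //; exact: measurable_scale3.
rewrite indicE; case: (boolP (q \in _)) => [_|qA].
  rewrite mulr1; apply: le_trans (integral_shell_ray omega xi0 r m s1 s2 N0 M0 (hn q)).
  apply: ge0_le_integral => //.
  - by move=> z _; rewrite lee_fin mulr_ge0 ?sqr_ge0.
  - apply/measurable_EFinP; apply: measurable_funM; first exact: measurable_funX.
    apply: (measurableT_comp mG (g := fun z : TR => (z, ((z * q.1)%R : TR, (z * q.2)%R : TR)))).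
    by apply: measurable_fun_pair => //; apply: measurable_fun_pair; exact: measurable_funM.
  - by move=> z _; rewrite lee_fin ler_wpM2l ?sqr_ge0.
have G00 z : G (z, ((z * q.1)%R, (z * q.2)%R)) = 0%R.
  rewrite /G /face_weight /= he; case: ifP => // /andP[z1 z2].
  rewrite /shell_weight; case: ifP => // /and4P[Nn _ cr _]; exfalso.
  move: Nn; rewrite norm3_scale => Nn.
  have z0 : (0 < `|z|)%R.
    rewrite normr_gt0; apply: contraTneq Nn => ->.
    by rewrite normr0 mul0r -leNgt divr_ge0// ltW.
  have q1 : (`|q.1 : R| <= 1)%R by move: z1; rewrite normrM ger_pMr.
  have q2 : (`|q.2 : R| <= 1)%R by move: z2; rewrite normrM ger_pMr.
  (* On the shell N/2 is below |z| times the length of the face vector, and that length is below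
     2. *)
  have Nz : (N < 4 * `|z|)%R.
    have : (`|z| * norm3 (e 1 q) < `|z| * 2)%R by rewrite ltr_pM2l// hs.
    by move: Nn; lra.
  have [qa qb] := hl z q Nz q1 q2 cr.
  move/negP: qA; apply; rewrite inE; split; rewrite /= in_itv/= -ler_distl //.
by under eq_integral do rewrite G00 mulr0; rewrite integral0 mulr0.
Qed.

End cone_estimate.

Section kernel_estimate.
Variable R : realType.
Local Notation mu := (@lebesgue_measure R).
Local Notation TR := (measurableTypeR R).
Local Notation mu2 := (@lebesgue2 R).
Local Notation mu3 := (@lebesgue3 R).
Local Open Scope ereal_scope.

Definition face_x (x : TR) (q : TR * TR) : R3 R := (x, q.1, q.2).
Definition face_y (y : TR) (q : TR * TR) : R3 R := (q.1, y, q.2).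
Definition face_z (z : TR) (q : TR * TR) : R3 R := (q.1, q.2, z).

Lemma norm3_ge1 (a : R3 R) : (1 <= dot3 a a)%R -> (1 <= norm3 a)%R.
Proof. by move=> h; rewrite -sqrtr1 ler_wsqrtr. Qed.

Lemma norm3_lt2 (a : R3 R) : (dot3 a a <= 3)%R -> (norm3 a < 2)%R.
Proof.
move=> h; rewrite -ltr_sqr ?nnegrE ?norm3_ge0// norm3_sqr.
by apply: le_lt_trans h _; lra.
Qed.

Lemma sqr_le1 (x : R) : (`|x| <= 1)%R -> (x ^+ 2 <= 1)%R.
Proof. by move=> x1; rewrite -real_normK ?num_real// expr_le1. Qed.

Section faces.
Variables (omega xi0 : R3 R) (N r m M : R) (s1 s2 : bool).
Hypotheses (N0 : (0 < N)%R) (r0 : (0 < r)%R) (M0 : (0 < M)%R)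
  (omega1 : sphere2 omega).

Let o1 : (omega.1.1 ^+ 2 + omega.1.2 ^+ 2 + omega.2 ^+ 2 = 1)%R.
Proof.
have := norm3_sqr omega; rewrite (omega1 : norm3 omega = 1%R) expr1n /dot3 => ->.
by rewrite !expr2.
Qed.

Let bound := (2 ^+ 19 * pi * (r ^+ 2 * M))%R.
Local Notation face := (face_weight omega xi0 N r m M s1 s2).

Lemma integral_face_z : \int[mu]_z \int[mu2]_q (face face_z (z, q))%:E <= bound%:E.
Proof.
apply: integral_face_weight => //.
- apply: measurable_fun_pair; last exact: measurable_fst.
  by apply: measurable_fun_pair; [exact: (measurableT_comp measurable_fst measurable_snd)
    |exact: (measurableT_comp measurable_snd measurable_snd)].
- by move=> z q; rewrite /face_z /scale3 /= mulr1.
- move=> q; apply: norm3_ge1; rewrite /dot3 /= mulr1 -!expr2 lerDr.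
  by rewrite addr_ge0 ?sqr_ge0.
- move=> q /sqr_le1 q1 /sqr_le1 q2; apply: norm3_lt2; rewrite /dot3 /= mulr1 -!expr2.
  by apply: (@le_trans _ _ (1 + 1 + 1)%R); [rewrite !lerD|lra].
have [a [b H]] := tube_direction_localised o1 r0 N0.
exists a, b => z q Nz q1 q2 /and3P[_ c1 c2]; apply: (H z) => //.
  by move: c1; rewrite /= mulr1 mulrBr mulrA.
by move: c2; rewrite /= mulr1 mulrBr mulrA.
Qed.

Lemma integral_face_x : \int[mu]_z \int[mu2]_q (face face_x (z, q))%:E <= bound%:E.
Proof.
apply: integral_face_weight => //.
- apply: measurable_fun_pair; last exact: (measurableT_comp measurable_snd measurable_snd).
  apply: measurable_fun_pair; first exact: measurable_fst.
  exact: (measurableT_comp measurable_fst measurable_snd).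
- by move=> z q; rewrite /face_x /scale3 /= mulr1.
- move=> q; apply: norm3_ge1; rewrite /dot3 /= mulr1 -!expr2 -addrA lerDl.
  by rewrite addr_ge0 ?sqr_ge0.
- move=> q /sqr_le1 q1 /sqr_le1 q2; apply: norm3_lt2; rewrite /dot3 /= mulr1 -!expr2.
  by apply: (@le_trans _ _ (1 + 1 + 1)%R); [rewrite !lerD|lra].
have o : (omega.1.2 ^+ 2 + omega.2 ^+ 2 + omega.1.1 ^+ 2 = 1)%R.
  by rewrite -o1 addrC addrA.
have [a [b H]] := tube_direction_localised o r0 N0.
exists a, b => z q Nz q1 q2 /and3P[c1 c2 _]; apply: (H z) => //.
  by move: c1; rewrite /= mulr1 distrC mulrBr mulrA.
by move: c2; rewrite /= mulr1 distrC mulrBr mulrA.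
Qed.

Lemma integral_face_y : \int[mu]_z \int[mu2]_q (face face_y (z, q))%:E <= bound%:E.
Proof.
apply: integral_face_weight => //.
- apply: measurable_fun_pair; last exact: (measurableT_comp measurable_snd measurable_snd).
  apply: measurable_fun_pair; last exact: measurable_fst.
  exact: (measurableT_comp measurable_fst measurable_snd).
- by move=> z q; rewrite /face_y /scale3 /= mulr1.
- move=> q; apply: norm3_ge1; rewrite /dot3 /= mulr1 -!expr2 addrAC lerDr.
  by rewrite addr_ge0 ?sqr_ge0.
- move=> q /sqr_le1 q1 /sqr_le1 q2; apply: norm3_lt2; rewrite /dot3 /= mulr1 -!expr2.
  by apply: (@le_trans _ _ (1 + 1 + 1)%R); [rewrite !lerD|lra].
have o : (omega.1.1 ^+ 2 + omega.2 ^+ 2 + omega.1.2 ^+ 2 = 1)%R.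
  by rewrite -o1 addrAC.
have [a [b H]] := tube_direction_localised o r0 N0.
exists a, b => z q Nz q1 q2 /and3P[c1 _ c2]; apply: (H z) => //.
  by move: c1; rewrite /= mulr1 mulrBr mulrA.
by move: c2; rewrite /= mulr1 distrC mulrBr mulrA.
Qed.

Lemma face_weight_ge0 e p : (0 <= face e p)%R.
Proof. by rewrite /face_weight; case: ifP => // _; exact: shell_weight_ge0. Qed.

(** Some coordinate of [xi] has the largest modulus, and the face of that coordinate carries the
    full weight. *)
Lemma shell_weight_le_faces (xi : R3 R) :
  (shell_weight omega xi0 N r m M s1 s2 xi <=
    face face_z (xi.2, (xi.1.1, xi.1.2)) + face face_x (xi.1.1, (xi.1.2, xi.2)) +
    face face_y (xi.1.2, (xi.1.1, xi.2)))%R.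
Proof.
have f0 := face_weight_ge0.
case: xi => -[x y] z /=.
have [H|H] := boolP ((`|x : R| <= `|z : R|) && (`|y : R| <= `|z : R|))%R.
  by rewrite {1}/face_weight /= H -addrA lerDl addr_ge0.
have [H'|H'] := boolP ((`|y : R| <= `|x : R|) && (`|z : R| <= `|x : R|))%R.
  rewrite [X in (_ + X + _)%R]/face_weight /= H' addrAC lerDr addr_ge0//.
rewrite [X in (_ + X)%R]/face_weight /= ifT ?lerDr ?addr_ge0//.
move: H H'; rewrite !negb_and -!ltNge.
by case/orP => h1; case/orP => h2; apply/andP; split; lra.
Qed.

Lemma measurable_face_comp d (T : measurableType d) (e : TR -> TR * TR -> R3 R)
    (f : T -> TR) (g h : T -> TR) :
  measurable_fun setT f -> measurable_fun setT g -> measurable_fun setT h ->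
  measurable_fun setT (fun p : TR * (TR * TR) => e p.1 p.2) ->
  measurable_fun setT (fun t => (face e (f t, (g t, h t)))%:E).
Proof.
move=> mf mg mh me; apply/measurable_EFinP; apply: measurable_fun_ifT => //.
  by apply: measurable_and; apply: measurable_fun_ler; exact: measurableT_comp.
apply: measurable_shell_weight => //.
apply: (measurableT_comp me (g := fun t => (f t, (g t, h t)))).
by apply: measurable_fun_pair => //; exact: measurable_fun_pair.
Qed.

Lemma integral_shell_weight :
  \int[mu3]_xi (shell_weight omega xi0 N r m M s1 s2 xi)%:E <=
  (3 * (2 ^+ 19 * pi * (r ^+ 2 * M)))%:E.
Proof.
have c1 : measurable_fun [set: R3 R] (fun xi => xi.1.1).
  exact: (measurableT_comp measurable_fst measurable_fst).
have c2 : measurable_fun [set: R3 R] (fun xi => xi.1.2).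
  exact: (measurableT_comp measurable_snd measurable_fst).
have c3 : measurable_fun [set: R3 R] (fun xi => xi.2) by exact: measurable_snd.
have p1 : measurable_fun [set: TR * (TR * TR)] (fun p => p.1) by exact: measurable_fst.
have p2 : measurable_fun [set: TR * (TR * TR)] (fun p => p.2.1).
  exact: (measurableT_comp measurable_fst measurable_snd).
have p3 : measurable_fun [set: TR * (TR * TR)] (fun p => p.2.2).
  exact: (measurableT_comp measurable_snd measurable_snd).
have mez : measurable_fun setT (fun p : TR * (TR * TR) => face_z p.1 p.2).
  by apply: measurable_fun_pair => //; exact: measurable_fun_pair.
have mex : measurable_fun setT (fun p : TR * (TR * TR) => face_x p.1 p.2).
  by apply: measurable_fun_pair => //; exact: measurable_fun_pair.
have mey : measurable_fun setT (fun p : TR * (TR * TR) => face_y p.1 p.2).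
  by apply: measurable_fun_pair => //; exact: measurable_fun_pair.
pose Fz (xi : R3 R) : \bar R := (face face_z (xi.2, (xi.1.1, xi.1.2)))%:E.
pose Fx (xi : R3 R) : \bar R := (face face_x (xi.1.1, (xi.1.2, xi.2)))%:E.
pose Fy (xi : R3 R) : \bar R := (face face_y (xi.1.2, (xi.1.1, xi.2)))%:E.
have mFz : measurable_fun setT Fz by exact: measurable_face_comp.
have mFx : measurable_fun setT Fx by exact: measurable_face_comp.
have mFy : measurable_fun setT Fy by exact: measurable_face_comp.
have F0 e p : 0 <= (face e p)%:E by rewrite lee_fin face_weight_ge0.
(* For each face Tonelli is used in the order that puts the dominant coordinate outermost. *)
have Iz : \int[mu3]_xi Fz xi <= bound%:E.
  rewrite (fubini_tonelli2 (m1 := mu2) (m2 := mu) Fz mFz (fun _ => F0 _ _)).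
  apply: le_trans integral_face_z; rewrite le_eqVlt; apply/orP; left; apply/eqP.
  by apply: eq_integral => z _; apply: eq_integral => -[x y] _.
have Ix : \int[mu3]_xi Fx xi <= bound%:E.
  rewrite (fubini_tonelli1 (m1 := mu2) (m2 := mu) Fx mFx (fun _ => F0 _ _)).
  have mG := measurable_fun_fubini_tonelli_F (m2 := mu) Fx mFx (fun _ => F0 _ _).
  have G0 q : 0 <= fubini_F mu Fx q by apply: integral_ge0 => z _; exact: F0.
  rewrite (fubini_tonelli1 (m1 := mu) (m2 := mu) _ mG G0).
  apply: le_trans integral_face_x; rewrite le_eqVlt; apply/orP; left; apply/eqP.
  apply: eq_integral => x _.
  transitivity (\int[mu2]_q (face face_x (x, (q.1, q.2)))%:E); last first.
    by apply: eq_integral => -[].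
  have mf : measurable_fun setT (fun q : TR * TR => (face face_x (x, (q.1, q.2)))%:E).
    by apply: measurable_face_comp => //; exact: measurable_cst.
  by rewrite (fubini_tonelli1 (m1 := mu) (m2 := mu) _ mf (fun _ => F0 _ _)).
have Iy : \int[mu3]_xi Fy xi <= bound%:E.
  rewrite (fubini_tonelli1 (m1 := mu2) (m2 := mu) Fy mFy (fun _ => F0 _ _)).
  have mG := measurable_fun_fubini_tonelli_F (m2 := mu) Fy mFy (fun _ => F0 _ _).
  have G0 q : 0 <= fubini_F mu Fy q by apply: integral_ge0 => z _; exact: F0.
  rewrite (fubini_tonelli2 (m1 := mu) (m2 := mu) _ mG G0).
  apply: le_trans integral_face_y; rewrite le_eqVlt; apply/orP; left; apply/eqP.
  apply: eq_integral => x _.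
  transitivity (\int[mu2]_q (face face_y (x, (q.1, q.2)))%:E); last first.
    by apply: eq_integral => -[].
  have mf : measurable_fun setT (fun q : TR * TR => (face face_y (x, (q.1, q.2)))%:E).
    by apply: measurable_face_comp => //; exact: measurable_cst.
  by rewrite (fubini_tonelli1 (m1 := mu) (m2 := mu) _ mf (fun _ => F0 _ _)).
apply: (@le_trans _ _ (\int[mu3]_xi (Fz xi + Fx xi + Fy xi))).
  apply: ge0_le_integral => //.
  - by move=> xi _; rewrite lee_fin shell_weight_ge0.
  - by apply/measurable_EFinP; exact: measurable_shell_weight.
  - by apply: emeasurable_funD => //; exact: emeasurable_funD.
  - by move=> xi _; rewrite /Fz /Fx /Fy -!EFinD lee_fin shell_weight_le_faces.
have mzx : measurable_fun setT (fun xi => Fz xi + Fx xi) by exact: emeasurable_funD.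
have zx0 xi : setT xi -> 0 <= Fz xi + Fx xi by move=> _; apply: adde_ge0; exact: F0.
rewrite (ge0_integralD mu3 measurableT zx0 mzx (fun _ _ => F0 _ _) mFy).
rewrite (ge0_integralD mu3 measurableT (fun _ _ => F0 _ _) mFz (fun _ _ => F0 _ _) mFx).
rewrite (_ : (3 * _)%:E = bound%:E + bound%:E + bound%:E).
  by rewrite !leeD.
by rewrite -!EFinD; congr EFin; rewrite /bound; ring.
Qed.

End faces.
End kernel_estimate.

(** * The kernel on space-time *)

Section spacetime_kernel.
Variable R : realType.
Local Notation mu := (@lebesgue_measure R).
Local Notation TR := (measurableTypeR R).
Local Notation mu3 := (@lebesgue3 R).
Local Notation mu13 := (@lebesgue13 R).
Local Open Scope ereal_scope.

Variables (omega : R3 R) (N r L1 L2 : R) (s1 s2 : bool).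
Hypotheses (N0 : (0 < N)%R) (r0 : (0 < r)%R) (L10 : (0 < L1)%R) (L20 : (0 < L2)%R)
  (omega1 : sphere2 omega).

(** A boolean, measurable set that contains the part of the cone region lying over the tube, by
    [tube_cross_le]. *)
Definition tube_cone (X : R13 R) : bool :=
  [&& N / 2 < norm3 X.2, norm3 X.2 <= N, cross_le r omega X.2 &
      `|- X.1 + sgn R s1 * norm3 X.2| <= L1]%R.

Definition thick_cone (X : R13 R) : bool :=
  (`|- X.1 + sgn R s2 * norm3 X.2| <= L2)%R.

Definition kernel (X0 X1 : R13 R) : R :=
  if tube_cone X1 && thick_cone (X0 - X1)%R then (theta12 s1 s2 X1 (X0 - X1)%R ^+ 2)%R else 0%R.

Lemma kernel_ge0 X0 X1 : (0 <= kernel X0 X1)%R.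
Proof. by rewrite /kernel; case: ifP => // _; exact: sqr_ge0. Qed.

Section measurability.
Context d (T : measurableType d).
Implicit Types f g : T -> R13 R.

Lemma measurable_R13P f : measurable_fun setT f <->
  measurable_fun setT (fun x => (f x).1 : R) /\ measurable_fun setT (fun x => (f x).2).
Proof.
split=> [/measurable_fun_pairP[]//|[f1 f2]].
by apply/measurable_fun_pairP; split; [exact: f1|exact: f2].
Qed.

Lemma measurable_sub13 f g : measurable_fun setT f -> measurable_fun setT g ->
  measurable_fun setT (fun x => f x - g x)%R.
Proof.
move=> /measurable_R13P[f1 f2] /measurable_R13P[g1 g2]; apply/measurable_R13P; split.
  exact: measurable_funB.
exact: measurable_sub3.
Qed.

Let measurable_cone_band s L f : measurable_fun setT f ->
  measurable_fun setT (fun x => (`|- (f x).1 + sgn R s * norm3 (f x).2| <= L)%R).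
Proof.
move=> /measurable_R13P[f1 f2]; apply: measurable_fun_ler => //.
apply: measurableT_comp => //; apply: measurable_funD; first exact: measurable_funN.
by apply: measurable_funM => //; exact: measurable_norm3.
Qed.

Lemma measurable_tube_cone f : measurable_fun setT f ->
  measurable_fun setT (fun x => tube_cone (f x)).
Proof.
move=> mf; have /measurable_R13P[f1 f2] := mf; have mn := measurable_norm3 f2.
apply: measurable_and; first exact: measurable_fun_ltr.
apply: measurable_and; first exact: measurable_fun_ler.
apply: measurable_and; first exact: measurable_cross_le.
exact: measurable_cone_band.
Qed.

Lemma measurable_thick_cone f : measurable_fun setT f ->
  measurable_fun setT (fun x => thick_cone (f x)).
Proof. exact: measurable_cone_band. Qed.

Lemma measurable_theta12 f g : measurable_fun setT f -> measurable_fun setT g ->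
  measurable_fun setT (fun x => theta12 s1 s2 (f x) (g x)).
Proof.
move=> /measurable_R13P[f1 f2] /measurable_R13P[g1 g2].
by apply: measurable_angle; exact: measurable_scale3.
Qed.

End measurability.

Lemma measurable_kernel X0 : measurable_fun setT (kernel X0).
Proof.
have mX : measurable_fun setT (fun X1 : R13 R => X0 - X1)%R by exact: measurable_sub13.
apply: measurable_fun_ifT => //.
  by apply: measurable_and; [exact: measurable_tube_cone|exact: measurable_thick_cone].
by apply: measurable_funX; exact: measurable_theta12.
Qed.

Let weight (X0 : R13 R) : R3 R -> R :=
  shell_weight omega X0.2 N r X0.1 (L1 + L2) s1 s2.

(** In the sum of the two cone conditions [t] cancels, which leaves the phase within [L1 + L2] of
    [X0.1]. *)
Lemma kernel_le_weight X0 (t : TR) xi : (kernel X0 (t, xi) <= weight X0 xi)%R.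
Proof.
rewrite /kernel; case: ifP => [/andP[/and4P[n1 n2 cr c1] c2]|_]; last exact: shell_weight_ge0.
rewrite /weight /shell_weight n1 n2 cr /= ifT//.
apply: le_trans (lerD c1 c2); apply: le_trans (ler_normD _ _).
by rewrite le_eqVlt; apply/orP; left; apply/eqP; congr `|_|%R; rewrite /=; ring.
Qed.

(** Gives two intervals for [t], of half-lengths [L1] and [L2]; [integral_kernel] keeps the shorter
    one. *)
Lemma kernel_band X0 (t : TR) xi : (kernel X0 (t, xi) != 0 ->
  `|(t : R) - sgn R s1 * norm3 xi| <= L1 /\
  `|(t : R) - (X0.1 - sgn R s2 * norm3 (X0.2 - xi)%R)| <= L2)%R.
Proof.
rewrite /kernel; case: ifP => [/andP[/and4P[_ _ _ c1] c2] _|]; last by rewrite eqxx.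
split; [move: c1|move: c2]; rewrite /thick_cone /= => h.
  by rewrite distrC addrC.
by apply: le_trans h; rewrite le_eqVlt; apply/orP; left; apply/eqP; congr `|_|%R; ring.
Qed.

Lemma integral_kernel X0 :
  \int[mu13]_X (kernel X0 X)%:E <= (3 * 2 ^+ 21 * pi * (r ^+ 2 * (L1 * L2)))%:E.
Proof.
have mk : measurable_fun setT (fun X => (kernel X0 X)%:E).
  by apply/measurable_EFinP; exact: measurable_kernel.
have k0 X : 0 <= (kernel X0 X)%:E by rewrite lee_fin kernel_ge0.
rewrite (fubini_tonelli2 (m1 := mu) (m2 := mu3) _ mk k0) /fubini_G.
pose L := Num.min L1 L2.
have L0 : (0 < L)%R by rewrite lt_min L10.
have inner xi : \int[mu]_t (kernel X0 (t, xi))%:E <= (2 * L)%:E * (weight X0 xi)%:E.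
  pose c := if (L1 <= L2)%R then (sgn R s1 * norm3 xi)%R
    else (X0.1 - sgn R s2 * norm3 (X0.2 - xi)%R)%R.
  pose D : set TR := `[(c - L)%R, (c + L)%R]%classic.
  have mD : measurable D by exact: measurable_itv.
  have muD : mu D <= (2 * L)%:E.
    rewrite lebesgue_measure_itv /=; case: ifP => _.
      by rewrite -EFinB lee_fin; lra.
    by rewrite lee_fin mulr_ge0// ltW.
  apply: (@le_trans _ _ (\int[mu]_t ((weight X0 xi)%:E * (\1_D t)%:E))).
    apply: ge0_le_integral => //.
    - exact: (measurable_fun_pair1 xi mk).
    - by apply: measurable_funeM; apply/measurable_EFinP; exact: measurable_indic.
    move=> t _; rewrite -EFinM lee_fin indicE; case: (boolP (t \in D)) => [_|tD].
      by rewrite mulr1 kernel_le_weight.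
    rewrite mulr0; have [->//|kn] := eqVneq (kernel X0 (t, xi)) 0%R.
    move/negP: tD; case; rewrite inE /D /= in_itv/= -ler_distl.
    have [k1 k2] := kernel_band kn.
    rewrite /c /L; have [h|h] := leP L1 L2; [exact: k1|exact: k2].
  rewrite ge0_integralZl_EFin ?shell_weight_ge0//; last first.
    by apply/measurable_EFinP; exact: measurable_indic.
  by rewrite integral_indic// setIT muleC lee_wpmul2r ?lee_fin ?shell_weight_ge0//.
have mw : measurable_fun setT (fun xi => (weight X0 xi)%:E).
  by apply/measurable_EFinP; exact: measurable_shell_weight.
apply: (@le_trans _ _ (\int[mu3]_xi ((2 * L)%:E * (weight X0 xi)%:E))).
  apply: ge0_le_integral => //.
  - by move=> xi _; apply: integral_ge0.
  - exact: (measurable_fun_fubini_tonelli_G (m1 := mu) _ mk k0).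
  - exact: measurable_funeM.
have M0 : (0 < L1 + L2)%R by rewrite addr_gt0.
have L20' : (0 <= 2 * L)%R by rewrite mulr_ge0// ltW.
rewrite ge0_integralZl_EFin//; last by move=> xi _; rewrite lee_fin shell_weight_ge0.
apply: le_trans (lee_wpmul2l _ (integral_shell_weight X0.2 X0.1 s1 s2 N0 r0 M0 omega1)) _.
  by rewrite lee_fin.
rewrite -EFinM lee_fin.
(* The sum is at most twice the maximum, and minimum times maximum is the product. This 2, the 2 in
   front of [L] and the face constant 3 2^19 give 3 2^21. *)
have LL : (L * (L1 + L2) <= 2 * (L1 * L2))%R.
  rewrite /L; have [h|h] := leP L1 L2;
    [have := ler_wpM2l (ltW L10) h|have := ler_wpM2l (ltW L20) (ltW h)]; lra.
rewrite (_ : 2 * L * _ = (3 * 2 ^+ 20 * pi * r ^+ 2) * (L * (L1 + L2)))%R; last by ring.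
rewrite (_ : 3 * 2 ^+ 21 * _ * _ = (3 * 2 ^+ 20 * pi * r ^+ 2) * (2 * (L1 * L2)))%R; last by ring.
apply: ler_wpM2l => //; apply: mulr_ge0; last exact: sqr_ge0.
by apply: mulr_ge0; [exact: mulr_ge0|exact: pi_ge0].
Qed.

End spacetime_kernel.

(** * The bilinear estimate *)

Section measure_preserving.
Variable R : realType.
Local Open Scope ereal_scope.

(** Invariance is phrased through integrals of nonnegative functions because in this form it passes
    to products by Tonelli. *)
Definition preserves_integral d (T : measurableType d) (m : {measure set T -> \bar R})
    (tau : T -> T) : Prop := measurable_fun setT tau /\
  forall g : T -> \bar R, measurable_fun setT g -> (forall x, 0 <= g x) ->
    \int[m]_x g (tau x) = \int[m]_x g x.

Lemma preserves_integral_prod d1 d2 (T1 : measurableType d1) (T2 : measurableType d2)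
    (m1 : {sigma_finite_measure set T1 -> \bar R})
    (m2 : {sigma_finite_measure set T2 -> \bar R}) (tau1 : T1 -> T1) (tau2 : T2 -> T2) :
  preserves_integral m1 tau1 -> preserves_integral m2 tau2 ->
  preserves_integral (m1 \x m2) (fun z => (tau1 z.1, tau2 z.2)).
Proof.
move=> [mt1 H1] [mt2 H2].
have mt : measurable_fun setT (fun z : T1 * T2 => (tau1 z.1, tau2 z.2)).
  apply: measurable_fun_pair; first exact: (measurableT_comp mt1).
  exact: (measurableT_comp mt2).
split=> // g mg g0.
have mgt : measurable_fun setT (fun z : T1 * T2 => g (tau1 z.1, tau2 z.2)).
  exact: (measurableT_comp mg mt).
rewrite (fubini_tonelli1 _ mgt (fun _ => g0 _)) (fubini_tonelli1 g mg g0).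
have mF := measurable_fun_fubini_tonelli_F (m2 := m2) g mg g0.
have F0 x : 0 <= fubini_F m2 g x by apply: integral_ge0.
rewrite -(H1 _ mF F0); apply: eq_integral => x _; rewrite /fubini_F /=.
by rewrite (H2 (fun y => g (tau1 x, y)))//; exact: (measurable_fun_pair2 _ mg).
Qed.

Lemma preserves_integral_reflect1 (b : R) :
  preserves_integral (@lebesgue_measure R) (fun x : R => (b - x)%R).
Proof.
split; first exact: measurable_funB.
by move=> g mg g0; exact: ge0_integral_reflect.
Qed.

Lemma ge0_integral_reflect13 (X0 : R13 R) (g : R13 R -> \bar R) :
  measurable_fun setT g -> (forall x, 0 <= g x) ->
  \int[@lebesgue13 R]_X g (X0 - X)%R = \int[@lebesgue13 R]_X g X.
Proof.
have P2 := preserves_integral_prod (preserves_integral_reflect1 X0.2.1.1)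
  (preserves_integral_reflect1 X0.2.1.2).
have P3 := @preserves_integral_prod _ _ _ _ (@lebesgue2 R) (@lebesgue_measure R) _ _ P2
  (preserves_integral_reflect1 X0.2.2).
have [_ P] := @preserves_integral_prod _ _ _ _ (@lebesgue_measure R) (@lebesgue3 R) _ _
  (preserves_integral_reflect1 X0.1) P3.
by move=> mg g0; rewrite -(P g mg g0).
Qed.

(** A translation is a composition of two reflections. *)
Lemma ge0_integral_shift13 (X1 : R13 R) (g : R13 R -> \bar R) :
  measurable_fun setT g -> (forall x, 0 <= g x) ->
  \int[@lebesgue13 R]_X g (X - X1)%R = \int[@lebesgue13 R]_X g X.
Proof.
move=> mg g0; rewrite -(ge0_integral_reflect13 0%R mg g0).
have mr : measurable_fun setT (fun Y : R13 R => g (0 - Y)%R).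
  by apply: (measurableT_comp mg); exact: measurable_sub13.
rewrite -[RHS](ge0_integral_reflect13 X1 mr) => [|Y]; last exact: g0.
by apply: eq_integral => X _; rewrite sub0r opprB.
Qed.

Lemma ae_reflect13 (X0 : R13 R) (P : R13 R -> Prop) :
  {ae @lebesgue13 R, forall X, P X} -> {ae @lebesgue13 R, forall X, P (X0 - X)%R}.
Proof.
move=> [A [mA A0 PA]]; pose B := (fun X : R13 R => X0 - X)%R @^-1` A.
have mB : measurable B.
  by rewrite -[B]setTI; apply: (measurable_sub13 _ _ measurableT) => //; exact: measurable_cst.
have mA1 : measurable_fun setT (fun X : R13 R => (\1_A X)%:E : \bar R).
  by apply/measurable_EFinP; exact: measurable_indic.
have A10 (X : R13 R) : 0 <= (\1_A X)%:E :> \bar R by rewrite lee_fin.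
have H := ge0_integral_reflect13 X0 mA1 A10.
exists B; split; [exact: mB | | by move=> X; exact: PA].
rewrite -[B]setIT -(integral_indic _ measurableT mB) -[RHS]A0 -[A in RHS]setIT.
by rewrite -(integral_indic _ measurableT mA) -[RHS]H.
Qed.

(** Hoelder with both exponents 2, squared. [b] will be the real or imaginary part of a convolution,
    which is controlled only through the integral of |f g|. *)
Lemma cauchy_schwarz_real d (T : measurableType d) (m : {measure set T -> \bar R})
    (f g : T -> R) (b K q : R) : measurable_fun setT f -> measurable_fun setT g ->
  (0 <= K)%R -> (0 <= q)%R ->
  \int[m]_x ((f x) ^+ 2)%:E <= K%:E -> \int[m]_x ((g x) ^+ 2)%:E <= q%:E ->
  (`|b|%R)%:E <= \int[m]_x (`|f x * g x|%R)%:E -> (b ^+ 2 <= K * q)%R.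
Proof.
move=> mf mg K0 q0 fK gq bfg.
have n2 (h : T -> R) (k : R) : (0 <= k)%R -> \int[m]_x ((h x) ^+ 2)%:E <= k%:E ->
    Lnorm m 2%:E (EFin \o h) <= (Num.sqrt k)%:E.
  move=> k0 hk; rewrite unlock.
  rewrite (_ : (Num.sqrt k)%:E = k%:E `^ 2^-1); last first.
    by rewrite poweR_EFin powR12_sqrt.
  apply: gt0_ler_poweR => //.
  - by rewrite in_itv/= leey andbT; apply: integral_ge0 => x _; rewrite lee_fin powR_ge0.
  - by rewrite in_itv/= leey andbT lee_fin.
  apply: le_trans hk; rewrite le_eqVlt; apply/orP; left; apply/eqP.
  apply: eq_integral => x _ /=.
  by rewrite powR_mulrn// real_normK ?num_real.
have pq : (2^-1 + 2^-1 = 1 :> R)%R by field.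
have := @hoelder _ _ _ m f g 2 2 mf mg (ltr0n _ 2) (ltr0n _ 2) pq.
rewrite Lnorm1 => H.
have h1 : (`|b|%R)%:E <= (Num.sqrt K * Num.sqrt q)%:E.
  apply: le_trans bfg _; apply: le_trans H _; rewrite EFinM.
  by apply: lee_pmul; rewrite ?Lnorm_ge0//; exact: n2.
rewrite -real_normK ?num_real// -(sqr_sqrtr K0) -(sqr_sqrtr q0) -exprMn.
by rewrite ler_sqr ?nnegrE ?mulr_ge0 ?sqrtr_ge0// -lee_fin.
Qed.

End measure_preserving.

(** * Weighted convolutions in L^2 *)

Section weighted_convolution.
Variable R : realType.
Local Notation mu := (@lebesgue13 R).
Local Notation Re := (@complex.Re R).
Local Notation Im := (@complex.Im R).
Local Open Scope ereal_scope.
Variables (w k : R13 R * R13 R -> R) (F1 F2 : R13 R -> R[i]) (K : R).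

Definition weighted_convolution (X0 : R13 R) : R[i] :=
  cintegral (fun X1 => (w (X0, X1))%:C * F1 X1 * F2 (X0 - X1)%R)%C%R.

Hypotheses (mw : measurable_fun setT w) (mF1 : cmeasurable F1) (mF2 : cmeasurable F2).

Let re (z : R13 R * R13 R) : R := (w z * (Re (F1 z.2) * Re (F2 (z.1 - z.2)) -
  Im (F1 z.2) * Im (F2 (z.1 - z.2))))%R.
Let im (z : R13 R * R13 R) : R := (w z * (Re (F1 z.2) * Im (F2 (z.1 - z.2)) +
  Im (F1 z.2) * Re (F2 (z.1 - z.2))))%R.

Lemma weighted_convolutionE X0 : weighted_convolution X0 =
  Complex (\int[mu]_X re (X0, X))%R (\int[mu]_X im (X0, X))%R.
Proof.
rewrite /weighted_convolution /cintegral /re /im; congr Complex;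
  apply: eq_Rintegral => X _; case: (F1 X) (F2 (X0 - X)%R) => a b [c d] /=; ring.
Qed.

Let msub : measurable_fun setT (fun z : R13 R * R13 R => z.1 - z.2)%R.
Proof. by apply: measurable_sub13. Qed.

Let mcomp1 (h : R13 R -> R) : measurable_fun setT h ->
  measurable_fun setT (fun z : R13 R * R13 R => h z.2).
Proof. by move=> mh; exact: (measurableT_comp mh). Qed.

Let mcomp2 (h : R13 R -> R) : measurable_fun setT h ->
  measurable_fun setT (fun z : R13 R * R13 R => h (z.1 - z.2)%R).
Proof. by move=> mh; exact: (measurableT_comp mh). Qed.

Let mre : measurable_fun setT re.
Proof.
have [mr1 mi1] := mF1; have [mr2 mi2] := mF2.
apply: measurable_funM => //; apply: measurable_funB; apply: measurable_funM.
- exact: (mcomp1 mr1).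
- exact: (mcomp2 mr2).
- exact: (mcomp1 mi1).
- exact: (mcomp2 mi2).
Qed.

Let mim : measurable_fun setT im.
Proof.
have [mr1 mi1] := mF1; have [mr2 mi2] := mF2.
apply: measurable_funM => //; apply: measurable_funD; apply: measurable_funM.
- exact: (mcomp1 mr1).
- exact: (mcomp2 mi2).
- exact: (mcomp1 mi1).
- exact: (mcomp2 mr2).
Qed.

Lemma cmeasurable_weighted_convolution : cmeasurable weighted_convolution.
Proof.
split; under eq_fun do rewrite weighted_convolutionE /=.
  exact: (@measurable_Rintegral1 _ _ (R13 R) (R13 R) R mu re mre).
exact: (@measurable_Rintegral1 _ _ (R13 R) (R13 R) R mu im mim).
Qed.

Let nn (F : R13 R -> R[i]) X : R := (Re (F X) ^+ 2 + Im (F X) ^+ 2)%R.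

Let nn_ge0 F X : (0 <= nn F X)%R. Proof. by rewrite addr_ge0 ?sqr_ge0. Qed.

Let mnn F : cmeasurable F -> measurable_fun setT (nn F).
Proof. by move=> [mr mi]; apply: measurable_funD; exact: measurable_funX. Qed.

Hypotheses (mk : forall X0, measurable_fun setT (fun X => k (X0, X)))
  (k0 : forall z, (0 <= k z)%R) (K0 : (0 < K)%R)
  (kK : forall X0, \int[mu]_X (k (X0, X))%:E <= K%:E)
  (wk : forall X0, {ae mu, forall X,
    [\/ F1 X = 0%R, F2 (X0 - X)%R = 0%R | (w (X0, X) ^+ 2 = k (X0, X))%R]}).

Let q X0 : \bar R := \int[mu]_X (nn F1 X * nn F2 (X0 - X))%:E.

Let mnn2 : measurable_fun setT (fun z : R13 R * R13 R => nn F1 z.2 * nn F2 (z.1 - z.2))%R.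
Proof.
by apply: measurable_funM; [exact: mcomp1 (mnn mF1)|exact: mcomp2 (mnn mF2)].
Qed.

Let q_ge0 X0 : 0 <= q X0.
Proof. by apply: integral_ge0 => X _; rewrite lee_fin mulr_ge0. Qed.

(** Cauchy-Schwarz for the square roots of [k] and of |F1|^2 |F2|^2. Almost everywhere one of the
    factors [F1], [F2] vanishes or w^2 = k, so |h| is at most the product of these roots. *)
Let part_le (h : R13 R * R13 R -> R) X0 : measurable_fun setT h ->
  (forall X, h (X0, X) ^+ 2 <= w (X0, X) ^+ 2 * (nn F1 X * nn F2 (X0 - X)))%R ->
  (((\int[mu]_X h (X0, X))%R ^+ 2)%:E <= K%:E * q X0).
Proof.
move=> mh hle.
have mh0 : measurable_fun setT (fun X => h (X0, X)).
  exact: (measurableT_comp mh (pair1_measurable X0)).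
(* Positivity of [K] makes the bound trivial when [q X0] is infinite. *)
have [->|qoo] := eqVneq (q X0) +oo; first by rewrite gt0_muley ?lte_fin// leey.
have qfin : q X0 \is a fin_num by rewrite ge0_fin_numE ?ltey.
rewrite -(fineK qfin) -EFinM lee_fin.
have mn2 : measurable_fun setT (fun X => nn F1 X * nn F2 (X0 - X)%R)%R.
  exact: (measurableT_comp mnn2 (pair1_measurable X0)).
apply: (@cauchy_schwarz_real _ _ _ mu (fun X => Num.sqrt (k (X0, X)))
  (fun X => Num.sqrt (nn F1 X * nn F2 (X0 - X)%R))).
- exact: (measurableT_comp (@measurable_sqrt R) (mk X0)).
- exact: (measurableT_comp (@measurable_sqrt R) mn2).
- exact: ltW.
- exact: fine_ge0.
- rewrite (eq_integral (fun X => (k (X0, X))%:E))//.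
  by move=> X _; rewrite sqr_sqrtr.
- rewrite fineK// /q le_eqVlt; apply/orP; left; apply/eqP.
  by apply: eq_integral => X _; rewrite sqr_sqrtr// mulr_ge0.
apply: le_trans (norm_fine_le _) _.
have mhE : measurable_fun setT (fun X => (h (X0, X))%:E) by exact/measurable_EFinP.
apply: le_trans (le_abse_integral mu measurableT mhE) _.
apply: ae_ge0_le_integral => //.
- exact: measurableT_comp.
- apply/measurable_EFinP; apply: measurableT_comp => //; apply: measurable_funM.
    exact: (measurableT_comp (@measurable_sqrt R) (mk X0)).
  exact: (measurableT_comp (@measurable_sqrt R) mn2).
apply: filterS (wk X0) => X wX _; rewrite abse_EFin lee_fin.
rewrite [leRHS]ger0_norm ?mulr_ge0 ?sqrtr_ge0// -sqrtr_sqr -sqrtrM//.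
rewrite ler_wsqrtr// (le_trans (hle X))//.
case: wX => [FX|FX|->//].
  by rewrite /nn FX /= expr0n /= addr0 mul0r !mulr0.
by rewrite /nn FX /= expr0n /= addr0 !mulr0.
Qed.

(** Tonelli and translation invariance split the integral of [q] into the product of the two squared
    norms. The factor 2 comes from bounding the real and imaginary parts separately. *)
Lemma sqnorm_weighted_convolution_le :
  sqnorm weighted_convolution <= (2 * K)%:E * (sqnorm F1 * sqnorm F2).
Proof.
pose f (z : R13 R * R13 R) : \bar R := (nn F1 z.2 * nn F2 (z.1 - z.2)%R)%:E.
have mf : measurable_fun setT f by apply/measurable_EFinP; exact: mnn2.
have f0 z : 0 <= f z by rewrite lee_fin mulr_ge0.
have mq : measurable_fun setT q.
  exact: (measurable_fun_fubini_tonelli_F (m2 := mu) f mf f0).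
have mE F : cmeasurable F -> measurable_fun setT (fun X => (nn F X)%:E).
  by move=> mF; exact: measurable_sqnorm.
have qE : \int[mu]_X0 q X0 = sqnorm F1 * sqnorm F2.
  have -> : \int[mu]_X0 q X0 = \int[mu]_X1 \int[mu]_X0 f (X0, X1).
    exact: (fubini_tonelli (m1 := mu) (m2 := mu) f mf f0).
  have F10 X : setT X -> 0 <= (nn F1 X)%:E by rewrite lee_fin.
  have := ge0_integralZr mu measurableT (mE F1 mF1) F10 (sqnorm_ge0 F2).
  move=> <-; apply: eq_integral => X1 _; rewrite /f /=.
  under eq_integral do rewrite EFinM.
  have mF2s : measurable_fun setT (fun X : R13 R => (nn F2 (X - X1)%R)%:E : \bar R).
    by apply: (measurableT_comp (mE F2 mF2)); exact: measurable_sub13.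
  have F20 (X : R13 R) : setT X -> 0 <= (nn F2 (X - X1)%R)%:E by rewrite lee_fin.
  have F11 : 0 <= (nn F1 X1)%:E by rewrite lee_fin.
  rewrite (ge0_integralZl mu measurableT mF2s F20 F11).
  congr (_ * _); apply: (@ge0_integral_shift13 R X1 (fun X => (nn F2 X)%:E) (mE F2 mF2)) => X. by rewrite lee_fin.
rewrite -qE -ge0_integralZl//; last by rewrite lee_fin mulr_ge0// ltW.
apply: ge0_le_integral => //.
- by move=> X _; rewrite lee_fin addr_ge0 ?sqr_ge0.
- exact: measurable_sqnorm cmeasurable_weighted_convolution.
- exact: measurable_funeM.
move=> X0 _; rewrite weighted_convolutionE /= EFinD.
rewrite (_ : (2 * K)%:E * q X0 = K%:E * q X0 + K%:E * q X0); last first.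
  by rewrite -ge0_muleDl ?lee_fin ?ltW// -EFinD mulr_natl mulr2n.
(* The squared modulus of F1 F2 exceeds the square of either part of the product by the square of
   the other part. *)
apply: leeD; apply: part_le => // X; rewrite /re /im exprMn ler_wpM2l ?sqr_ge0// /nn.
  rewrite -subr_ge0.
  set a := Re (F1 X); set b := Im (F1 X); set c := Re _; set d := Im _.
  by rewrite (_ : _ - _ = (a * d + b * c) ^+ 2)%R ?sqr_ge0//; ring.
rewrite -subr_ge0.
set a := Re (F1 X); set b := Im (F1 X); set c := Re _; set d := Im _.
by rewrite (_ : _ - _ = (a * c - b * d) ^+ 2)%R ?sqr_ge0//; ring.
Qed.
End weighted_convolution.

(** Subtracting a multiple of [omega] from [a] does not change the cross product with [omega]. For
    [b] the difference to an axis point whose distance is within r of the infimum, Lagrange's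
    identity bounds the cross product by |b| <= 2r. *)
Lemma tube_cross_le (R : realType) (r : R) (omega a : R3 R) :
  0 < r -> sphere2 omega -> tube r omega a -> cross_le r omega a.
Proof.
move=> r0 o1 ta; have o1' : norm3 omega = 1 by exact: o1.
have hinf : has_inf [set norm3 (a - b)%R | b in axis omega].
  split; first by exists (norm3 (a - scale3 0 omega)), (scale3 0 omega) => //; exists 0.
  by exists 0 => _ [b _ <-]; exact: norm3_ge0.
have [_ [_ [s _ <-] <-] lt2r] := inf_adherent r0 hinf.
set b := (a - _)%R in lt2r.
have {}lt2r : norm3 b <= 2 * r.
  apply: ltW; apply: lt_le_trans lt2r _.
  by rewrite mulr_natl mulr2n lerD2r; exact: ta.
have b2 : dot3 b b * dot3 omega omega <= (2 * r) ^+ 2.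
  rewrite -!norm3_sqr o1' expr1n mulr1 ler_sqr ?nnegrE ?norm3_ge0//.
  by rewrite mulr_ge0// ltW.
have key (x : R) : x ^+ 2 <= dot3 b b * dot3 omega omega -> `|x| <= 2 * r.
  move=> h; rewrite -ler_sqr ?nnegrE ?mulr_ge0 ?(ltW r0)// real_normK ?num_real//.
  exact: le_trans h b2.
have sq3 (x y z t : R) : t = x ^+ 2 + y ^+ 2 + z ^+ 2 -> [/\ x ^+ 2 <= t, y ^+ 2 <= t & z ^+ 2 <= t].
  by move=> ->; split; nra.
pose cr (i j k l : R) := i * l - j * k.
have [] := sq3 (a.1.1 * omega.1.2 - a.1.2 * omega.1.1) (a.1.1 * omega.2 - a.2 * omega.1.1)
  (a.1.2 * omega.2 - a.2 * omega.1.2) (dot3 b b * dot3 omega omega - dot3 b omega ^+ 2).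
  by rewrite /dot3 /b /scale3 /=; ring.
move=> h1 h2 h3; have dd := sqr_ge0 (dot3 b omega).
by apply/and3P; split; apply: key; [apply: le_trans h1 _|apply: le_trans h2 _|apply: le_trans h3 _];
  rewrite lerBlDr lerDl.
Qed.

(** * The angular bilinear operator *)

Section bilinear_estimate.
Variable R : realType.
Local Notation mu := (@lebesgue13 R).
Local Notation c := ((2 * pi : R) ^+ 4)%R.
Local Open Scope ereal_scope.
Variables (N1 N2 L1 L2 r : R) (s1 s2 : bool) (omega : R3 R) (u1 u2 : R13 R -> R[i]).
Hypotheses (N10 : (0 < N1)%R) (L10 : (0 < L1)%R) (L20 : (0 < L2)%R) (r0 : (0 < r)%R)
  (omega1 : sphere2 omega) (supp1 : supp_fourier_sub u1 (cone_region s1 N1 L1))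
  (supp2 : supp_fourier_sub u2 (cone_region s2 N2 L2)).

Let Pu1 := multiplier [set X | tube r omega X.2] u1.
Let K : R := (3 * 2 ^+ 21 * pi * (r ^+ 2 * (L1 * L2)))%R.

(** In the degenerate alternative of [fourier_multiplier] the transform is zero almost everywhere,
    and the support property holds trivially. *)
Let supp_Pu1 : {ae mu, forall X, ~~ tube_cone omega N1 r L1 s1 X -> fourier Pu1 X = 0%R}.
Proof.
have [E|E] := fourier_multiplier [set X | tube r omega X.2] u1; last first.
  by apply: filterS E => X ->.
move: E supp1; apply: filterS2 => X EX FX nX; rewrite EX.
have [tX|ntX] := pselect (tube r omega X.2); last first.
  by rewrite indicE memNset ?mul0r.
rewrite FX ?mulr0// => -[/andP[n1 n2] cX]; move: nX.
by rewrite /tube_cone n1 n2 cX tube_cross_le.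
Qed.

Let supp_u2 : {ae mu, forall X, ~~ thick_cone L2 s2 X -> fourier u2 X = 0%R}.
Proof.
have S : {ae mu, forall X, ~ cone_region s2 N2 L2 X -> fourier u2 X = 0%R} by exact: supp2.
by apply: filterS S => X FX nX; rewrite FX// => -[_]; exact/negP.
Qed.

Lemma angle_bilinear_hatE : angle_bilinear_hat s1 s2 Pu1 u2 =
  weighted_convolution (fun z => theta12 s1 s2 z.2 (z.1 - z.2)%R) (fourier Pu1) (fourier u2).
Proof. by []. Qed.

Let mtheta : measurable_fun setT
  (fun z : R13 R * R13 R => theta12 s1 s2 z.2 (z.1 - z.2)%R).
Proof. by apply: measurable_theta12 => //; exact: measurable_sub13. Qed.

Lemma cmeasurable_angle_bilinear_hat : cmeasurable (angle_bilinear_hat s1 s2 Pu1 u2).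
Proof.
rewrite angle_bilinear_hatE.
by apply: cmeasurable_weighted_convolution => //; exact: cmeasurable_fourier.
Qed.

Lemma sqnorm_angle_bilinear_hat_le : sqnorm (angle_bilinear_hat s1 s2 Pu1 u2) <=
  (2 * K)%:E * (((4 * c)%:E * sqnorm u1) * ((4 * c)%:E * sqnorm u2)).
Proof.
have K0 : (0 < K)%R by rewrite /K !mulr_gt0// ?exprn_gt0// pi_gt0.
rewrite angle_bilinear_hatE.
apply: (@le_trans _ _ ((2 * K)%:E * (sqnorm (fourier Pu1) * sqnorm (fourier u2)))).
  apply: (@sqnorm_weighted_convolution_le _ _
    (fun z => kernel omega N1 r L1 L2 s1 s2 z.1 z.2)) => //.
  - exact: cmeasurable_fourier.
  - exact: cmeasurable_fourier.
  - by move=> X0; exact: measurable_kernel.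
  - by move=> z; exact: kernel_ge0.
  - by move=> X0; exact: integral_kernel.
  move=> X0; move: supp_Pu1 (ae_reflect13 X0 supp_u2); apply: filterS2 => X P1 P2.
  have [t1|/P1] := boolP (tube_cone omega N1 r L1 s1 X); last by constructor 1.
  have [t2|/P2] := boolP (thick_cone L2 s2 (X0 - X)%R); last by constructor 2.
  by constructor 3; rewrite /kernel /= t1 t2.
apply: lee_pmul.
- by rewrite lee_fin mulr_ge0// ltW.
- by rewrite mule_ge0// sqnorm_ge0.
- by [].
apply: lee_pmul; rewrite ?sqnorm_ge0//.
  exact: sqnorm_fourier_multiplier_le.
exact: sqnorm_fourier_le.
Qed.

End bilinear_estimate.

Local Open Scope complex_scope.

Theorem theorem2p3 (R : realType) :
  exists C : R,
    forall (N1 N2 L1 L2 : R) (s1 s2 : bool) (r : R) (omega : R3 R)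
           (u1 u2 : R13 R -> R[i]),
      0 < N1 -> 0 < N2 -> 0 < L1 -> 0 < L2 -> 0 < r -> sphere2 omega ->
      in_Lp 2 u1 -> in_Lp 2 u2 ->
      supp_fourier_sub u1 (cone_region s1 N1 L1) ->
      supp_fourier_sub u2 (cone_region s2 N2 L2) ->
      let Pu1 := multiplier [set X | tube r omega X.2] u1 in
      in_Lp 2 (angle_bilinear_hat s1 s2 Pu1 u2) /\
      (Lpnorm 2 (angle_bilinear s1 s2 Pu1 u2) <=
        (C * Num.sqrt (r ^+ 2 * L1 * L2))%:E * Lpnorm 2 u1 * Lpnorm 2 u2)%E.
Proof.
(* The factors 4/c of the inverse transform, 4c of each of the two transforms, and 2 for real and
   imaginary parts multiply to 128 c; the bracket is the constant of [integral_kernel]. *)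
pose c : R := (2 * pi) ^+ 4; pose K0 : R := 128 * c * (3 * 2 ^+ 21 * pi).
have c0 : 0 < c by rewrite exprn_gt0// mulr_gt0// pi_gt0.
have K00 : 0 <= K0 by rewrite !mulr_ge0// ?ltW// pi_gt0.
exists (Num.sqrt K0) => N1 N2 L1 L2 s1 s2 r omega u1 u2 N10 _ L10 L20 r0 o1 u1L2 u2L2 S1 S2 /=.
set Pu1 := multiplier _ u1.
have hatL := sqnorm_angle_bilinear_hat_le N10 L10 L20 r0 o1 S1 S2.
rewrite -/Pu1 -/c in hatL.
pose n1 := fine (sqnorm u1); pose n2 := fine (sqnorm u2).
have n10 : 0 <= n1 by rewrite fine_ge0// sqnorm_ge0.
have n20 : 0 <= n2 by rewrite fine_ge0// sqnorm_ge0.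
have E1 : sqnorm u1 = n1%:E by rewrite fineK// ge0_fin_numE ?sqnorm_ge0// sqnorm_lty.
have E2 : sqnorm u2 = n2%:E by rewrite fineK// ge0_fin_numE ?sqnorm_ge0// sqnorm_lty.
rewrite E1 E2 -!EFinM in hatL.
split.
  apply: in_L2P; first exact: cmeasurable_angle_bilinear_hat.
  by apply: le_lt_trans hatL _; rewrite ltry.
have invL : (sqnorm (angle_bilinear s1 s2 Pu1 u2) <=
    (K0 * (r ^+ 2 * L1 * L2) * (n1 * n2))%:E)%E.
  apply: le_trans (sqnorm_inv_fourier_le _) _.
  apply: le_trans (lee_pmul _ _ (lexx _) hatL) _.
  - by rewrite lee_fin divr_ge0// ltW.
  - exact: sqnorm_ge0.
  rewrite -EFinM lee_fin le_eqVlt; apply/orP; left; apply/eqP.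
  by rewrite /K0 -/c; field; rewrite gt_eqF.
have sqrtE (x : R) : 0 <= x -> (x%:E `^ 2^-1 = (Num.sqrt x)%:E)%E.
  by move=> x0; rewrite poweR_EFin powR12_sqrt.
have rL0 : 0 <= r ^+ 2 * L1 * L2 by rewrite !mulr_ge0// ltW// exprn_gt0.
rewrite !Lpnorm2E E1 E2 !sqrtE// -!EFinM.
have -> : Num.sqrt K0 * Num.sqrt (r ^+ 2 * L1 * L2) * Num.sqrt n1 * Num.sqrt n2 =
    Num.sqrt (K0 * (r ^+ 2 * L1 * L2) * (n1 * n2)).
  by rewrite (sqrtrM (n1 * n2) (mulr_ge0 K00 rL0)) (sqrtrM _ K00) (sqrtrM _ n10) mulrA.
have P0 := mulr_ge0 (mulr_ge0 K00 rL0) (mulr_ge0 n10 n20).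
rewrite -(sqrtE _ P0); apply: gt0_ler_poweR; rewrite ?invr_gt0// in_itv/= ?leey ?andbT//.
exact: sqnorm_ge0.
Qed.
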